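(* Let $n\ge 2$, let $u\in S^{n-1}$, and let $H=u^\perp$ be oriented with $u\in H^+$. Let $X=\mathcal{S}(\mathbb{R}^n)$ or $X=\mathcal{V}(\mathbb{R}^n)$ and suppose that $T:X\to X$ is a rearrangement. If the induced map $\diamondsuit_T:\mathcal{L}^n\to\mathcal{L}^n$, defined by $\diamondsuit_TA=\{x:T1_A(x)=1\}$ for $A\in\mathcal{L}^n$, is perimeter preserving on convex bodies and invariant on $H$-symmetric unions of two disjoint balls, then $T$ essentially equals $\mathrm{Id}$, $\dagger$, $P_H$, or $P_H^\dagger$.
   Context: $\mathcal{H}^n$ is $n$-dimensional Hausdorff (Lebesgue) measure on $\mathbb{R}^n$; ''essentially'' means up to a set of $\mathcal{H}^n$-measure zero. $\mathcal{L}^n$ is the class of $\mathcal{H}^n$-measurable sets of finite $\mathcal{H}^n$-measure in $\mathbb{R}^n$; $\mathcal{K}^n_n$ is the class of convex bodies (compact convex sets with interior points); $1_A$ is the characteristic function of $A$. $S^{n-1}$ is the unit sphere and $u^\perp$ is the hyperplane through the origin orthogonal to $u$. ''Ball'' means closed $n$-dimensional ball (positive radius). $\mathcal{S}(\mathbb{R}^n)$ is the set of real-valued $\mathcal{H}^n$-measurable functions $f$ on $\mathbb{R}^n$ with $\mathcal{H}^n(\{x:f(x)>t\})<\infty$ for all real $t>\operatorname{ess\,inf} f$ (where $\operatorname{ess\,inf} f=-\infty$ is allowed). $\mathcal{V}(\mathbb{R}^n)$ is the set of nonnegative real-valued measurable $f$ with $\mathcal{H}^n(\{x:f(x)>t\})<\infty$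 for all $t>0$. A map $T:X\to X$ is equimeasurable if $\mathcal{H}^n(\{x:Tf(x)>t\})=\mathcal{H}^n(\{x:f(x)>t\})$ for all $f\in X$ and $t\in\mathbb{R}$; monotonic if for $f,g\in X$, $f\le g$ essentially implies $Tf\le Tg$ essentially; a rearrangement if it is equimeasurable and monotonic. Two maps $T_0,T_1:X\to X$ are essentially equal if for each $f\in X$, $T_0f(x)=T_1f(x)$ for $\mathcal{H}^n$-almost all $x$ (the exceptional set may depend on $f$). For equimeasurable $T$, $\diamondsuit_T$ is well defined. $\diamondsuit_T$ is perimeter preserving on convex bodies if for each $K\in\mathcal{K}^n_n$, $\diamondsuit_TK$ is a set of finite perimeter and $S(\diamondsuit_TK)=S(K)$, where $S$ denotes perimeter (in the sense of De Giorgi; for a convex body $S(K)$ is its surface area). It is invariant on $H$-symmetric unions of two disjoint balls if $\diamondsuit_TK=K$, essentially, whenever $K$ is a union of two disjoint balls that is symmetric with respect to reflection in $H$. $H^+$ is the closed half-space bounded by $H$ containing $u$, and $H^-$ is the other one. $x^\dagger$ is the reflection of $x$ in $H$ and $f^\dagger(x)=f(x^\dagger)$. $\mathrm{Id}$ is the identity map; $\dagger$ is the map $f\mapsto f^\dagger$; $P_H$ (polarization) is given by $P_Hf(x)=\max\{f(x),f(x^\dagger)\}$ if $x\in H^+$ and $P_Hf(x)=\min\{f(x),f(x^\dagger)\}$ if $x\in H^-$; $P_H^\dagger f=(P_Hf)^\dagger$. *)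

(* Defs.v *)
From HB Require Import structures.
From mathcomp Require Import all_boot all_order all_algebra.
From mathcomp Require Import all_classical all_reals all_analysis ess_sup_inf.

Set Implicit Arguments.
Unset Strict Implicit.
Unset Printing Implicit Defensive.

Import Order.TTheory GRing.Theory Num.Def Num.Theory.
Import numFieldNormedType.Exports.

Local Open Scope classical_set_scope.
Local Open Scope ring_scope.

(* R^n is 'rV[R]_n.  The library norm `|x| on row vectors is the sup norm, so
   the Euclidean norm is defined separately; the topologies agree. *)
Section euclidean.
Context {R : realType} {n : nat}.
Implicit Types x y u c : 'rV[R]_n.

Definition dotp x y : R := \sum_(i < n) x 0 i * y 0 i.

Definition enorm x : R := Num.sqrt (dotp x x).

Definition eball c (r : R) : set 'rV[R]_n := [set x | enorm (x - c) <= r].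

Definition is_ball (B : set 'rV[R]_n) : Prop :=
  exists c, exists2 r : R, 0 < r & B = eball c r.

(* Reflection in the hyperplane orthogonal to the unit vector u. *)
Definition refl u x : 'rV[R]_n := x - (2 * dotp x u) *: u.

Definition reflf u (f : 'rV[R]_n -> R) : 'rV[R]_n -> R := fun x => f (refl u x).

(* The two cases overlap on the hyperplane dotp x u = 0, where x is its own
   reflection and both formulas give f x. *)
Definition polarization u (f : 'rV[R]_n -> R) : 'rV[R]_n -> R := fun x =>
  if 0 <= dotp x u then Num.max (f x) (f (refl u x))
  else Num.min (f x) (f (refl u x)).

Definition convex_body (K : set 'rV[R]_n) : Prop :=
  [/\ compact K, convex_set (K : set (convex_lmodType 'rV[R]_n))
    & interior K !=set0].

Definition symmetric_two_balls u (K : set 'rV[R]_n) : Prop :=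
  (exists B1 B2, [/\ is_ball B1, is_ball B2, B1 `&` B2 = set0
    & K = B1 `|` B2]) /\ refl u @` K = K.

End euclidean.

(* Lebesgue outer measure: infimum of the total volumes of the countable
   families of closed boxes covering X. *)
Section lebesgue_outer.
Context {R : realType} {n : nat}.

Definition box (ab : 'rV[R]_n * 'rV[R]_n) : set 'rV[R]_n :=
  [set x | forall i, ab.1 0 i <= x 0 i <= ab.2 0 i].

Definition box_volume (ab : 'rV[R]_n * 'rV[R]_n) : R :=
  \prod_(i < n) Num.max (ab.2 0 i - ab.1 0 i) 0.

Definition box_cover (X : set 'rV[R]_n) : set (set ('rV[R]_n * 'rV[R]_n)) :=
  [set C | countable C /\ X `<=` \bigcup_(ab in C) box ab].

Definition lebesgue_outer (X : set 'rV[R]_n) : \bar R :=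
  ereal_inf [set (\esum_(ab in C) (box_volume ab)%:E)%E | C in box_cover X].

Local Open Scope ereal_scope.

Lemma box_volume_ge0 ab : 0 <= (box_volume ab)%:E.
Proof.
by rewrite lee_fin; apply: prodr_ge0 => i _; rewrite le_max lexx orbT.
Qed.

Lemma lebesgue_outer_ge0 X : 0 <= lebesgue_outer X.
Proof.
apply: le_ereal_inf_tmp => _ [C _ <-].
by apply: esum_ge0 => ab _; exact: box_volume_ge0.
Qed.

Lemma lebesgue_outer0 : lebesgue_outer set0 = 0.
Proof.
apply/eqP; rewrite eq_le lebesgue_outer_ge0 andbT.
apply: ereal_inf_lbound; exists set0; last by rewrite esum_set0.
by split=> //; exact: countable0.
Qed.

Lemma le_lebesgue_outer :
  {homo lebesgue_outer : X Y / X `<=` Y >-> X <= Y}.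
Proof.
move=> X Y XY; apply: ereal_inf_le_tmp => _ [C [cC YC] <-].
by exists C => //; split=> //; exact: subset_trans YC.
Qed.

Lemma lebesgue_outer_sigma_subadditive : sigma_subadditive lebesgue_outer.
Proof.
move=> A; have [[i ioo]|] := pselect (exists i, lebesgue_outer (A i) = +oo).
  rewrite (eseries_pinfty _ _ ioo) ?leey// => k _.
  by rewrite -ltNye (lt_le_trans _ (lebesgue_outer_ge0 _)).
rewrite -forallNE => Aoo.
suff add2e (e : {posnum R}) : lebesgue_outer (\bigcup_k A k) <=
    \sum_(i <oo) lebesgue_outer (A i) + e%:num%:E.
  by apply/lee_addgt0Pr => _/posnumP[].
rewrite (le_trans _ (epsilon_trick _ _ _))//; last first.
  by move=> k; exact: lebesgue_outer_ge0.
pose P k C := box_cover (A k) C /\ \esum_(ab in C) (box_volume ab)%:E <=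
  lebesgue_outer (A k) + (e%:num / (2 ^ k.+1)%:R)%:E.
have [G PG] : {G : nat -> set ('rV[R]_n * 'rV[R]_n) & forall k, P k (G k)}.
  apply: (@choice _ _ P) => k; rewrite /P.
  have fk : lebesgue_outer (A k) \is a fin_num.
    by rewrite ge0_fin_numE ?lebesgue_outer_ge0// ltey; apply/eqP/Aoo.
  have ek : (0 < e%:num / (2 ^ k.+1)%:R)%R by [].
  have [_ [C CA <-] Clt] := lb_ereal_inf_adherent ek fk.
  by exists C; split=> //; exact: ltW.
pose D := seqDU G.
have DG k : D k `<=` G k by exact: subset_seqDU.
apply: (@le_trans _ _ (\esum_(ab in \bigcup_k D k) (box_volume ab)%:E)).
  apply: ereal_inf_lbound; exists (\bigcup_k D k) => //; split.
    apply: bigcup_countable => // k _.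
    by apply: (sub_countable (subset_card_le (DG k))); exact: (PG k).1.1.
  rewrite /D -seqDU_bigcup_eq => x [k _ Akx].
  have [ab Gab abx] := (PG k).1.2 x Akx.
  by exists ab => //; exists k.
rewrite esum_bigcupT; [|exact: trivIset_seqDU|exact: box_volume_ge0].
rewrite -nneseries_esumT; last first.
  by move=> k; apply: esum_ge0 => ab _; exact: box_volume_ge0.
apply: lee_nneseries => [k _ _|k _].
  by apply: esum_ge0 => ab _; exact: box_volume_ge0.
apply: le_trans (PG k).2.
apply: ereal_sup_le => _ [F [finF FD] <-]; exists F => //.
by split=> //; exact: subset_trans FD (DG k).
Qed.

HB.instance Definition _ := isOuterMeasure.Build R 'rV[R]_n lebesgue_outer
  lebesgue_outer0 lebesgue_outer_ge0 le_lebesgue_outer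
  lebesgue_outer_sigma_subadditive.

End lebesgue_outer.

(* R^n with the sigma-algebra of Lebesgue (Caratheodory) measurable sets, and
   the n-dimensional Lebesgue measure on it. *)
Notation Rn R n := (caratheodory_type (@lebesgue_outer R n)).

Definition lebesgue_n {R : realType} {n : nat} : set (Rn R n) -> \bar R :=
  @lebesgue_outer R n.
HB.instance Definition _ (R : realType) (n : nat) :=
  isMeasure.Build _ _ _ (@lebesgue_n R n)
    (@caratheodory_measure0 _ _ (@lebesgue_outer R n))
    (@caratheodory_measure_ge0 _ _ (@lebesgue_outer R n))
    (@caratheodory_measure_sigma_additive _ _ (@lebesgue_outer R n)).

Section perimeter.
Context {R : realType} {n : nat}.

Definition C1_field (phi : 'rV[R]_n -> 'rV[R]_n) : Prop :=
  forall i : 'I_n, (forall x, derivable phi x (delta_mx 0 i)) /\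
    continuous (fun x => 'D_(delta_mx 0 i) phi x).

Definition compact_support (phi : 'rV[R]_n -> 'rV[R]_n) : Prop :=
  compact (closure [set x | phi x != 0]).

Definition divergence (phi : 'rV[R]_n -> 'rV[R]_n) (x : 'rV[R]_n) : R :=
  \sum_(i < n) ('D_(delta_mx 0 i) phi x) 0 i.

Definition test_field : set ('rV[R]_n -> 'rV[R]_n) :=
  [set phi | [/\ C1_field phi, compact_support phi
               & forall x, enorm (phi x) <= 1]].

(* De Giorgi's perimeter. *)
Definition perimeter (E : set 'rV[R]_n) : \bar R :=
  ereal_sup [set (\int[lebesgue_n]_(x in (E : set (Rn R n)))
                    (divergence phi x)%:E)%E | phi in test_field].

Definition finite_perimeter (E : set 'rV[R]_n) : Prop :=
  measurable (E : set (Rn R n)) /\ (perimeter E < +oo)%E.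

End perimeter.

Section rearrangement.
Context {R : realType} {n : nat}.
Implicit Types (f g : 'rV[R]_n -> R) (X : set ('rV[R]_n -> R))
  (T : ('rV[R]_n -> R) -> ('rV[R]_n -> R)).

Definition ess_le f g : Prop := {ae @lebesgue_n R n, forall x, f x <= g x}.

Definition ess_eq f g : Prop := {ae @lebesgue_n R n, forall x, f x = g x}.

Definition ess_eq_set (A B : set 'rV[R]_n) : Prop :=
  {ae @lebesgue_n R n, forall x, A x <-> B x}.

Definition class_S : set ('rV[R]_n -> R) :=
  [set f : 'rV[R]_n -> R | measurable_fun [set: Rn R n] (f : Rn R n -> R) /\
    forall t : R, (ess_inf (@lebesgue_n R n) (EFin \o f) < t%:E)%E ->
      (lebesgue_n [set x | (t < f x)%R] < +oo)%E].

Definition class_V : set ('rV[R]_n -> R) :=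
  [set f : 'rV[R]_n -> R |
    [/\ measurable_fun [set: Rn R n] (f : Rn R n -> R),
    (forall x, 0 <= f x) &
    forall t : R, 0 < t -> (lebesgue_n [set x | (t < f x)%R] < +oo)%E]].

(* A map X -> X is represented by a map on all functions that sends X into X;
   its values outside X play no role. *)
Definition maps_into X T : Prop := forall f, X f -> X (T f).

Definition equimeasurable X T : Prop := forall f, X f -> forall t : R,
  lebesgue_n [set x | t < T f x] = lebesgue_n [set x | t < f x].

Definition monotonic X T : Prop := forall f g, X f -> X g ->
  ess_le f g -> ess_le (T f) (T g).

Definition rearrangement X T : Prop :=
  [/\ maps_into X T, equimeasurable X T & monotonic X T].

Definition ess_eq_map X T0 T1 : Prop := forall f, X f -> ess_eq (T0 f) (T1 f).

Definition diamond T (A : set 'rV[R]_n) : set 'rV[R]_n :=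
  [set x | T (\1_A) x = 1].

Definition perimeter_preserving_on_convex_bodies
    (D : set 'rV[R]_n -> set 'rV[R]_n) : Prop :=
  forall K, convex_body K ->
    finite_perimeter (D K) /\ perimeter (D K) = perimeter K.

Definition invariant_on_symmetric_two_balls (u : 'rV[R]_n)
    (D : set 'rV[R]_n -> set 'rV[R]_n) : Prop :=
  forall K, symmetric_two_balls u K -> ess_eq_set (D K) K.

End rearrangement.

(* Main.v *)
Require Import Defs.
From mathcomp Require Import all_boot all_order all_algebra.
From mathcomp Require Import all_classical all_reals all_analysis ess_sup_inf.
From mathcomp Require Import ring lra measurable_realfun.

(** T is determined by its action on sets. Let f be in X and let {f > t} have
    finite measure. Truncations of f and functions with two values lead from f
    to the indicator of {f > t} through functions which are comparable in pairs
    and share that superlevel set, and a rearrangement keeps the superlevel sets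
    of such functions equal up to null sets. So {T f > t} is the diamond of
    {f > t} ([above_diamond]), and the task is to find the diamond, a map D on
    sets of finite measure which is monotonic and measure preserving
    ([ess_eq_map_of_sets], [D_classification]).

    D fixes the sets that are symmetric about the hyperplane H: off H, a
    symmetric open set is a countable union of pairs of disjoint balls exchanged
    by the reflection, so it is contained in its image, and equal to it because
    the measures agree; outer regularity does the rest ([D_symmetric]).

    The core of the proof is that D maps a ball B that misses H, with radius r
    and reflection B', either to B or to B' ([D_ball]). Put E = D B. Then E lies
    in the union of B and B', by monotonicity, and E has the measure and the
    perimeter of B. The field which is (x - c) / r on B and (x - c') / r on B'
    has norm at most 1 and divergence n / r, so
      P(E) >= (n / r) |E| = (n / r) |B| >= P(B) = P(E),
    the second inequality being [perimeter_eball_le]. Hence this field maximizes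
    the flux among all test fields. Inside B its norm is less than 1, so that
    small multiples, of either sign, of zeta v may be added to it, where zeta is
    a smooth function supported inside B and v is a vector. It follows that the
    integral over E of the derivative of zeta along v is zero
    ([calibration_stationary]). In other words the measure of E `&` A does not
    change when A is moved inside B. A translation invariant content on boxes is
    a multiple of the volume ([box_content_unique]), so E has a constant density
    in B; if the density is less than 1, comparing the measure of the part of E
    in a box with itself shows that it is 0. So B is, up to null sets, disjoint
    from E or contained in E ([ball_dichotomy]).

    Any two balls of an open half-space bounded by H lie in a third one, so all
    balls of the half-space are treated alike, and then so are all its sets
    ([half_space_sets]). The two choices for each of the two half-spaces give
    the identity, the reflection and the two polarizations: in each case D A
    contains the image of A under the candidate, which is at least as large as
    A.

    Lebesgue measure is given as an infimum over coverings by coordinate boxes.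
    The facts about it that are used, such as the invariance under reflections
    in arbitrary hyperplanes ([lebesgue_outer_refl]), are derived from that; the
    latter rests on the same uniqueness of translation invariant contents. *)

Set Implicit Arguments.
Unset Strict Implicit.
Unset Printing Implicit Defensive.

Import Order.TTheory GRing.Theory Num.Def Num.Theory.
Import numFieldNormedType.Exports.

Local Open Scope classical_set_scope.
Local Open Scope ring_scope.

(** * Box coverings and measurable sets *)

Section boxes.
Context {R : realType} {n : nat}.
Implicit Types (a b : 'rV[R]_n) (ab : 'rV[R]_n * 'rV[R]_n) (X : set 'rV[R]_n).

Definition set_coord a (i : 'I_n) (t : R) : 'rV[R]_n :=
  \row_j (if j == i then t else a 0 j).

Lemma set_coord_eq a i t : set_coord a i t 0 i = t.
Proof. by rewrite mxE eqxx. Qed.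

Lemma set_coord_neq a i t j : j != i -> set_coord a i t 0 j = a 0 j.
Proof. by rewrite mxE => /negbTE ->. Qed.

Lemma le_outer_box ab : (lebesgue_outer (box ab) <= (box_volume ab)%:E)%E.
Proof.
apply: ereal_inf_lbound; exists [set ab].
  split; first exact: countable1.
  by move=> x abx; exists ab.
by rewrite esum_set1 ?box_volume_ge0.
Qed.

Lemma box_volume_degenerate (i : 'I_n) ab : ab.2 0 i <= ab.1 0 i ->
  box_volume ab = 0.
Proof.
move=> abi; rewrite /box_volume (bigD1 i)//=.
by rewrite max_r ?mul0r// subr_le0.
Qed.

(** Sequences are more convenient than countable families, and lose nothing in
    positive dimension: the missing terms are filled with degenerate boxes. *)
Lemma box_cover_seq (n0 : (0 < n)%N) X (e : R) : (lebesgue_outer X < +oo)%E ->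
  0 < e -> exists F : nat -> 'rV[R]_n * 'rV[R]_n,
    X `<=` \bigcup_k box (F k) /\
    (\sum_(0 <= k <oo) (box_volume (F k))%:E <= lebesgue_outer X + e%:E)%E.
Proof.
move=> Xoo e0.
have Xfin : lebesgue_outer X \is a fin_num.
  by rewrite ge0_fin_numE ?lebesgue_outer_ge0.
have [_ [C [cC XC] <-] Clt] := lb_ereal_inf_adherent e0 Xfin.
have /countable_injP[f finj] := cC.
pose i0 : 'I_n := Ordinal n0.
have vol0 : box_volume (0 : 'rV[R]_n, 0 : 'rV[R]_n) = 0.
  by apply: (@box_volume_degenerate i0).
pose F k := if pselect (exists2 c, C c & f c = k) is left h
            then s2val (cid2 h) else (0, 0).
have Ff c : C c -> F (f c) = c.
  move=> Cc; rewrite /F; case: pselect => [h|[]]; last by exists c.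
  case: (cid2 h) => c' Cc' /= ff; apply: finj => //; exact/mem_set.
exists F; split.
  by move=> x /XC[c Cc cx]; exists (f c) => //; rewrite Ff.
apply: le_trans (ltW Clt).
have h0 k : (0 <= (box_volume (F k))%:E)%E by exact: box_volume_ge0.
rewrite nneseries_esumT//.
rewrite (_ : \esum_(i in C) _ = \esum_(k in f @` C) (box_volume (F k))%:E)%E.
  rewrite [leRHS]esum_mkcond; apply: le_esum => k _ /=.
  case: ifPn => // /negP kC.
  rewrite /F; case: pselect => [[c Cc ck]|_]; last by rewrite vol0.
  by exfalso; apply: kC; apply/mem_set; exists c.
rewrite (@reindex_esum R _ _ C (f @` C) f).
  by apply: eq_esum => c Cc; rewrite Ff.
by split.
Qed.

Lemma lebesgue_outer_le_series (F : nat -> 'rV[R]_n * 'rV[R]_n) X :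
  X `<=` \bigcup_k box (F k) ->
  (lebesgue_outer X <= \sum_(0 <= k <oo) (box_volume (F k))%:E)%E.
Proof.
move=> XF; apply: le_trans (le_lebesgue_outer XF) _.
apply: le_trans (lebesgue_outer_sigma_subadditive _) _.
by apply: lee_nneseries => k _ *; [exact: lebesgue_outer_ge0|exact: le_outer_box].
Qed.

End boxes.

Section measurability.
Context {R : realType} {n : nat}.
Implicit Types (X : set 'rV[R]_n).

Let splitmaxr (a b t : R) : maxr (minr b t - a) 0 + maxr (b - maxr a t) 0 =
  maxr (b - a) 0.
Proof.
have [?|?] := leP b t; have [?|?] := leP a t; rewrite /Order.max;
  by repeat (case: ifPn; rewrite -?leNgt => ?); lra.
Qed.

Lemma box_volume_split (i : 'I_n) (t : R) (a b : 'rV[R]_n) :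
  box_volume (a, set_coord b i (minr (b 0 i) t)) +
  box_volume (set_coord a i (maxr (a 0 i) t), b) = box_volume (a, b).
Proof.
rewrite /box_volume (bigD1 i)//= [X in _ + X](bigD1 i)//= [RHS](bigD1 i)//=.
rewrite !set_coord_eq -(splitmaxr (a 0 i) (b 0 i) t) mulrDl.
by congr (_ * _ + _ * _); apply: eq_bigr => j ji; rewrite set_coord_neq.
Qed.

(** The hyperplane cuts each box of a cover into two boxes, whose volumes add
    up to that of the box. *)
Lemma measurable_coord_le (i : 'I_n) (t : R) :
  measurable ([set x | x 0 i <= t] : set (Rn R n)).
Proof.
have n0 : (0 < n)%N by case: n i => // -[].
apply: le_caratheodory_measurable => X.
have [Xoo|] := ltP (lebesgue_outer X) +oo%E; last first.
  by rewrite leye_eq => /eqP Xoo; rewrite [leRHS]Xoo leey.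
apply/lee_addgt0Pr => e e0.
have [F [XF Fle]] := box_cover_seq n0 Xoo e0.
apply: le_trans Fle.
pose L k := ((F k).1, set_coord (F k).2 i (minr ((F k).2 0 i) t)).
pose G k := (set_coord (F k).1 i (maxr ((F k).1 0 i) t), (F k).2).
have -> : (\sum_(0 <= k <oo) (box_volume (F k))%:E =
  \sum_(0 <= k <oo) (box_volume (L k))%:E +
  \sum_(0 <= k <oo) (box_volume (G k))%:E)%E.
  rewrite -nneseriesD; do ?by move=> *; exact: box_volume_ge0.
  apply: eq_eseriesr => k _; rewrite -EFinD /L /G box_volume_split.
  by case: (F k).
apply: leeD; apply: lebesgue_outer_le_series => x [/XF[k _ Fx]] /= xt;
  exists k => // j /=; have := Fx j; rewrite mxE; case: eqP => [->|_] //.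
  by rewrite le_min xt => /andP[-> ->].
move/negP: xt; rewrite -ltNge => /ltW xt.
by rewrite ge_max xt => /andP[-> ->].
Qed.

Lemma measurable_coord (i : 'I_n) :
  measurable_fun [set: Rn R n] (fun x : Rn R n => (x : 'rV[R]_n) 0 i).
Proof.
apply: (measurability _ (RGenOInfty.measurableE R)) => /= _ [_ [t ->] <-].
rewrite setTI.
rewrite (_ : _ @^-1` _ = ~` [set x : Rn R n | (x : 'rV[R]_n) 0 i <= t]).
  exact/measurableC/measurable_coord_le.
by apply/seteqP; split=> x /=; rewrite in_itv/= andbT ltNge => /negP.
Qed.

Lemma rV_ballE (x : 'rV[R]_n) e : 0 < e ->
  ball x e = [set y | forall i, `|x 0 i - y 0 i| < e].
Proof.
move=> e0; apply/seteqP; split=> y /=; first by move=> [_ h] i; exact: h.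
by move=> h; split=> // i j; rewrite ord1; exact: h.
Qed.

Lemma measurable_rV_ball (x : 'rV[R]_n) e : measurable (ball x e : set (Rn R n)).
Proof.
have [e0|e0] := ltP 0 e; last first.
  rewrite (_ : ball x e = set0)//; apply/seteqP; split=> // y /=.
  by move=> [e1]; have := lt_le_trans e1 e0; rewrite ltxx.
rewrite rV_ballE//.
rewrite [X in measurable X](_ : _ = \bigcap_(i in [set: 'I_n])
   ((fun y : Rn R n => (y : 'rV[R]_n) 0 i) @^-1` (ball (x 0 i) e))); last first.
  apply/seteqP; split=> y /=; first by move=> h i _; exact: h.
  by move=> h i; exact: h.
apply: fin_bigcap_measurable => // i _.
rewrite -[X in measurable X]setTI; apply: measurable_coord => //.
exact: measurable_ball.
Qed.

(** Lindelof property: points with rational coordinates and balls with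
    radii 1/k form a countable base. *)
Lemma rV_lindelof (O : set 'rV[R]_n) (V : 'rV[R]_n -> set 'rV[R]_n) :
  (forall x, O x -> nbhs x (V x)) -> O !=set0 ->
  exists s : nat -> 'rV[R]_n, (forall k, O (s k)) /\
    O `<=` \bigcup_k V (s k).
Proof.
move=> OV [x0 Ox0].
pose P (qk : 'rV[rat]_n * nat) y := O y /\
  ball (map_mx (@ratr R) qk.1) qk.2.+1%:R^-1 `<=` V y.
pose g qk := if pselect (exists y, P qk y) is left h then sval (cid h) else x0.
pose s k := if unpickle k is Some qk then g qk else x0.
exists s; split.
  move=> k; rewrite /s; case: unpickle => // qk; rewrite /g.
  by case: pselect => // h; case: (cid h) => y [].
move=> x Ox.
have /nbhs_ballP[e /= e0 eV] := OV x Ox.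
have [k ke] : exists k, k.+1%:R^-1 < e / 2.
  have e20 : 0 < e / 2 by rewrite divr_gt0.
  by have [k _ /(_ _ (leqnn k))] := near_infty_natSinv_lt (PosNum e20); exists k.
have k0 : 0 < k.+1%:R^-1 :> R by rewrite invr_gt0.
have [q Hq] : exists q : 'rV[rat]_n, forall i, `|ratr (q 0 i) - x 0 i| < k.+1%:R^-1.
  have h i : {q : rat | `|ratr q - x 0 i| < k.+1%:R^-1}.
    apply: cid; have := @rat_in_itvoo R (x 0 i) (x 0 i + k.+1%:R^-1).
    rewrite ltrDl => /(_ k0)[q]; rewrite in_itv/= => /andP[h1 h2].
    exists q; move: h1 h2 k0; move: (ratr q) _^-1 => z d h1 h2 d0.
    by rewrite ltr_norml; apply/andP; split; lra.
  exists (\row_i sval (h i)) => i; rewrite mxE; exact: (svalP (h i)).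
have Pq : exists y, P (q, k) y.
  exists x; split=> // y; rewrite rV_ballE//= => yq; apply: eV.
  rewrite rV_ballE//= => i; have := yq i; have := Hq i; rewrite !mxE/=.
  move: ke; move: (ratr _) _^-1 (y 0 i) => z d yi de.
  by rewrite !ltr_norml => /andP[? ?] /andP[? ?]; apply/andP; split; lra.
exists (pickle (q, k)) => //; rewrite /s pickleK /g.
case: pselect => // h; case: (cid h) => y [Oy] /=; apply.
by rewrite rV_ballE//= => i; rewrite mxE; exact: Hq.
Qed.

Lemma open_measurable_rV (O : set 'rV[R]_n) : open O ->
  measurable (O : set (Rn R n)).
Proof.
move=> oO; have [->|/set0P O0] := eqVneq O set0; first exact: measurable0.
have h x : O x -> {e : R | 0 < e & ball x e `<=` O}.
  move=> Ox; apply: cid2; have := oO x Ox; rewrite /interior /= => /nbhs_ballP.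
  by move=> [e e0 eO]; exists e.
pose r x := if pselect (O x) is left Ox then s2val (h x Ox) else 1.
have [|s [Os Ocov]] := @rV_lindelof O (fun x => ball x (r x)) _ O0.
  move=> x Ox; apply: nbhsx_ballx; rewrite /r; case: pselect => // Ox'.
  by case: (h x Ox').
rewrite (_ : O = \bigcup_k ball (s k) (r (s k))).
  by apply: bigcupT_measurable => k; exact: measurable_rV_ball.
apply/seteqP; split=> // x [k _]; rewrite /r; case: pselect => // Osk.
by case: (h _ _) => e e0 /=; apply.
Qed.

Lemma closed_measurable_rV (O : set 'rV[R]_n) : closed O ->
  measurable (O : set (Rn R n)).
Proof.
move=> cO; rewrite -(setCK O); apply: measurableC; apply: open_measurable_rV.
exact: closed_openC.
Qed.

Lemma continuous_measurable_rV (f : 'rV[R]_n -> R) : continuous f ->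
  measurable_fun [set: Rn R n] (f : Rn R n -> R).
Proof.
move=> /continuousP cf.
apply: (measurability _ (RGenOpens.measurableE R)) => /= _ [_ [a [b ->]] <-].
rewrite setTI; apply: open_measurable_rV; apply: cf; exact: interval_open.
Qed.

End measurability.

(** * Translations and outer regularity *)

Section translation.
Context {R : realType} {n : nat} (n0 : (0 < n)%N).
Implicit Types (X : set 'rV[R]_n) (v : 'rV[R]_n).

Lemma lebesgue_outer_translate_le v X :
  (lebesgue_outer [set x | X (x + v)%R] <= lebesgue_outer X)%E.
Proof.
have [Xoo|] := ltP (lebesgue_outer X) +oo%E; last first.
  by rewrite leye_eq => /eqP Xoo; rewrite [leRHS]Xoo leey.
apply/lee_addgt0Pr => e e0.
have [F [XF Fle]] := box_cover_seq n0 Xoo e0.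
apply: le_trans Fle.
pose G k := ((F k).1 - v, (F k).2 - v).
rewrite (@eq_eseriesr _ _ (fun k => (box_volume (G k))%:E)); last first.
  move=> k _; congr (_%:E); apply: eq_bigr => i _.
  by rewrite !mxE; congr Num.max; rewrite /=; ring.
apply: lebesgue_outer_le_series => x /XF[k _ h]; exists k => // i.
by have := h i; rewrite !mxE lerBlDr lerBrDr.
Qed.

Lemma lebesgue_outer_translate v X :
  lebesgue_outer [set x | X (x + v)%R] = lebesgue_outer X.
Proof.
apply/eqP; rewrite eq_le lebesgue_outer_translate_le/=.
rewrite -[in leLHS](_ : [set x | [set y | X (y + v)%R] (x - v)%R] = X).
  exact: lebesgue_outer_translate_le.
by apply/seteqP; split=> x /=; rewrite subrK.
Qed.

Lemma measurable_translate v (A : set (Rn R n)) : measurable A ->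
  measurable ([set x | A ((x : 'rV[R]_n) + v)] : set (Rn R n)).
Proof.
move=> mA; apply: le_caratheodory_measurable => X.
pose Y : set 'rV[R]_n := [set x | X (x - v)].
have YX Z : lebesgue_outer [set x : 'rV[R]_n | Z (x - v)] = lebesgue_outer Z.
  exact: lebesgue_outer_translate.
rewrite -[leRHS]YX -[X in (X + _)%E]YX -[X in (_ + X)%E]YX.
rewrite [leRHS](mA _); apply: leeD; apply: le_lebesgue_outer => x /=.
  by rewrite subrK.
by rewrite subrK.
Qed.

(** Infinitely many disjoint sets, each at least as large as S, do not fit into
    a set of finite measure unless S is a null set. *)
Lemma null_of_disjoint_copies (S B : set (Rn R n)) (A : nat -> set (Rn R n)) :
  measurable B -> (lebesgue_outer B < +oo)%E ->
  (forall k, measurable (A k)) -> trivIset [set: nat] A ->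
  (forall k, A k `<=` B) ->
  (forall k, lebesgue_outer S <= lebesgue_outer (A k))%E ->
  lebesgue_outer S = 0%E.
Proof.
move=> mB Boo mA tA AB SA.
have mAU : measurable (\bigcup_k A k) by exact: bigcupT_measurable.
have := measure_semi_bigcup (@lebesgue_n R n) mA tA mAU => Aeq.
have SfE : lebesgue_outer S \is a fin_num.
  rewrite ge0_fin_numE ?lebesgue_outer_ge0//; apply: le_lt_trans (SA 0%N) _.
  by apply: le_lt_trans Boo; exact: le_lebesgue_outer (AB 0%N).
have BfE : lebesgue_outer B \is a fin_num.
  by rewrite ge0_fin_numE ?lebesgue_outer_ge0.
have h N : N%:R * fine (lebesgue_outer S) <= fine (lebesgue_outer B).
  rewrite -lee_fin EFinM !fineK// mule_natl.
  apply: (@le_trans _ _ (lebesgue_outer (\bigcup_k A k))); last first.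
    by apply: le_lebesgue_outer => x [k _ /AB].
  rewrite [leRHS]Aeq; apply: le_trans (nneseries_lim_ge N _); last first.
    by move=> *; exact: lebesgue_outer_ge0.
  apply: (@le_trans _ _ (\sum_(0 <= k < N) lebesgue_outer S)%E).
    by rewrite sumr_const_nat subn0.
  by apply: lee_sum => k _; exact: SA.
have s0 : 0 <= fine (lebesgue_outer S) by rewrite fine_ge0// lebesgue_outer_ge0.
apply/eqP; rewrite -(fineK SfE) eqe eq_le s0 andbT leNgt; apply/negP => s1.
have [N _ /(_ N (leqnn N))] :=
  nbhs_infty_gtr (fine (lebesgue_outer B) / fine (lebesgue_outer S)).
by rewrite /= ltr_pdivrMr// ltNge h.
Qed.

(** For hyperplanes and slabs the disjoint copies are translates. *)
Lemma null_disjoint_translates (S B : set (Rn R n)) (v : nat -> 'rV[R]_n) :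
  measurable S -> measurable B -> (lebesgue_outer B < +oo)%E ->
  trivIset [set: nat] (fun k => [set x | S ((x : 'rV[R]_n) + v k)]) ->
  (forall k, [set x | S ((x : 'rV[R]_n) + v k)] `<=` B) ->
  lebesgue_outer S = 0%E.
Proof.
move=> mS mB Boo tS SB.
apply: (null_of_disjoint_copies (A := fun k => [set x | S ((x : 'rV[R]_n) + v k)])
  mB Boo) => // k; first exact: measurable_translate.
by rewrite lebesgue_outer_translate.
Qed.

(** Contracting the boxes of a cover does not increase their volumes. This
    compares a sphere with larger concentric ones. *)
Lemma lebesgue_outer_shrink_le (s : R) X : 1 <= s ->
  (lebesgue_outer [set x | X (s *: x)%R] <= lebesgue_outer X)%E.
Proof.
move=> s1; have s0 : 0 < s by apply: lt_le_trans s1.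
have [Xoo|] := ltP (lebesgue_outer X) +oo%E; last first.
  by rewrite leye_eq => /eqP Xoo; rewrite [leRHS]Xoo leey.
apply/lee_addgt0Pr => e e0.
have [F [XF Fle]] := box_cover_seq n0 Xoo e0.
apply: le_trans Fle.
pose G k := (s^-1 *: (F k).1, s^-1 *: (F k).2).
apply: (@le_trans _ _ (\sum_(0 <= k <oo) (box_volume (G k))%:E)%E).
  apply: lebesgue_outer_le_series => x /XF[k _ h]; exists k => // i.
  by have := h i; rewrite !mxE ler_pdivrMl// ler_pdivlMl.
apply: lee_nneseries => k _ *; first exact: box_volume_ge0.
rewrite lee_fin; apply: ler_prod => i _; rewrite le_max lexx orbT/= !mxE -mulrBr.
have si : 0 < s^-1 by rewrite invr_gt0.
have [ab|ab] := leP 0 ((F k).2 0 i - (F k).1 0 i).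
  by rewrite max_l ?mulr_ge0 ?(ltW si)// ler_piMl// invf_le1.
by rewrite max_r// pmulr_rle0// ltW.
Qed.

End translation.

Section regularity.
Context {R : realType} {n : nat} (n0 : (0 < n)%N).
Implicit Types (X : set 'rV[R]_n) (ab : 'rV[R]_n * 'rV[R]_n).

Definition open_box ab : set 'rV[R]_n :=
  [set x | forall i, ab.1 0 i < x 0 i < ab.2 0 i].

Lemma open_open_box ab : open (open_box ab).
Proof.
rewrite openE => x abx; rewrite /interior /=.
have h (i : 'I_n) : nbhs x [set y : 'rV[R]_n | ab.1 0 i < y 0 i < ab.2 0 i].
  have o : open_nbhs (x 0 i) [set y | ab.1 0 i < y < ab.2 0 i].
    by split; [rewrite -set_itvoo; exact: interval_open|exact: abx].
  exact: (@coord_continuous R 1 n 0 i x _ (open_nbhs_nbhs o)).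
have := filter_forall (nbhs_filter x) h.
by apply: filterS => y.
Qed.

Lemma max0E (y : R) : maxr y 0 = 2^-1 * (y + `|y|).
Proof.
have [y0|y0] := leP 0 y; first by rewrite ger0_norm//; lra.
by rewrite ltr0_norm//; lra.
Qed.

Lemma box_volume_enlarge ab (e : R) : 0 < e -> exists2 d : R, 0 < d &
  box_volume (ab.1 - const_mx d, ab.2 + const_mx d) <= box_volume ab + e.
Proof.
move=> e0; pose f d := box_volume (ab.1 - const_mx d, ab.2 + const_mx d).
have cf : f d @[d --> 0^'+] --> f 0.
  apply: cvg_at_right_filter; rewrite /f /box_volume.
  apply: (@cvg_big R 'I_n *%R 1); first exact: mul_continuous.
  move=> i _ /=; rewrite !mxE.
  under eq_fun do rewrite !mxE max0E; rewrite max0E.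
  have h : ab.2 0 i + d - (ab.1 0 i - d) @[d --> (0:R)] --> ab.2 0 i + 0 - (ab.1 0 i - 0).
    apply: cvgB; first by apply: cvgD; [exact: cvg_cst|exact: cvg_id].
    by apply: cvgB; [exact: cvg_cst|exact: cvg_id].
  by apply: cvgMr; apply: cvgD => //; exact: cvg_norm.
have f0 : f 0 = box_volume ab.
  rewrite /f (_ : const_mx 0 = 0) ?subr0 ?addr0; first by case: ab @f cf.
  by apply/matrixP => i j; rewrite !mxE.
move/cvgrPdist_lt: cf => /(_ e e0) h.
near (0 : R)^'+ => d; exists d => //.
have : `|f 0 - f d| < e by near: d.
by rewrite f0 ltr_norml -/(f d) => /andP[? _]; lra.
Unshelve. all: by end_near. Qed.

(** The closed boxes of a cover can be replaced by open ones, at an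
    arbitrarily small cost. *)
Lemma open_box_cover X (e : R) : (lebesgue_outer X < +oo)%E -> 0 < e ->
  exists F : nat -> 'rV[R]_n * 'rV[R]_n, X `<=` \bigcup_k open_box (F k) /\
    (\sum_(0 <= k <oo) (box_volume (F k))%:E <= lebesgue_outer X + e%:E)%E.
Proof.
move=> Xoo e0; have e20 : 0 < e / 2 by rewrite divr_gt0.
have [F [XF Fle]] := box_cover_seq n0 Xoo e20.
have ek k : 0 < e / 2 / (2 ^ k.+1)%:R by rewrite divr_gt0// ltr0n expn_gt0.
pose d k := s2val (cid2 (box_volume_enlarge (F k) (ek k))).
pose G k := ((F k).1 - const_mx (d k), (F k).2 + const_mx (d k)).
have d0 k : 0 < d k by rewrite /d; case: cid2.
have Gle k : box_volume (G k) <= box_volume (F k) + e / 2 / (2 ^ k.+1)%:R.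
  by rewrite /G /d; case: cid2.
exists G; split.
  move=> x /XF[k _ h]; exists k => // i; have := h i; rewrite /= !mxE.
  by have := d0 k => ? /andP[? ?]; apply/andP; split; lra.
apply: (@le_trans _ _ (lebesgue_outer X + (e / 2)%:E + (e / 2)%:E)%E); last first.
  by rewrite -addeA -EFinD -splitr.
apply: le_trans (leeD Fle (lexx _)).
apply: le_trans (epsilon_trick _ _ (ltW e20)); last first.
  by move=> k; exact: box_volume_ge0.
by apply: lee_nneseries => k _ *; [exact: box_volume_ge0|rewrite -EFinD lee_fin].
Qed.

Lemma open_outer_approx X (e : R) : (lebesgue_outer X < +oo)%E -> 0 < e ->
  exists O : set 'rV[R]_n, [/\ open O, X `<=` O &
    (lebesgue_outer O <= lebesgue_outer X + e%:E)%E].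
Proof.
move=> Xoo e0; have [F [XF Fle]] := open_box_cover Xoo e0.
exists (\bigcup_k open_box (F k)); split => //.
  by apply: bigcup_open => k _; exact: open_open_box.
apply: le_trans Fle; apply: lebesgue_outer_le_series => x [k _ h].
by exists k => // i; have /andP[/ltW -> /ltW ->] := h i.
Qed.

Lemma lebesgue_outer_ball_lty (x : 'rV[R]_n) e :
  (lebesgue_outer (ball x e) < +oo)%E.
Proof.
have [e0|e0] := ltP 0 e; last first.
  rewrite (_ : ball x e = set0) ?lebesgue_outer0//; apply/seteqP.
  by split=> // y /= [e1]; have := lt_le_trans e1 e0; rewrite ltxx.
apply: (@le_lt_trans _ _ (box_volume (x - const_mx e, x + const_mx e))%:E);
  last exact: ltry.
apply: le_trans (le_outer_box _); apply: le_lebesgue_outer => y.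
rewrite rV_ballE// => /= h i; have := h i; rewrite !mxE ltr_norml.
by move=> /andP[? ?]; apply/andP; split; lra.
Qed.

End regularity.

(** * Translation invariant contents on boxes *)

Section uniqueness.
Context {R : realType}.

(** The defect D of g from linearity vanishes at full length, is additive and
    bounded.  Doubling halves it on the first half of the interval, and passing
    to the complementary length does the same on the second half; hence it is
    bounded by C / 2^k for all k. *)
Lemma additive_interval_linear (p q : R) (g : R -> R -> R) :
  (forall s t, p <= s -> s <= t -> t <= q -> 0 <= g s t) ->
  (forall s t r, p <= s -> s <= t -> t <= r -> r <= q ->
    g s r = g s t + g t r) ->
  (forall s t h, p <= s -> s <= t -> t <= q -> p <= s + h -> t + h <= q ->
    g (s + h) (t + h) = g s t) ->
  forall s t, p <= s -> s <= t -> t <= q -> g s t * (q - p) = g p q * (t - s).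
Proof.
move=> g0 gadd gtr s t ps st tq.
pose L := q - p; pose G x := g p (p + x).
have L0 : 0 <= L by rewrite /L; lra.
have Gadd x y : 0 <= x -> 0 <= y -> x + y <= L -> G (x + y) = G x + G y.
  move=> x0 y0 xyL; rewrite /G /L in xyL *.
  rewrite (gadd p (p + x)); [|lra..]; congr (_ + _).
  have := gtr p (p + y) x; rewrite [p + y + x](_ : _ = p + (x + y)); last lra.
  by apply; lra.
have Gge0 x : 0 <= x -> x <= L -> 0 <= G x.
  by move=> x0 xL; apply: g0; rewrite /L in xL; lra.
have Gmono x : 0 <= x -> x <= L -> G x <= G L.
  move=> x0 xL; rewrite (_ : L = x + (L - x)); last lra.
  by rewrite Gadd ?lerDl ?Gge0; lra.
pose D x := G x * L - G L * x.
have DC k x : 0 <= x -> x <= L -> `|D x| * 2 ^+ k <= G L * L.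
  elim: k x => [|k IH] x x0 xL.
    rewrite expr0 mulr1 /D ler_norml.
    have := Gge0 x x0 xL; have := Gmono x x0 xL => h1 h2.
    have GL0 : 0 <= G L by apply: le_trans h1.
    have := ler_wpM2r L0 h1; have := ler_wpM2l GL0 xL.
    have := mulr_ge0 h2 L0; have := mulr_ge0 GL0 x0.
    by move=> *; apply/andP; split; lra.
  wlog xL2 : x x0 xL / x <= L / 2 => [hw|].
    have [|h] := leP x (L / 2); first exact: hw.
    have -> : D x = - D (L - x).
      by rewrite /D (_ : G L = G x + G (L - x)); [ring|rewrite -Gadd; [congr G; ring|lra..]].
    by rewrite normrN; apply: hw; lra.
  have -> : `|D x| * 2 ^+ k.+1 = `|D (x + x)| * 2 ^+ k.
    rewrite exprS mulrA; congr (_ * _).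
    rewrite (_ : D (x + x) = D x * 2) ?normrM ?(ger0_norm (_ : 0 <= 2 :> R))//.
    by rewrite /D Gadd; [ring|lra..].
  by apply: IH; lra.
have D0 x : 0 <= x -> x <= L -> D x = 0.
  move=> x0 xL; apply/eqP; rewrite -normr_eq0 eq_le normr_ge0 andbT leNgt.
  apply/negP => Dpos.
  have [N _ /(_ N (leqnn N))/=] := nbhs_infty_gtr (G L * L / `|D x|).
  rewrite ltr_pdivrMr// ltNge => /negP; apply.
  apply: le_trans (DC N x x0 xL); rewrite mulrC ler_wpM2l//.
  by rewrite -natrX ler_nat ltnW// ltn_expl.
have := D0 (t - s); rewrite /D /G /L.
have -> : g p (p + (t - s)) = g s t.
  have := gtr s t (p - s); rewrite [s + (p - s)](_ : _ = p); last lra.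
  rewrite [t + (p - s)](_ : _ = p + (t - s)); last lra.
  by apply; lra.
rewrite [p + (q - p)](_ : _ = q); last lra.
by move=> h; apply/eqP; rewrite -subr_eq0; apply/eqP; apply: h; lra.
Qed.

Context {n : nat}.
Implicit Types (a b p q v : 'rV[R]_n).

Definition hbox a b : set 'rV[R]_n := [set x | forall i, a 0 i < x 0 i <= b 0 i].

Definition subbox p q a b := forall i : 'I_n,
  [/\ p 0 i <= a 0 i, a 0 i <= b 0 i & b 0 i <= q 0 i].

(** Stretch the box to the full interval in one coordinate after the other; each
    time the content is linear in the length of that side. *)
Lemma box_content_unique p q (N : 'rV[R]_n -> 'rV[R]_n -> R) :
  (forall a b, subbox p q a b -> 0 <= N a b) ->
  (forall a b i t, subbox p q a b -> a 0 i <= t -> t <= b 0 i ->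
    N a b = N a (set_coord b i t) + N (set_coord a i t) b) ->
  (forall a b v, subbox p q a b -> subbox p q (a + v) (b + v) ->
    N (a + v) (b + v) = N a b) ->
  forall a b, subbox p q a b ->
    N a b * \prod_i (q 0 i - p 0 i) = N p q * \prod_i (b 0 i - a 0 i).
Proof.
move=> N0 Nadd Ntr a b sab.
pose A (s : seq 'I_n) := \row_i (if i \in s then p 0 i else a 0 i).
pose B (s : seq 'I_n) := \row_i (if i \in s then q 0 i else b 0 i).
have sAB s : subbox p q (A s) (B s).
  move=> i; have [? ? ?] := sab i; rewrite !mxE; by case: ifP => _ //; split=> //; lra.
suff key s : uniq s -> N a b * \prod_(i <- s) (q 0 i - p 0 i) =
    N (A s) (B s) * \prod_(i <- s) (b 0 i - a 0 i).
  have := key (index_enum 'I_n) (index_enum_uniq _); rewrite /= => ->.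
  by congr (N _ _ * _); apply/rowP => i; rewrite !mxE mem_index_enum.
elim: s => [_|i s IH /= /andP[is_ us]].
  rewrite !big_nil !mulr1; congr N; apply/rowP => i; rewrite mxE in_nil//.
rewrite !big_cons mulrCA IH// mulrCA.
suff -> : N (A (i :: s)) (B (i :: s)) * ((b 0 i - a 0 i) * \prod_(j <- s) (b 0 j - a 0 j)) =
   N (A (i :: s)) (B (i :: s)) * (b 0 i - a 0 i) * \prod_(j <- s) (b 0 j - a 0 j).
  suff -> : N (A (i :: s)) (B (i :: s)) * (b 0 i - a 0 i) = N (A s) (B s) * (q 0 i - p 0 i).
    by ring.
  pose g x y := N (set_coord (A s) i x) (set_coord (B s) i y).
  have e1 : N (A s) (B s) = g (a 0 i) (b 0 i).
    rewrite /g; congr N; apply/rowP => j; rewrite !mxE; case: eqP => // ->;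
      by rewrite (negbTE is_).
  have e2 : N (A (i :: s)) (B (i :: s)) = g (p 0 i) (q 0 i).
    by rewrite /g; congr N; apply/rowP => j; rewrite !mxE inE; case: eqP => // ->.
  have sg x y : p 0 i <= x -> x <= y -> y <= q 0 i ->
      subbox p q (set_coord (A s) i x) (set_coord (B s) i y).
    move=> px xy yq j; have := sAB s j; rewrite !mxE; case: eqP => // -> _.
    by split.
  rewrite e1 e2; apply/esym; have [? ? ?] := sab i.
  apply: (additive_interval_linear (g := g)) => //.
  - by move=> x y *; apply: N0; exact: sg.
  - move=> x y z px xy yz zq.
    rewrite /g (Nadd _ _ i y) ?set_coord_eq//; last by apply: sg => //; apply: le_trans yz.
    by congr (N _ _ + N _ _); apply/rowP => j; rewrite !mxE; case: eqP.
  - move=> x y h px xy yq pxh yhq; rewrite /g.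
    have hE (c : 'rV[R]_n) z : set_coord c i (z + h) = set_coord c i z + h *: delta_mx 0 i.
      by apply/rowP => j; rewrite !mxE/=; case: eqP => _; rewrite ?mulr1 ?mulr0 ?addr0.
    rewrite !hE; apply: Ntr; first exact: sg.
    by rewrite -!hE; apply: sg => //; rewrite lerD2r.
by ring.
Qed.

End uniqueness.

Section content.
Context {R : realType} {n : nat} (n0 : (0 < n)%N).
Implicit Types (a b p q v : 'rV[R]_n).

Lemma le_outer_hbox a b : (forall i, a 0 i <= b 0 i) ->
  (lebesgue_outer (hbox a b) <= (\prod_i (b 0 i - a 0 i))%:E)%E.
Proof.
move=> ab; apply: le_trans (le_lebesgue_outer _) _; last first.
  apply: le_trans (le_outer_box (a, b)) _; rewrite lee_fin /box_volume.
  apply: ler_prod => i _ /=; rewrite le_max lexx orbT ge_max lexx/=.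
  by rewrite subr_ge0.
by move=> x h i; have /andP[/ltW -> ->] := h i.
Qed.

Lemma hboxI a b p q : hbox a b `&` hbox p q =
  hbox (\row_i maxr (a 0 i) (p 0 i)) (\row_i minr (b 0 i) (q 0 i)).
Proof.
apply/seteqP; split=> x /=.
  move=> [h1 h2] i; have := h1 i; have := h2 i; rewrite !mxE gt_max le_min.
  by move=> /andP[ha hb] /andP[hc hd]; rewrite ha hb hc hd.
by move=> h; split=> i; have := h i; rewrite !mxE gt_max le_min;
  move=> /andP[/andP[ha hb] /andP[hc hd]]; rewrite ?ha ?hb ?hc ?hd.
Qed.

Variables (E : set 'rV[R]_n) (phi : 'rV[R]_n -> 'rV[R]_n) (p q : 'rV[R]_n).
Let nu (A : set 'rV[R]_n) := lebesgue_outer (E `&` phi @^-1` A).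
Hypothesis mphi : forall i,
  measurable_fun [set: Rn R n] (fun x : Rn R n => phi x 0 i).
Hypothesis pq : forall i, p 0 i < q 0 i.
Hypothesis nufin : (nu (hbox p q) < +oo)%E.
Hypothesis nutr : forall a b v, subbox p q a b -> subbox p q (a + v) (b + v) ->
  nu (hbox (a + v) (b + v)) = nu (hbox a b).

Let nu_fin_num a b : subbox p q a b -> nu (hbox a b) \is a fin_num.
Proof.
move=> sab; rewrite ge0_fin_numE ?lebesgue_outer_ge0//.
apply: le_lt_trans nufin; apply: le_lebesgue_outer => x [Ex h]; split=> // i.
have /andP[h1 h2] := h i; have [s1 s2 s3] := sab i.
by rewrite (le_lt_trans s1 h1) (le_trans h2 s3).
Qed.

Lemma content_subbox a b : subbox p q a b ->
  fine (nu (hbox a b)) * \prod_i (q 0 i - p 0 i) =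
  fine (nu (hbox p q)) * \prod_i (b 0 i - a 0 i).
Proof.
apply: (box_content_unique (N := fun a b => fine (nu (hbox a b)))).
- by move=> {}a {}b sab; rewrite fine_ge0// lebesgue_outer_ge0.
- move=> {}a {}b i t sab ati tbi.
  have mH : measurable ([set x | phi x 0 i <= t] : set (Rn R n)).
    have := mphi i measurableT (measurable_itv `]-oo, t]).
    by rewrite setTI.
  have -> : nu (hbox a b) = (nu (hbox a (set_coord b i t)) +
      nu (hbox (set_coord a i t) b))%E.
    rewrite [LHS](mH _); congr (_ + _)%E; congr lebesgue_outer;
      apply/seteqP; split=> x /=.
    + move=> [[Ex h] xt]; split=> // j; have := h j; rewrite mxE.
      by case: eqP => // -> /andP[-> _].
    + move=> [Ex h]; split; last by have := h i; rewrite mxE eqxx => /andP[].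
      split=> // j; have := h j; rewrite mxE; case: eqP => // -> /andP[->] /=.
      by move=> /le_trans; apply.
    + move=> [[Ex h] /negP]; rewrite -ltNge => tx; split=> // j.
      by have := h j; rewrite mxE; case: eqP => // -> /andP[_ ->]; rewrite tx.
    + move=> [Ex h]; split; last first.
        by have := h i; rewrite mxE eqxx => /andP[]; rewrite ltNge => /negP.
      split=> // j; have := h j; rewrite mxE; case: eqP => // -> /andP[+ ->].
      by move=> /(le_lt_trans ati) ->.
  rewrite fineD//; apply: nu_fin_num => j; have [h1 h2 h3] := sab j;
    rewrite mxE; case: eqP => // ji; rewrite ji in h1 h2 h3 *; split=> //.
  + exact: le_trans h3.
  + exact: le_trans ati.
- by move=> {}a {}b v sab sabv; rewrite nutr.
Qed.

Let volpq : 0 < \prod_i (q 0 i - p 0 i).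
Proof. by apply: prodr_gt0 => i _; rewrite subr_gt0. Qed.

(** On boxes the content is theta times the volume; covering A by boxes bounds
    it on A by theta times the outer measure. *)
Lemma content_le A : A `<=` hbox p q ->
  (nu A <= (fine (nu (hbox p q)) / \prod_i (q 0 i - p 0 i))%:E *
   lebesgue_outer A)%E.
Proof.
move=> Apq; set th := _ / _.
have th0 : 0 <= th by rewrite divr_ge0 ?(ltW volpq)// fine_ge0// lebesgue_outer_ge0.
have Aoo : (lebesgue_outer A < +oo)%E.
  apply: le_lt_trans (le_lebesgue_outer Apq) _.
  by apply: le_lt_trans (le_outer_hbox _) (ltry _) => i; exact: ltW.
have Afin : lebesgue_outer A \is a fin_num.
  by rewrite ge0_fin_numE ?lebesgue_outer_ge0.
suff h e : 0 < e -> (nu A <= th%:E * (lebesgue_outer A + e%:E))%E.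
  apply/lee_addgt0Pr => e e0.
  have e1 : 0 < e / (th + 1) by rewrite divr_gt0// ltr_wpDl.
  apply: le_trans (h _ e1) _; rewrite muleDr ?fin_num_adde_defl//.
  rewrite leeD2l// -EFinM lee_fin mulrA ler_pdivrMr ?ltr_wpDl//.
  by rewrite mulrC ler_wpM2l ?(ltW e0)// lerDl.
move=> e0; have [F [AF Fle]] := open_box_cover n0 Aoo e0.
apply: (@le_trans _ _ (th%:E * (\sum_(0 <= k <oo) (box_volume (F k))%:E))%E).
  rewrite -nneseriesZl; last by move=> k _; exact: box_volume_ge0.
  have sub : E `&` phi @^-1` A `<=`
      \bigcup_k (E `&` phi @^-1` (hbox (F k).1 (F k).2 `&` hbox p q)).
    move=> x [Ex Ax]; have [k _ h] := AF _ Ax; exists k => //; split=> //.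
    split; last exact: Apq.
    by move=> i; have /andP[-> /ltW ->] := h i.
  apply: le_trans (le_lebesgue_outer sub) _.
  apply: le_trans (lebesgue_outer_sigma_subadditive _) _.
  apply: lee_nneseries => [k _ _|k _]; first exact: lebesgue_outer_ge0.
  rewrite hboxI; set c := \row_i _; set d := \row_i _.
  rewrite -/(nu _).
  have [[i dc]|] := pselect (exists i, d 0 i < c 0 i).
    rewrite (_ : nu _ = 0%E); last first.
      rewrite (_ : hbox c d = set0) /nu ?preimage_set0 ?setI0 ?lebesgue_outer0//.
      apply/seteqP; split=> // x /(_ i) /andP[h1 h2].
      by have := lt_le_trans h1 h2; rewrite ltNge (ltW dc).
    by rewrite mule_ge0// ?lee_fin// -lee_fin box_volume_ge0.
  move=> /forallNP dc.
  have scd : subbox p q c d.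
    move=> i; split; last by rewrite mxE ge_min lexx orbT.
      by rewrite mxE le_max lexx orbT.
    by have /negP := dc i; rewrite -leNgt.
  rewrite -(fineK (nu_fin_num scd)) -EFinM lee_fin.
  rewrite /th mulrAC ler_pdivlMr// (content_subbox scd).
  rewrite ler_wpM2l ?fine_ge0 ?lebesgue_outer_ge0//.
  rewrite /box_volume; apply: ler_prod => i _; rewrite subr_ge0.
  have [_ -> _] := scd i; rewrite /= le_max; apply/orP; left.
  by rewrite !mxE lerB// ?ge_min ?le_max lexx.
by apply: lee_wpmul2l; rewrite ?lee_fin.
Qed.

End content.

(** * Euclidean geometry *)

Section euclid.
Context {R : realType} {n : nat}.
Implicit Types (x y z c u v : 'rV[R]_n).

Lemma dotpC x y : dotp x y = dotp y x.
Proof. by apply: eq_bigr => i _; rewrite mulrC. Qed.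

Lemma dotpDl x y z : dotp (x + y) z = dotp x z + dotp y z.
Proof. by rewrite -big_split; apply: eq_bigr => i _; rewrite mxE mulrDl. Qed.

Lemma dotpZl (k : R) x y : dotp (k *: x) y = k * dotp x y.
Proof. by rewrite mulr_sumr; apply: eq_bigr => i _; rewrite mxE mulrA. Qed.

Lemma dotpNl x y : dotp (- x) y = - dotp x y.
Proof. by rewrite -scaleN1r dotpZl mulN1r. Qed.

Lemma dotpBl x y z : dotp (x - y) z = dotp x z - dotp y z.
Proof. by rewrite dotpDl dotpNl. Qed.

Lemma dotpDr x y z : dotp x (y + z) = dotp x y + dotp x z.
Proof. by rewrite !(dotpC x) dotpDl. Qed.

Lemma dotpZr (k : R) x y : dotp x (k *: y) = k * dotp x y.
Proof. by rewrite !(dotpC x) dotpZl. Qed.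

Lemma dotpNr x y : dotp x (- y) = - dotp x y.
Proof. by rewrite !(dotpC x) dotpNl. Qed.

Lemma dotpBr x y z : dotp x (y - z) = dotp x y - dotp x z.
Proof. by rewrite !(dotpC x) dotpBl. Qed.

Definition dotpE := (dotpBl, dotpBr, dotpDl, dotpDr, dotpZl, dotpZr, dotpNl, dotpNr).

Lemma dotp_delta x (i : 'I_n) : dotp x (delta_mx 0 i) = x 0 i.
Proof.
rewrite /dotp (bigD1 i)//= !mxE !eqxx mulr1 big1 ?addr0// => j ji.
by rewrite !mxE (negbTE ji) andbF mulr0.
Qed.

Lemma dotpp_ge0 x : 0 <= dotp x x.
Proof. by apply: sumr_ge0 => i _; rewrite -expr2 sqr_ge0. Qed.

Lemma enorm_ge0 x : 0 <= enorm x.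
Proof. exact: sqrtr_ge0. Qed.

Lemma sqr_enorm x : enorm x ^+ 2 = dotp x x.
Proof. by rewrite sqr_sqrtr// dotpp_ge0. Qed.

Lemma coord_le_enorm x i : `|x 0 i| <= enorm x.
Proof.
rewrite -sqrtr_sqr ler_wsqrtr// /dotp (bigD1 i)//= -expr2 lerDl.
by apply: sumr_ge0 => j _; rewrite -expr2 sqr_ge0.
Qed.

Lemma enorm0_eq0 x : enorm x = 0 -> x = 0.
Proof.
move=> x0; apply/rowP => i; rewrite mxE; apply/eqP; rewrite -normr_eq0.
by rewrite eq_le normr_ge0 andbT -x0 coord_le_enorm.
Qed.

Lemma dotp_le_enorm x y : dotp x y <= enorm x * enorm y.
Proof.
have [->|x0] := eqVneq x 0.
  rewrite (_ : dotp 0 y = 0) ?mulr_ge0 ?enorm_ge0//.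
  by apply: big1 => i _; rewrite mxE mul0r.
have [->|y0] := eqVneq y 0.
  rewrite (_ : dotp x 0 = 0) ?mulr_ge0 ?enorm_ge0//.
  by apply: big1 => i _; rewrite mxE mulr0.
have ex : 0 < enorm x.
  rewrite lt_neqAle enorm_ge0 andbT eq_sym; apply: contra x0 => /eqP h.
  exact/eqP/enorm0_eq0.
have ey : 0 < enorm y.
  rewrite lt_neqAle enorm_ge0 andbT eq_sym; apply: contra y0 => /eqP h.
  exact/eqP/enorm0_eq0.
have := dotpp_ge0 (enorm y *: x - enorm x *: y).
rewrite !dotpE -!sqr_enorm (dotpC y x) => h.
rewrite -(ler_pM2l (_ : 0 < enorm x * enorm y)) ?mulr_gt0//.
by move: h; lra.
Qed.

Lemma enormN x : enorm (- x) = enorm x.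
Proof. by rewrite /enorm !dotpE opprK. Qed.

Lemma enormZ (k : R) x : enorm (k *: x) = `|k| * enorm x.
Proof. by rewrite /enorm !dotpE mulrA -expr2 sqrtrM ?sqr_ge0// sqrtr_sqr. Qed.

Lemma enormD x y : enorm (x + y) <= enorm x + enorm y.
Proof.
rewrite -(@ler_pXn2r _ 2)// ?nnegrE ?addr_ge0 ?enorm_ge0// sqr_enorm !dotpE.
rewrite sqrrD !sqr_enorm (dotpC y x).
by have := dotp_le_enorm x y; lra.
Qed.

Lemma enorm_le_sup x (M : R) : (forall i, `|x 0 i| <= M) -> enorm x <= n%:R * M.
Proof.
move=> xM; have M0 : 0 <= n%:R * M.
  case: n x xM => [|m] x xM; first by rewrite mul0r.
  by rewrite mulr_ge0// (le_trans _ (xM ord0)).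
rewrite -(@ler_pXn2r _ 2)// ?nnegrE ?enorm_ge0// sqr_enorm.
apply: (@le_trans _ _ (\sum_(i < n) M ^+ 2)).
  apply: ler_sum => i _; rewrite -expr2 -real_normK ?num_real//.
  by rewrite lerXn2r ?nnegrE// (le_trans _ (xM i)).
rewrite sumr_const card_ord exprMn -[leLHS]mulr_natl ler_wpM2r ?sqr_ge0//.
by rewrite -natrX ler_nat; case: (n) => // m; rewrite expnS expn1 leq_pmull.
Qed.

Lemma dotp_continuous c : continuous (fun x => dotp x c).
Proof.
move=> x; apply: (@cvg_big R 'I_n +%R 0 xpredT add_continuous _ (nbhs x)) => i _.
by apply: cvgMl; exact: coord_continuous.
Qed.

Lemma dotpp_continuous : continuous (fun x => dotp x x).
Proof.
move=> x; apply: (@cvg_big R 'I_n +%R 0 xpredT add_continuous _ (nbhs x)) => i _.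
by apply: cvgM; exact: coord_continuous.
Qed.

Lemma enorm_continuous c : continuous (fun x => enorm (x - c)).
Proof.
move=> x; have h1 : {for x, continuous (fun x : 'rV[R]_n => x - c)}.
  by apply: (@cvgB _ _ _ (nbhs x) _ id (cst c) x c); [exact: cvg_id|exact: cvg_cst].
have h2 : {for x, continuous (fun x : 'rV[R]_n => dotp (x - c) (x - c))}.
  exact: continuous_comp h1 (@dotpp_continuous (x - c)).
exact: continuous_comp h2 (@sqrt_continuous R _).
Qed.

Lemma eball_closed c r : closed (eball c r).
Proof.
rewrite (_ : eball c r = (fun x => enorm (x - c)) @^-1` [set t | t <= r])//.
by apply: closed_comp => [x _|]; [exact: enorm_continuous|exact: closed_le].
Qed.

Lemma measurable_eball c r : measurable (eball c r : set (Rn R n)).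
Proof. exact/closed_measurable_rV/eball_closed. Qed.

Lemma eball_sub_ball c r : eball c r `<=` ball c (`|r| + 1).
Proof.
move=> x xc; rewrite rV_ballE ?ltr_wpDl//= => i.
rewrite distrC; have := coord_le_enorm (x - c) i; rewrite !mxE => h.
apply: le_lt_trans h _; apply: le_lt_trans xc _.
by rewrite (le_lt_trans (ler_norm _))// ltrDl.
Qed.

Lemma enorm_distC x y : enorm (x - y) = enorm (y - x).
Proof. by rewrite -enormN opprB. Qed.

End euclid.

Section reflection.
Context {R : realType} {n : nat} (u : 'rV[R]_n) (hu : enorm u = 1).
Implicit Types (x y z c v : 'rV[R]_n) (X : set 'rV[R]_n).

Lemma dotpuu : dotp u u = 1.
Proof. by rewrite -sqr_enorm hu expr1n. Qed.

Lemma dotp_refl_u x : dotp (refl u x) u = - dotp x u.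
Proof. by rewrite /refl !dotpE dotpuu; ring. Qed.

Lemma reflK : involutive (refl u).
Proof.
move=> x; rewrite {1}/refl dotp_refl_u /refl mulrN scaleNr opprK subrK//.
Qed.

Lemma reflD x y : refl u (x + y) = refl u x + refl u y.
Proof. by rewrite /refl dotpDl mulrDr scalerDl opprD addrACA. Qed.

Lemma reflN x : refl u (- x) = - refl u x.
Proof. by rewrite /refl dotpNl mulrN scaleNr opprD. Qed.

Lemma dotp_refl x y : dotp (refl u x) (refl u y) = dotp x y.
Proof. by rewrite /refl !dotpE dotpuu (dotpC u y); ring. Qed.

Lemma enorm_refl x : enorm (refl u x) = enorm x.
Proof. by rewrite /enorm dotp_refl. Qed.

Lemma refl_eball c r : refl u @^-1` eball c r = eball (refl u c) r.
Proof.
apply/seteqP; split=> x /=; rewrite /eball/=;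
  by rewrite -[X in _ -> X <= _]enorm_refl reflD reflN ?reflK.
Qed.

Lemma refl_opp x : refl (- u) x = refl u x.
Proof. by rewrite /refl dotpNr mulrN scaleNr scalerN opprK. Qed.

Lemma refl_continuous : continuous (refl u).
Proof.
move=> x; apply: (@cvgB _ _ _ (nbhs x) _ id (fun x => (2 * dotp x u) *: u) x); first exact: cvg_id.
apply: cvgZ; last exact: cvg_cst.
by apply: cvgMr; exact: dotp_continuous.
Qed.

End reflection.

(** * Null sets and invariance under reflections *)

Section nullsets.
Context {R : realType} {n : nat}.
Implicit Types (A B C : set 'rV[R]_n).

Definition null A := lebesgue_outer A = 0%E.

Definition sub_ae A B := null (A `\` B).

Lemma null_sub A B : A `<=` B -> null B -> null A.
Proof.
move=> AB B0; apply/eqP; rewrite eq_le lebesgue_outer_ge0 andbT -B0.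
exact: le_lebesgue_outer.
Qed.

Lemma null0 : null (set0 : set 'rV[R]_n).
Proof. exact: lebesgue_outer0. Qed.

Lemma null_bigcup (F : nat -> set 'rV[R]_n) : (forall k, null (F k)) ->
  null (\bigcup_k F k).
Proof.
move=> F0; apply/eqP; rewrite eq_le lebesgue_outer_ge0 andbT.
apply: le_trans (lebesgue_outer_sigma_subadditive _) _.
by rewrite eseries0// => k _ _; exact: F0.
Qed.

Lemma nullU A B : null A -> null B -> null (A `|` B).
Proof.
by move=> A0 B0; rewrite -bigcup2E; apply: null_bigcup => -[|[|k]] //=; exact: null0.
Qed.

Lemma null_measurable A : null A -> measurable (A : set (Rn R n)).
Proof.
move=> A0; apply: le_caratheodory_measurable => X.
have XA : null (X `&` A) by apply: null_sub A0; exact: subIsetr.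
by rewrite [X in (X + _)%E]XA add0e; apply: le_lebesgue_outer; exact: subIsetl.
Qed.

Lemma negligible_null A : (@lebesgue_n R n).-negligible A <-> null A.
Proof.
split=> [[B [mB B0 AB]]|A0]; first exact: null_sub AB B0.
by exists A; split => //; exact: null_measurable.
Qed.

Lemma aeP (P : 'rV[R]_n -> Prop) :
  {ae @lebesgue_n R n, forall x, P x} <-> null [set x | ~ P x].
Proof. exact: negligible_null. Qed.

Lemma sub_ae_sub A B : A `<=` B -> sub_ae A B.
Proof. by move=> AB; apply: null_sub null0 => x [/AB]. Qed.

Lemma sub_ae_trans A B C : sub_ae A B -> sub_ae B C -> sub_ae A C.
Proof.
move=> AB BC; apply: null_sub (nullU AB BC) => x [Ax nCx].
by have [Bx|nBx] := pselect (B x); [right|left].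
Qed.

Lemma sub_aeI A B C : sub_ae C A -> sub_ae C B -> sub_ae C (A `&` B).
Proof.
move=> h1 h2; apply: null_sub (nullU h1 h2) => x [Cx nABx].
have [Ax|nAx] := pselect (A x); last by left.
by right; split => // Bx; apply: nABx.
Qed.

Lemma sub_aeU A B C : sub_ae A C -> sub_ae B C -> sub_ae (A `|` B) C.
Proof.
by move=> h1 h2; apply: null_sub (nullU h1 h2) => x [[Ax|Bx] nC]; [left|right].
Qed.

Lemma sub_ae_bigcup (F : nat -> set 'rV[R]_n) C : (forall k, sub_ae (F k) C) ->
  sub_ae (\bigcup_k F k) C.
Proof.
move=> h; apply: null_sub (null_bigcup h) => x [[k _ Fx] nC].
by exists k.
Qed.

Lemma sub_ae_bigcap (F : nat -> set 'rV[R]_n) C : (forall k, sub_ae C (F k)) ->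
  sub_ae C (\bigcap_k F k).
Proof.
move=> h; apply: null_sub (null_bigcup h) => x [Cx nF].
by apply: contrapT => nU; apply: nF => k _; apply: contrapT => nFk; apply: nU; exists k.
Qed.

Lemma sub_ae_le A B : sub_ae A B -> (lebesgue_outer A <= lebesgue_outer B)%E.
Proof.
move=> AB; apply: le_trans (le_lebesgue_outer (_ : A `<=` B `|` (A `\` B))) _.
  by move=> x Ax; have [Bx|nBx] := pselect (B x); [left|right].
by apply: le_trans (outer_measureU2 _ _ _) _; rewrite [X in (_ + X)%E]AB adde0.
Qed.

(** Among sets of the same finite measure, inclusion is equality. *)
Lemma sub_ae_rev A B : measurable (A : set (Rn R n)) ->
  (lebesgue_outer B < +oo)%E -> (lebesgue_outer B <= lebesgue_outer A)%E ->
  sub_ae A B -> sub_ae B A.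
Proof.
move=> mA Boo BA AB; rewrite /sub_ae /null.
have BAle : (lebesgue_outer A <= lebesgue_outer (B `&` A))%E.
  apply: sub_ae_le; apply: null_sub AB => x [Ax nBA]; split=> // Bx.
  exact: nBA.
have Bfin : lebesgue_outer B \is a fin_num by rewrite ge0_fin_numE ?lebesgue_outer_ge0.
have BAfin : lebesgue_outer (B `&` A) \is a fin_num.
  rewrite ge0_fin_numE ?lebesgue_outer_ge0//.
  by apply: le_lt_trans Boo; apply: le_lebesgue_outer; exact: subIsetl.
apply/eqP; rewrite eq_le lebesgue_outer_ge0 andbT.
have := mA B; rewrite -setDE => BE.
rewrite -(leeD2lE _ _ BAfin) adde0.
by rewrite -[leLHS]BE; exact: le_trans BA BAle.
Qed.

Lemma null_translate v A : (0 < n)%N -> null A -> null [set x | A (x + v)].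
Proof. by move=> n0; rewrite /null lebesgue_outer_translate. Qed.

End nullsets.

Section reflection_measure.
Context {R : realType} {n : nat} (n0 : (0 < n)%N) (u : 'rV[R]_n)
  (hu : enorm u = 1).
Implicit Types (x y z c v : 'rV[R]_n) (X A : set 'rV[R]_n).

Let cube (M : R) : set 'rV[R]_n := hbox (const_mx (- M)) (const_mx M).

Let cube_sub (A : set 'rV[R]_n) (M : R) :
  (forall x, A x -> forall i, `|x 0 i| < M) -> A `<=` cube M.
Proof.
move=> h x /h {}h i; rewrite !mxE; have := h i.
by rewrite ltr_norml => /andP[-> /ltW ->].
Qed.

Let enorm_cube (M : R) : forall x, cube M x -> enorm x <= n%:R * M.
Proof.
move=> x h; apply: enorm_le_sup => i; have := h i; rewrite !mxE ler_norml.
by move=> /andP[/ltW -> ->].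
Qed.

Let coord_refl_measurable i :
  measurable_fun [set: Rn R n] (fun x : Rn R n => refl u x 0 i).
Proof.
apply: continuous_measurable_rV => x.
have h := @coord_continuous R 1 n 0 i (refl u x).
exact: (@continuous_comp _ _ _ _ _ x (@refl_continuous _ _ u x) h).
Qed.

Let nu A := lebesgue_outer (refl u @^-1` A).

Let nu_translate v A : nu [set x | A (x - v)] = nu A.
Proof.
rewrite /nu (_ : _ @^-1` _ = [set x | (refl u @^-1` A) (x - refl u v)]).
  by rewrite lebesgue_outer_translate.
by apply/seteqP; split=> x /=; rewrite reflD reflN reflK.
Qed.

Let nu_hbox_translate a b v : nu (hbox (a + v) (b + v)) = nu (hbox a b).
Proof.
have -> : hbox (a + v) (b + v) = [set x | hbox a b (x - v)].
  apply/seteqP; split=> x h i; have := h i; rewrite !mxE.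
    by rewrite ltrBrDr lerBlDr.
  by rewrite ltrBrDr lerBlDr.
exact: nu_translate.
Qed.

Let nu_cube_lty M : (nu (cube M) < +oo)%E.
Proof.
apply: le_lt_trans (lebesgue_outer_ball_lty 0 (`|n%:R * M| + 1)).
apply: le_lebesgue_outer; apply: subset_trans (@eball_sub_ball _ _ _ _).
by move=> x /enorm_cube; rewrite /eball/= subr0 enorm_refl.
Qed.

(** The constant by which nu differs from the volume on the boxes in a cube. *)
Let theta (M : R) : R := fine (nu (cube M)) / \prod_(i < n) (2 * M).

Let nu_le (M : R) A : 0 < M -> A `<=` cube M ->
  (nu A <= (theta M)%:E * lebesgue_outer A)%E.
Proof.
move=> M0 AM.
have := @content_le _ _ n0 [set: _] (refl u) (const_mx (- M)) (const_mx M)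
  coord_refl_measurable _ _ _ _ AM.
rewrite !setTI.
rewrite (_ : \prod_i _ = \prod_(i < n) (2 * M)); last first.
  by apply: eq_bigr => i _; rewrite !mxE; lra.
apply => [i||a b v _ _]; first by rewrite !mxE; lra.
    exact: (nu_cube_lty M).
by rewrite !setTI; exact: nu_hbox_translate.
Qed.

(** A ball around the origin is its own image, so there nu is Lebesgue measure.
    On the complement of the ball in the cube nu is at most theta times Lebesgue
    measure, but on the whole cube it is theta times the volume. *)
Let theta_le1 (r M : R) : 0 < M -> r < M -> ~ null (eball (0 : 'rV[R]_n) r) ->
  theta M <= 1.
Proof.
move=> M0 rM Bpos; set B := eball _ _ in Bpos.
have BV : B `<=` cube M.
  apply: cube_sub => x xB i; apply: le_lt_trans rM.
  by move: xB; rewrite /B /eball/= subr0; apply: le_trans (coord_le_enorm _ _).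
have mB : measurable (B : set (Rn R n)) by exact: measurable_eball.
have vol0 : 0 < \prod_(i < n) (2 * M) by apply: prodr_gt0 => i _; lra.
have th0 : 0 <= theta M by rewrite divr_ge0 ?(ltW vol0)// fine_ge0 ?lebesgue_outer_ge0.
have nuVE : nu (cube M) = (theta M * \prod_(i < n) (2 * M))%:E.
  by rewrite /theta divfK ?gt_eqF// fineK// ge0_fin_numE ?lebesgue_outer_ge0//.
have Vle : (lebesgue_outer (cube M) <= (\prod_(i < n) (2 * M))%:E)%E.
  apply: le_trans (le_outer_hbox _) _ => [i|]; first by rewrite !mxE; lra.
  by rewrite lee_fin; apply: ler_prod => i _; rewrite !mxE; apply/andP; split; lra.
have BE : refl u @^-1` B = B.
  rewrite /B refl_eball// /refl; congr eball.
  by rewrite -(scale0r (0 : 'rV[R]_n)) dotpZl mul0r mulr0 !scale0r subr0.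
have Brefl x : B (refl u x) = B x by rewrite -[in RHS]BE.
have e1 : nu (cube M) = (lebesgue_outer B + nu (cube M `\` B))%E.
  rewrite /nu [LHS](mB _); congr (_ + _)%E; congr lebesgue_outer.
    by apply/seteqP; split=> x /=; [case|move=> Bx; split=> //; apply: BV; rewrite Brefl].
  by apply/seteqP; split=> x /=; rewrite /setD/= Brefl.
have e2 : lebesgue_outer (cube M) = (lebesgue_outer B + lebesgue_outer (cube M `\` B))%E.
  by rewrite [LHS](mB _); congr (_ + _)%E; congr lebesgue_outer; rewrite (setIidr BV).
have VBle : (nu (cube M `\` B) <= (theta M)%:E * lebesgue_outer (cube M `\` B))%E.
  by apply: nu_le => //; exact: subDsetl.
have Voo : (lebesgue_outer (cube M) < +oo)%E by apply: le_lt_trans Vle (ltry _).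
have Bfin : lebesgue_outer B \is a fin_num.
  by rewrite ge0_fin_numE ?lebesgue_outer_ge0// (le_lt_trans _ Voo)// le_lebesgue_outer.
have Dfin : lebesgue_outer (cube M `\` B) \is a fin_num.
  rewrite ge0_fin_numE ?lebesgue_outer_ge0// (le_lt_trans _ Voo)//.
  by rewrite le_lebesgue_outer//; exact: subDsetl.
have nDfin : nu (cube M `\` B) \is a fin_num.
  by rewrite ge0_fin_numE ?lebesgue_outer_ge0// (le_lt_trans VBle)// -(fineK Dfin) -EFinM ltry.
have Bgt0 : 0 < fine (lebesgue_outer B).
  rewrite lt_neqAle fine_ge0 ?lebesgue_outer_ge0// andbT eq_sym.
  by apply/eqP => h; apply: Bpos; rewrite /null -(fineK Bfin) h.
move: e1 e2 VBle Vle; rewrite nuVE => e1 ->.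
move: e1; rewrite -(fineK Bfin) -(fineK Dfin) -(fineK nDfin) -!EFinD -EFinM.
move: Bgt0; move: (fine _) (fine _) (fine _) (\prod_(_ < _) _) (theta M) th0 => B' nD D V th th0 B0.
move=> [e1]; rewrite !lee_fin => h1 h2.
have h3 : th * (D + B') <= th * V by rewrite ler_wpM2l.
by rewrite -(ler_pM2r B0) mul1r; lra.
Qed.

Lemma null_setT_of_balls : (forall r, null (eball (0 : 'rV[R]_n) r)) ->
  null [set: 'rV[R]_n].
Proof.
move=> h; apply: null_sub (null_bigcup (F := fun k => eball 0 k%:R) _) => // x _.
have [k _ /(_ k (leqnn k))] := nbhs_infty_gtr (enorm x).
by move=> /ltW xk; exists k => //; rewrite /eball/= subr0.
Qed.

Lemma lebesgue_outer_refl_le A :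
  (lebesgue_outer (refl u @^-1` A) <= lebesgue_outer A)%E.
Proof.
have [Anull|/existsNP[r0 rpos]] := pselect (forall r, null (eball (0 : 'rV[R]_n) r)).
  rewrite (_ : lebesgue_outer (refl u @^-1` A) = 0%E) ?lebesgue_outer_ge0//.
  by apply: null_sub (null_setT_of_balls Anull).
have boxle (ab : 'rV[R]_n * 'rV[R]_n) : (nu (box ab) <= (box_volume ab)%:E)%E.
  pose M := `|r0| + \sum_i (`|ab.1 0 i| + `|ab.2 0 i|) + 1.
  have S0 : 0 <= \sum_i (`|ab.1 0 i| + `|ab.2 0 i|) by apply: sumr_ge0 => i _; rewrite addr_ge0.
  have M0 : 0 < M by rewrite /M ltr_wpDl// addr_ge0.
  have rM : r0 < M by rewrite /M; have := ler_norm r0; lra.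
  have bM : box ab `<=` cube M.
    apply: cube_sub => x h i; have /andP[h1 h2] := h i.
    have := ler_norm (ab.2 0 i); have := ler_norm (- ab.1 0 i); rewrite normrN => h3 h4.
    have : `|ab.1 0 i| + `|ab.2 0 i| <= \sum_i (`|ab.1 0 i| + `|ab.2 0 i|).
      by rewrite [leRHS](bigD1 i)//= lerDl; apply: sumr_ge0 => j _; rewrite addr_ge0.
    have := normr_ge0 r0; have := normr_ge0 (ab.1 0 i); have := normr_ge0 (ab.2 0 i).
    by rewrite ltr_norml /M => *; apply/andP; split; lra.
  apply: le_trans (nu_le M0 bM) _.
  apply: le_trans (lee_wpmul2l _ (le_outer_box ab)) _.
    by rewrite lee_fin divr_ge0 ?fine_ge0 ?lebesgue_outer_ge0// prodr_ge0// => i _; lra.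
  rewrite -EFinM lee_fin ler_piMl//; first by rewrite -lee_fin box_volume_ge0.
  exact: theta_le1 rM rpos.
have [Aoo|] := ltP (lebesgue_outer A) +oo%E; last first.
  by rewrite leye_eq => /eqP ->; rewrite leey.
apply/lee_addgt0Pr => e e0; have [F [AF Fle]] := box_cover_seq n0 Aoo e0.
apply: le_trans Fle.
apply: le_trans (le_lebesgue_outer (_ : _ `<=` \bigcup_k (refl u @^-1` box (F k)))) _.
  by rewrite -preimage_bigcup; exact: preimage_subset.
apply: le_trans (lebesgue_outer_sigma_subadditive _) _.
by apply: lee_nneseries => k _ *; [exact: lebesgue_outer_ge0|exact: boxle].
Qed.

(** Coordinate boxes are not mapped to such boxes; but the image measure is
    translation invariant, hence a multiple of the volume, and the balls around
    the origin show that the factor is at most 1. *)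
Lemma lebesgue_outer_refl A :
  lebesgue_outer (refl u @^-1` A) = lebesgue_outer A.
Proof.
apply/eqP; rewrite eq_le lebesgue_outer_refl_le/=.
rewrite -[in leLHS](_ : refl u @^-1` (refl u @^-1` A) = A).
  exact: lebesgue_outer_refl_le.
by apply/seteqP; split=> x /=; rewrite reflK.
Qed.

Lemma measurable_refl A : measurable (A : set (Rn R n)) ->
  measurable (refl u @^-1` A : set (Rn R n)).
Proof.
move=> mA; apply: le_caratheodory_measurable => X.
rewrite -[leRHS]lebesgue_outer_refl -[X in (X + _)%E]lebesgue_outer_refl.
rewrite -[X in (_ + X)%E]lebesgue_outer_refl.
rewrite [leRHS](mA _); apply: leeD; apply: le_lebesgue_outer => x /=;
  by rewrite reflK.
Qed.

Lemma null_refl A : null A -> null (refl u @^-1` A).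
Proof. by rewrite /null lebesgue_outer_refl. Qed.

End reflection_measure.

Section balls.
Context {R : realType} {n : nat}.
Implicit Types (x y z c u v : 'rV[R]_n) (X A O S : set 'rV[R]_n).

Lemma open_lt_enorm c (r : R) : open [set x : 'rV[R]_n | enorm (x - c) < r].
Proof.
rewrite (_ : mkset _ = (fun x => enorm (x - c)) @^-1` [set t | t < r])//.
by apply: open_comp => [x _|]; [exact: enorm_continuous|exact: open_lt].
Qed.

Lemma enorm0 : enorm (0 : 'rV[R]_n) = 0.
Proof. by rewrite -(scale0r (0 : 'rV[R]_n)) enormZ normr0 mul0r. Qed.

Lemma nbhs_eball c (r : R) : 0 < r -> nbhs c (eball c r).
Proof.
move=> r0; have o : open_nbhs c [set x : 'rV[R]_n | enorm (x - c) < r].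
  by split; [exact: open_lt_enorm|rewrite /= subrr enorm0].
by apply: filterS (open_nbhs_nbhs o) => x /ltW.
Qed.

Lemma open_eball_sub O x : open O -> O x ->
  exists2 r : R, 0 < r & eball x r `<=` O.
Proof.
move=> oO Ox; have := oO x Ox; rewrite /interior /= => /nbhs_ballP[e /= e0 eO].
exists (e / 2); first by rewrite divr_gt0.
move=> y yx; apply: eO; rewrite rV_ballE//= => i.
rewrite distrC; have := coord_le_enorm (y - x) i; rewrite !mxE => h.
by apply: le_lt_trans h _; apply: le_lt_trans yx _; lra.
Qed.

(** An open set is a countable union of closed balls. *)
Lemma open_sub_ae O S : open O ->
  (forall c r, 0 < r -> eball c r `<=` O -> sub_ae (eball c r) S) ->
  sub_ae O S.
Proof.
move=> oO OS; have [->|/set0P O0] := eqVneq O set0; first exact: sub_ae_sub.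
have h x : O x -> {r : R | 0 < r & eball x r `<=` O}.
  by move=> Ox; apply: cid2; exact: open_eball_sub.
pose r x := if pselect (O x) is left Ox then s2val (h x Ox) else 1.
have rP x : O x -> 0 < r x /\ eball x (r x) `<=` O.
  by rewrite /r; case: pselect => // Ox _; case: (h x Ox).
have [x /rP[r0 _]|s [Os Ocov]] := @rV_lindelof _ _ O (fun x => eball x (r x)) _ O0.
  exact: nbhs_eball.
apply: sub_ae_trans (sub_ae_sub Ocov) _; apply: sub_ae_bigcup => k.
by have [r0 rO] := rP _ (Os k); exact: OS.
Qed.

Lemma lebesgue_outer_eball_lty c (r : R) : (lebesgue_outer (eball c r) < +oo)%E.
Proof.
apply: le_lt_trans (lebesgue_outer_ball_lty c (`|r| + 1)).
exact/le_lebesgue_outer/eball_sub_ball.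
Qed.

End balls.

Section hyperplane.
Context {R : realType} {n : nat} (n0 : (0 < n)%N).

(** A bounded part of the hyperplane has infinitely many disjoint translates in
    a bounded set. *)
Lemma null_hyperplane (u : 'rV[R]_n) : enorm u = 1 ->
  null [set x | dotp x u = 0].
Proof.
move=> hu; pose S (k : nat) : set 'rV[R]_n := [set x | dotp x u = 0] `&` eball 0 k%:R.
apply: null_sub (null_bigcup (F := S) _).
  move=> x xu; have [k _ /(_ k (leqnn k))] := nbhs_infty_gtr (enorm x).
  by move=> /ltW xk; exists k => //; split => //; rewrite /eball/= subr0.
move=> k; pose v j : 'rV[R]_n := j.+1%:R^-1 *: u.
have vu j : dotp (v j) u = j.+1%:R^-1 by rewrite dotpZl -sqr_enorm hu expr1n mulr1.
apply: (@null_disjoint_translates R n n0 (S k) (eball 0 (k%:R + 1)) v).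
- apply: measurableI; last exact: measurable_eball.
  apply: closed_measurable_rV; rewrite (_ : mkset _ = (dotp^~ u) @^-1` [set 0])//.
  by apply: closed_comp => [x _|]; [exact: dotp_continuous|exact: closed_eq].
- exact: measurable_eball.
- exact: lebesgue_outer_eball_lty.
- apply/trivIsetP => i j _ _ ij; apply/seteqP; split=> // x [[xi _] [xj _]].
  move: xi xj => /=; rewrite !dotpDl !vu => xi xj.
  have /invr_inj/eqP : i.+1%:R^-1 = j.+1%:R^-1 :> R.
    by apply: (@addrI _ (dotp x u)); rewrite xi xj.
  by rewrite eqr_nat eqSS (negbTE ij).
- move=> j x [_]; rewrite /eball/= !subr0 => h.
  rewrite -[x](addrK (v j)); apply: le_trans (enormD _ _) _.
  rewrite lerD// enormN enormZ hu mulr1 ger0_norm ?invr_ge0//.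
  by rewrite invf_le1 ?ltr0n// ler1n.
Qed.

(** A unit slab has infinitely many disjoint translates, so it is a null set if
    the space has finite measure; and countably many slabs fill the space. *)
Lemma lebesgue_outer_setT_dich :
  null [set: 'rV[R]_n] \/ lebesgue_outer [set: 'rV[R]_n] = +oo%E.
Proof.
have [Too|] := ltP (lebesgue_outer [set: 'rV[R]_n]) +oo%E; last first.
  by rewrite leye_eq => /eqP ?; right.
left; pose i0 : 'I_n := Ordinal n0.
pose S : set 'rV[R]_n := [set x | 0 <= x 0 i0 < 1].
pose v (k : nat) : 'rV[R]_n := - (k%:R *: delta_mx 0 i0).
have Snull : null S.
  apply: (@null_disjoint_translates R n n0 S [set: _] v) => //.
    rewrite (_ : S = (fun x : 'rV[R]_n => x 0 i0) @^-1` `[0, 1[).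
      by rewrite -[X in measurable X]setTI; exact: measurable_coord.
    by apply/seteqP; split=> x; rewrite /S /= in_itv.
  apply/trivIsetP => i j _ _ ij; apply/seteqP; split=> // x [].
  rewrite /S /v /= !mxE !eqxx !mulr1 => /andP[h1 h2] /andP[h3 h4].
  have : (i < j.+1)%N by rewrite -(ltr_nat R) -natr1; lra.
  have : (j < i.+1)%N by rewrite -(ltr_nat R) -natr1; lra.
  by rewrite !ltnS => ji ij'; move: ij; rewrite eqn_leq ji ij'.
apply: null_sub (null_bigcup (F := fun k =>
    [set x | S (x + v k)] `|` [set x | S (x + - v k)]) _); last first.
  by move=> k; apply: nullU; exact: null_translate.
move=> x _; have := floor_itv (x 0 i0); rewrite /S /=.
case: (Num.floor (x 0 i0)) => k /andP[h1 h2].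
  exists k => //; left; rewrite /= !mxE !eqxx mulr1; move: h1 h2.
  by rewrite intrD -!pmulrn => h1 h2; apply/andP; split; lra.
exists k.+1 => //; right; rewrite /= !mxE !eqxx mulr1 opprK; move: h1 h2.
by rewrite NegzE intrD mulrNz -!pmulrn => h1 h2; apply/andP; split; lra.
Qed.

End hyperplane.

(** * Derivatives along lines and translated integrals *)

Section line_derivative.
Context {R : realType} {n : nat}.
Implicit Types (x y v : 'rV[R]_n) (F : 'rV[R]_n -> R).

(** Directional derivatives are derivatives of functions of one variable, to
    which the mean value theorem and differentiation under the integral sign
    apply. *)
Lemma is_derive_lineP F y v (t d : R) :
  is_derive (y + t *: v) v F d <->
  is_derive t 1 (fun s : R => F (y + s *: v)) d.
Proof.
pose G (s : R) := F (y + s *: v); set z := y + t *: v.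
have E : (fun h : R => h^-1 *: ((G \o shift t) (h *: (1 : R)) - G t)) =
         (fun h : R => h^-1 *: ((F \o shift z) (h *: v) - F z)).
  apply/funext => h; congr (_ *: (F _ - _)).
  by rewrite /= scalerDl -[X in _ + (X + _)]/(h * 1 *: v) mulr1 addrCA.
have Ed : derivable G t 1 = derivable F z v := congr1 (fun q => cvg (q @ 0^')) E.
have ED : 'D_1 G t = 'D_v F z := congr1 (fun q => lim (q @ 0^')) E.
split=> -[ex <-]; split.
- by rewrite -/G Ed.
- exact: ED.
- by rewrite -Ed.
- exact/esym/ED.
Qed.

Lemma is_derive_comp1 F x v (w : R -> R) (d dw : R) :
  is_derive x v F d -> is_derive (F x) 1 w dw ->
  is_derive x v (w \o F) (dw * d).
Proof.
move=> hF hw.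
have xE : x = x + 0 *: v by rewrite scale0r addr0.
rewrite xE; apply/is_derive_lineP; rewrite xE in hF hw.
exact: (@is_derive1_comp _ w (fun s : R => F (x + s *: v)) 0 dw d hw
  ((is_derive_lineP _ _ _ _ _).1 hF)).
Qed.

Lemma is_derive1_continuous (g : R -> R) (t d : R) : is_derive t 1 g d ->
  {for t, continuous g}.
Proof.
by move=> [ex _]; apply: differentiable_continuous; exact/derivable1_diffP.
Qed.

End line_derivative.

Section translation_integral.
Context {R : realType} {n : nat}.
Local Notation mu := (@lebesgue_n R n).
Implicit Types (x y v : 'rV[R]_n) (F dF : 'rV[R]_n -> R) (D : set (Rn R n)).

Lemma bounded_integrable_rV D F (M : R) : measurable D -> (mu D < +oo)%E ->
  measurable_fun D (F : Rn R n -> R) -> (forall x, D x -> `|F x| <= M) ->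
  mu.-integrable D (EFin \o F).
Proof.
move=> mD Doo mF FM; apply: measurable_bounded_integrable => //.
exists M; split; first exact: num_real.
by move=> M' MM' x Dx; apply: le_trans (FM x Dx) _; exact: ltW.
Qed.

Lemma continuous_shift F v : continuous F -> continuous (fun x => F (x + v)).
Proof.
move=> cF x; have h : {for x, continuous (fun x : 'rV[R]_n => x + v)}.
  by apply: (@cvgD _ _ _ (nbhs x) _ id (cst v) x v); [exact: cvg_id|exact: cvg_cst].
exact: (@continuous_comp _ _ _ _ F x h (cF _)).
Qed.

Variables (F dF : 'rV[R]_n -> R) (v : 'rV[R]_n) (M : R) (D : set (Rn R n)).
Hypothesis (cF : continuous F) (cdF : continuous dF).
Hypothesis (dFP : forall x, is_derive x v F (dF x)).
Hypothesis (FM : forall x, `|F x| <= M) (dFM : forall x, `|dF x| <= M).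
Hypothesis (mD : measurable D) (Doo : (mu D < +oo)%E).

Let Phi (t : R) := (\int[mu]_(y in D) F ((y : 'rV[R]_n) + t *: v))%R.

(** Differentiation under the integral sign along a translation. *)
Lemma is_derive_integral_translate (t : R) :
  is_derive t 1 Phi (\int[mu]_(y in D) dF ((y : 'rV[R]_n) + t *: v))%R.
Proof.
pose f (s : R) (y : Rn R n) : R := F ((y : 'rV[R]_n) + s *: v).
have M0 : 0 <= M by apply: le_trans (FM 0).
have df (s : R) (y : Rn R n) : is_derive s 1 (f^~ y) (dF ((y : 'rV[R]_n) + s *: v)).
  exact/is_derive_lineP.
have It : `]t - 1, t + 1[%classic t by rewrite /= in_itv/=; apply/andP; split; lra.
have intf (s : R) : `]t - 1, t + 1[%classic s -> mu.-integrable D (EFin \o f s).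
  move=> _; apply: bounded_integrable_rV => //; last by move=> x _; exact: FM.
  apply: measurable_funTS; apply: continuous_measurable_rV.
  exact: continuous_shift.
have derf (s : R) (y : Rn R n) : `]t - 1, t + 1[%classic s -> D y -> derivable (f^~ y) s 1.
  by move=> _ _; have [] := df s y.
have intG : mu.-integrable D (EFin \o cst M).
  apply: (@bounded_integrable_rV D (cst M) M) => //.
  by move=> x _; rewrite /= ger0_norm.
have Gub (s : R) (y : Rn R n) : `]t - 1, t + 1[%classic s -> D y -> `|partial1of2 f s y| <= cst M y.
  by move=> _ _; rewrite partial1of2E; have [_ ->] := df s y; exact: dFM.
have h1 := @derivable_under_integral _ _ _ mu f D mD t _ _ It intf derf
  (cst M) (fun _ => M0) intG Gub.
have h2 := @differentiation_under_integral _ _ _ mu f D mD t _ _ It intf derf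
  (cst M) (fun _ => M0) intG Gub.
split; first exact: h1.
rewrite -derive1E [LHS]h2; apply: eq_Rintegral => y _.
by rewrite partial1of2E; have [_ ->] := df t y.
Qed.

(** The derivative of the translated integral vanishes along the segment. *)
Lemma integral_translate_invariant :
  (forall t, 0 <= t -> t <= 1 ->
     (\int[mu]_(y in D) dF ((y : 'rV[R]_n) + t *: v))%R = 0) ->
  (\int[mu]_(y in D) F ((y : 'rV[R]_n) + v))%R = (\int[mu]_(y in D) F y)%R.
Proof.
move=> h0.
have [|c c01] := @MVT _ Phi (fun t => \int[mu]_(y in D) dF ((y : 'rV[R]_n) + t *: v))%R
  0 1 ltr01 (fun s _ => is_derive_integral_translate s).
  by apply: continuous_subspaceT => s; exact: (is_derive1_continuous (is_derive_integral_translate s)).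
move: c01; rewrite in_itv/= => /andP[c0 c1].
rewrite h0 ?ltW// mul0r => /eqP; rewrite subr_eq0 => /eqP.
rewrite /Phi scale1r => ->; apply: eq_Rintegral => y _.
by rewrite scale0r addr0.
Qed.

End translation_integral.

(** * Smooth functions and cutoffs *)

Section gradients.
Context {R : realType} {n : nat}.
Implicit Types (x y c u v : 'rV[R]_n) (f g : 'rV[R]_n -> R)
  (df dg : 'rV[R]_n -> 'rV[R]_n).

(** The derivatives in all directions, not only the partial ones, are part of
    the notion, since sets are moved along arbitrary vectors. *)
Definition has_grad f df := [/\ continuous f,
  forall i, continuous (fun x => df x 0 i) &
  forall x v, is_derive x v f (dotp (df x) v)].

Lemma has_grad_cst (k : R) : has_grad (fun=> k) (fun=> 0).
Proof.
split=> [|i|x v]; [exact: cst_continuous|exact: cst_continuous|].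
apply: (is_derive_eq (is_derive_cst _ _ _)).
by rewrite -(scale0r (0 : 'rV[R]_n)) dotpZl mul0r.
Qed.

Lemma has_grad_dotp u : has_grad (fun x => dotp x u) (fun=> u).
Proof.
split=> [|i|x v]; [exact: dotp_continuous|exact: cst_continuous|].
have xE : x = x + 0 *: v by rewrite scale0r addr0.
rewrite xE; apply/is_derive_lineP.
rewrite (_ : (fun s => _) = cst (dotp x u) + dotp v u \*: id); last first.
  by apply/funext => s; rewrite dotpDl dotpZl /= mulrC.
apply: (is_derive_eq (is_deriveD _ _)).
by rewrite add0r [LHS]mulr1 dotpC.
Qed.

Lemma has_gradD f g df dg : has_grad f df -> has_grad g dg ->
  has_grad (fun x => f x + g x) (fun x => df x + dg x).
Proof.
move=> [cf cdf hf] [cg cdg hg]; split=> [x|i x|x v].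
- by rewrite /continuous_at; exact: (@cvgD _ _ _ (nbhs x) _ _ _ _ _ (cf x) (cg x)).
- rewrite /continuous_at; under eq_fun do rewrite mxE; rewrite mxE.
  exact: (@cvgD _ _ _ (nbhs x) _ _ _ _ _ (cdf i x) (cdg i x)).
- by apply: (is_derive_eq (is_deriveD (hf x v) (hg x v))); rewrite dotpDl.
Qed.

Lemma has_gradM f g df dg : has_grad f df -> has_grad g dg ->
  has_grad (fun x => f x * g x) (fun x => f x *: dg x + g x *: df x).
Proof.
move=> [cf cdf hf] [cg cdg hg]; split=> [x|i x|x v].
- by rewrite /continuous_at; exact: (@cvgM _ _ (nbhs x) _ _ _ _ _ (cf x) (cg x)).
- rewrite /continuous_at; under eq_fun do rewrite !mxE; rewrite !mxE.
  exact: (@cvgD _ _ _ (nbhs x) _ _ _ _ _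
    (@cvgM _ _ (nbhs x) _ _ _ _ _ (cf x) (cdg i x))
    (@cvgM _ _ (nbhs x) _ _ _ _ _ (cg x) (cdf i x))).
- apply: (is_derive_eq (is_deriveM (hf x v) (hg x v))).
  by rewrite dotpDl !dotpZl.
Qed.

Lemma has_gradZ (k : R) f df : has_grad f df ->
  has_grad (fun x => k * f x) (fun x => k *: df x).
Proof.
move=> [cf cdf hf]; split=> [x|i x|x v].
- exact: (@cvgMl_tmp _ _ (nbhs x) _ _ _ _ (cf x)).
- rewrite /continuous_at; under eq_fun do rewrite mxE; rewrite mxE.
  exact: (@cvgMl_tmp _ _ (nbhs x) _ _ _ _ (cdf i x)).
- by apply: (is_derive_eq (is_deriveZ k (hf x v))); rewrite dotpZl.
Qed.

Lemma has_grad_comp (w w' : R -> R) f df :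
  (forall y : R, is_derive y 1 w (w' y)) -> continuous w' -> has_grad f df ->
  has_grad (fun x => w (f x)) (fun x => w' (f x) *: df x).
Proof.
move=> hw cw' [cf cdf hf]; split=> [x|i x|x v].
- exact: (@continuous_comp _ _ _ f w x (cf x) (is_derive1_continuous (hw _))).
- rewrite /continuous_at; under eq_fun do rewrite mxE; rewrite mxE.
  exact: (@cvgM _ _ (nbhs x) _ _ _ _ _
    (@continuous_comp _ _ _ f w' x (cf x) (cw' _)) (cdf i x)).
- rewrite dotpZl; exact: is_derive_comp1 (hf x v) (hw _).
Qed.

Lemma has_grad_prod (I : Type) (s : seq I) (F : I -> 'rV[R]_n -> R)
  (dF : I -> 'rV[R]_n -> 'rV[R]_n) : (forall i, has_grad (F i) (dF i)) ->
  exists df, has_grad (fun x => \prod_(i <- s) F i x) df.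
Proof.
move=> h; elim: s => [|i s [df hs]].
  by exists (fun=> 0); under eq_fun do rewrite big_nil; exact: has_grad_cst.
eexists; under eq_fun do rewrite big_cons; exact: has_gradM (h i) hs.
Qed.

Lemma has_grad_shift f df c : has_grad f df ->
  has_grad (fun x => f (x + c)) (fun x => df (x + c)).
Proof.
move=> [cf cdf hf]; split=> [|i|x v]; first exact: continuous_shift.
  exact: (@continuous_shift _ _ (fun x => df x 0 i)).
have xE : x = x + 0 *: v by rewrite scale0r addr0.
rewrite xE; apply/is_derive_lineP.
have -> : (fun s : R => f (x + s *: v + c)) = (fun s => f ((x + c) + s *: v)).
  by apply/funext => s; rewrite addrAC.
by apply/is_derive_lineP; rewrite scale0r !addr0.
Qed.

Lemma has_grad_sqr c : has_grad (fun x => dotp (x - c) (x - c))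
  (fun x => 2 *: (x - c)).
Proof.
suff h : has_grad (fun x => dotp x x) (fun x => 2 *: x).
  exact: (has_grad_shift (- c) h).
split=> [|i x|x v]; first exact: dotpp_continuous.
  rewrite /continuous_at; under eq_fun do rewrite mxE; rewrite mxE.
  exact: (@cvgMl_tmp _ _ (nbhs x) _ _ _ _ (@coord_continuous R 1 n 0 i x)).
have xE : x = x + 0 *: v by rewrite scale0r addr0.
rewrite {1}xE; apply/is_derive_lineP.
rewrite (_ : (fun s => _) = cst (dotp x x) + (2 * dotp x v) \*: id +
   dotp v v \*: (id * id)); last first.
  apply/funext => s; rewrite !dotpE (dotpC v x) !fctE /=.
  by rewrite /GRing.scale/=; ring.
apply: (is_derive_eq (is_deriveD _ _)).
by rewrite /GRing.scale/= dotpZl; ring.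
Qed.

End gradients.

Section cutoff.
Context {R : realType}.

Definition pos2 (y : R) : R := maxr y 0 ^+ 2.

Lemma is_derive_pos2 (y : R) : is_derive y 1 pos2 (2 * maxr y 0).
Proof.
have key (h : R) : `|pos2 (h + y) - pos2 y - 2 * maxr y 0 * h| <= h ^+ 2.
  have h2 := sqr_ge0 h; have hy2 := sqr_ge0 (h + y); have y2 := sqr_ge0 y.
  rewrite /pos2 ler_norml; have [y0|y0] := leP y 0; have [hy0|hy0] := leP (h + y) 0.
  - by apply/andP; split; lra.
  - have : h * y <= 0 by nra.
    by move=> ?; apply/andP; split; nra.
  - by apply/andP; split; nra.
  - by apply/andP; split; nra.
have cv : (h^-1 *: (pos2 (h *: (1 : R) + y) - pos2 y)) @[h --> 0^'] --> 2 * maxr y 0.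
  apply/cvgrPdist_le => /= e e0; near=> h.
  have h0 : h != 0 by near: h; exact: nbhs_dnbhs_neq.
  have -> : h *: (1 : R) = h by rewrite /GRing.scale/= mulr1.
  rewrite distrC (_ : _ - _ = h^-1 * (pos2 (h + y) - pos2 y - 2 * maxr y 0 * h)); last first.
    by rewrite /GRing.scale/=; field.
  rewrite normrM normfV ler_pdivrMl ?normr_gt0//.
  apply: le_trans (key h) _; rewrite -real_normK ?num_real// expr2.
  by rewrite ler_wpM2l// ltW//; near: h; exact: dnbhs0_lt.
by split; [apply/cvg_ex; eexists; exact: cv|exact: cvg_lim cv].
Unshelve. all: by end_near. Qed.

Lemma continuous_max0 : continuous (fun y : R => maxr y 0).
Proof.
move=> y; rewrite /continuous_at; under eq_fun do rewrite max0E; rewrite max0E; apply: cvgMr.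
by apply: cvgD; [exact: cvg_id|apply: cvg_norm; exact: cvg_id].
Qed.

(** A C^1 step decreasing from 1 on y <= 0 to 0 on y >= 1. *)
Definition step (y : R) : R := pos2 (1 - pos2 y).

Definition step' (y : R) : R := - (4 * maxr (1 - pos2 y) 0 * maxr y 0).

Let is_derive_1Bpos2 (y : R) :
  is_derive y 1 (fun y => 1 - pos2 y) (- (2 * maxr y 0)).
Proof.
have h0 := is_deriveB (is_derive_cst (1 : R) y (1 : R)) (is_derive_pos2 y).
by rewrite sub0r in h0.
Qed.

Lemma is_derive_step (y : R) : is_derive y 1 step (step' y).
Proof.
have h1 := @is_derive1_comp _ pos2 (fun y => 1 - pos2 y) y _ _
  (is_derive_pos2 _) (is_derive_1Bpos2 y).
by apply: (is_derive_eq h1); rewrite /step'; ring.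
Qed.

Lemma continuous_step' : continuous step'.
Proof.
move=> y; rewrite /continuous_at; apply: cvgN; apply: cvgM; last exact: continuous_max0.
apply: cvgMr.
have h := is_derive1_continuous (is_derive_1Bpos2 y).
exact: (@continuous_comp _ _ _ _ _ y h (@continuous_max0 _)).
Qed.

Lemma pos2_ge0 y : 0 <= pos2 y. Proof. exact: sqr_ge0. Qed.

Lemma step_le0 y : y <= 0 -> step y = 1.
Proof.
move=> y0; rewrite /step {2}/pos2 max_r// expr0n/= subr0 /pos2 max_l ?expr1n//.
Qed.

Lemma step_ge1 y : 1 <= y -> step y = 0.
Proof.
move=> y1; rewrite /step {1}/pos2 max_r ?expr0n// subr_le0 /pos2 max_l ?(le_trans _ y1)//.
exact: exprn_ege1.
Qed.

Lemma step_ge0 y : 0 <= step y. Proof. exact: pos2_ge0. Qed.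

Lemma step_le1 y : step y <= 1.
Proof.
rewrite /step {1}/pos2 exprn_ile1// ?le_max ?lexx ?orbT// ge_max ler01 andbT.
by rewrite lerBlDr lerDl pos2_ge0.
Qed.

Lemma step'_le0 y : step' y <= 0.
Proof. by rewrite oppr_le0 !mulr_ge0// le_max lexx orbT. Qed.

Lemma step'_eq0 y : y <= 0 -> step' y = 0.
Proof. by move=> y0; rewrite /step' [X in _ * X]max_r// mulr0 oppr0. Qed.

End cutoff.

(** * Integrals of compactly supported functions *)

Section compact_eball.
Context {R : realType} {n : nat}.
Local Notation mu := (@lebesgue_n R n).
Implicit Types (x y c v : 'rV[R]_n) (F g : 'rV[R]_n -> R).

Lemma mx_norm_le_enorm x : `|x| <= enorm x.
Proof.
rewrite [leLHS]/Num.Def.normr/= mx_normrE; apply: bigmax_le; first exact: enorm_ge0.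
by move=> [i j] _ /=; rewrite ord1 coord_le_enorm.
Qed.

Lemma compact_eball c (r : R) : compact (eball c r).
Proof.
apply: bounded_closed_compact; last exact: eball_closed.
exists (r + enorm c); split; first exact: num_real.
move=> M rM x xc; apply: le_trans (mx_norm_le_enorm x) _; apply: le_trans (ltW rM).
rewrite -[x](subrK c); apply: le_trans (enormD _ _) _; exact: lerD.
Qed.

Lemma continuous_bounded_eball F c (r : R) : continuous F ->
  exists M : R, forall x, eball c r x -> `|F x| <= M.
Proof.
move=> cF; have [B0|B0] := pselect (eball c r !=set0); last first.
  by exists 0 => x xc; exfalso; apply: B0; exists x.
have cn : {within eball c r, continuous (fun x => `|F x|)}.
  apply: continuous_subspaceT => x.
  exact: (cvg_norm (cF x)).
have [x0 _ h] := compact_EVT_max B0 (@compact_eball c r) cn.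
by exists `|F x0| => x xc; apply: h; rewrite inE.
Qed.

Lemma continuous_supp_bounded F c (r : R) : continuous F ->
  (forall x, ~ eball c r x -> F x = 0) -> exists M : R, forall x, `|F x| <= M.
Proof.
move=> cF F0; have [M FM] := continuous_bounded_eball c r cF.
exists (Num.max M 0) => x; rewrite le_max.
have [xc|xc] := pselect (eball c r x); first by rewrite FM.
by rewrite F0// normr0 lexx orbT.
Qed.

Lemma continuous_integrable_eball F c (r : R) (D : set (Rn R n)) :
  continuous F -> measurable D -> D `<=` eball c r ->
  mu.-integrable D (EFin \o F).
Proof.
move=> cF mD Dc; have [M FM] := continuous_bounded_eball c r cF.
apply: (@bounded_integrable_rV _ _ D F M) => //.
- by apply: le_lt_trans (le_lebesgue_outer Dc) _; exact: lebesgue_outer_eball_lty.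
- by apply: measurable_funTS; exact: continuous_measurable_rV.
- by move=> x /Dc; exact: FM.
Qed.

Lemma Rintegral_supp F (S D : set (Rn R n)) : S `<=` D ->
  (forall x, D x -> ~ S x -> F x = 0) ->
  (\int[mu]_(x in D) F x)%R = (\int[mu]_(x in S) F x)%R.
Proof.
move=> SD F0; rewrite Rintegral_mkcond [RHS]Rintegral_mkcond.
congr Rintegral; apply/funext => x; rewrite !patchE.
have [xS|xS] := pselect (S x).
  by rewrite (mem_set xS) (mem_set (SD _ xS)).
rewrite (memNset xS); have [xD|xD] := pselect (D x); last by rewrite (memNset xD).
by rewrite (mem_set xD) F0.
Qed.

Lemma Rintegral_translate F v (D : set (Rn R n)) : (0 < n)%N ->
  continuous F -> measurable D ->
  mu.-integrable [set x | D ((x : 'rV[R]_n) + v)] (EFin \o (fun x : 'rV[R]_n => F (x + v))) ->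
  (\int[mu]_(x in [set x : Rn R n | D ((x : 'rV[R]_n) + v)]) F ((x : 'rV[R]_n) + v))%R =
  (\int[mu]_(x in D) F x)%R.
Proof.
move=> n0 cF mD iF; rewrite /Rintegral; congr fine.
pose phi (x : Rn R n) : Rn R n := (x : 'rV[R]_n) + v.
have mphi : measurable_fun [set: Rn R n] phi.
  by move=> _ A mA; rewrite setTI; exact: measurable_translate.
have mF : measurable_fun [set: Rn R n] (EFin \o (F : Rn R n -> R)).
  by apply/measurable_EFinP; exact: continuous_measurable_rV.
have := @integral_pushforward _ _ _ _ _ phi mphi mu D (EFin \o F) mF iF mD.
move=> <-; apply: eq_measure_integral => A mA _.
exact: (lebesgue_outer_translate n0 v A).
Qed.

Lemma is_derive_outside_supp F (dF : 'rV[R]_n -> R) v c (r : R) :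
  (forall x, is_derive x v F (dF x)) -> (forall x, ~ eball c r x -> F x = 0) ->
  forall x, ~ eball c r x -> dF x = 0.
Proof.
move=> hF F0 x xc; have nF : \near x, F x = cst 0 x.
  have o : open_nbhs x (~` eball c r).
    by split=> //; apply: closed_openC; exact: eball_closed.
  by apply: filterS (open_nbhs_nbhs o) => y /F0.
have h1 := near_eq_is_derive nF (hF x).
have [_ <-] := h1; have [_ ->] := is_derive_cst (0 : R) x v.
by [].
Qed.

(** The total integral of a directional derivative is the derivative of a
    translation-invariant quantity. *)
Lemma integral_derive_eq0 F (dF : 'rV[R]_n -> R) v c (r : R) (D : set (Rn R n)) :
  (0 < n)%N -> continuous F -> continuous dF ->
  (forall x, is_derive x v F (dF x)) -> (forall x, ~ eball c r x -> F x = 0) ->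
  eball c r `<=` D -> (\int[mu]_(x in D) dF x)%R = 0.
Proof.
move=> n0 cF cdF hF F0 BD.
have dF0 := is_derive_outside_supp hF F0.
have [M1 FM1] := continuous_supp_bounded cF F0.
have [M2 FM2] := continuous_supp_bounded cdF dF0.
pose M := maxr M1 M2.
have FM x : `|F x| <= M by rewrite le_max FM1.
have dFM x : `|dF x| <= M by rewrite le_max FM2 orbT.
pose D0 : set (Rn R n) := eball c (r + enorm v).
have mD0 : measurable D0 by exact: measurable_eball.
have D0oo : (mu D0 < +oo)%E by exact: lebesgue_outer_eball_lty.
have BD0 : eball c r `<=` D0.
  by move=> x; rewrite /D0 /eball/= => h; apply: le_trans h _; rewrite lerDl enorm_ge0.
rewrite (Rintegral_supp BD); last by move=> x _; exact: dF0.
rewrite -(Rintegral_supp BD0); last by move=> x _; exact: dF0.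
have h := is_derive_integral_translate cF hF FM dFM mD0 D0oo 0.
have Phi0 : \forall t \near (0 : R), (\int[mu]_(y in D0) F ((y : 'rV[R]_n) + t *: v))%R =
    cst (\int[mu]_(y in eball c r) F y)%R t.
  have : \forall t \near (0 : R), `|t| <= 1.
    by apply: (filterS _ (nbhs0_le (ltr01 : 0 < 1 :> R))).
  apply: filterS => t t1 /=.
  pose D1 : set (Rn R n) := eball (c + t *: v) (r + enorm v).
  have D1E : D0 = [set x : Rn R n | D1 ((x : 'rV[R]_n) + t *: v)].
    apply/seteqP; split=> x; rewrite /D0 /D1 /eball/= opprD addrACA subrr addr0//.
  have mD1 : measurable D1 by exact: measurable_eball.
  rewrite D1E (Rintegral_translate n0 cF mD1); last first.
    rewrite -D1E; apply: (continuous_integrable_eball _ mD0 (fun x h => h)).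
    exact: continuous_shift.
  apply: Rintegral_supp => [x|x _]; last exact: F0.
  rewrite /D1 /eball/= opprD addrA => xc; apply: le_trans (enormD _ _) _.
  by rewrite lerD// enormN enormZ ler_piMl// enorm_ge0.
have [_ h2] := near_eq_is_derive Phi0 h.
have [_ h3] := is_derive_cst (\int[mu]_(y in eball c r) F y)%R (0 : R) (1 : R).
rewrite h3 in h2; rewrite h2; apply: eq_Rintegral => y _.
by rewrite scale0r addr0.
Qed.

End compact_eball.

(** * Test fields *)

Section test_fields.
Context {R : realType} {n : nat}.
Implicit Types (x y c v : 'rV[R]_n) (f : 'rV[R]_n -> R)
  (phi : 'rV[R]_n -> 'rV[R]_n).
Local Notation e_ i := (delta_mx 0 i : 'rV[R]_n).

(** Move from x to y by changing one coordinate at a time, and apply the mean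
    value theorem to each step. *)
Lemma lipschitz_of_partials f (d : 'I_n -> 'rV[R]_n -> R) (M : R) :
  (forall i x, is_derive x (e_ i) f (d i x)) -> (forall i x, `|d i x| <= M) ->
  forall x y, `|f y - f x| <= M * \sum_i `|y 0 i - x 0 i|.
Proof.
move=> fd dM x y.
have step1 p i (t : R) : `|f (p + t *: e_ i) - f p| <= M * `|t|.
  pose g (s : R) := f (p + s *: e_ i).
  have dg (s : R) : is_derive s 1 g (d i (p + s *: e_ i)) by exact/is_derive_lineP.
  have cg (A : set R) : {within A, continuous g}.
    by apply: continuous_subspaceT => s; exact: (is_derive1_continuous (dg s)).
  have gE : f (p + t *: e_ i) - f p = g t - g 0 by rewrite /g scale0r addr0.
  rewrite gE; have [t0|/ltW t0] := leP 0 t.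
    have [s _ ->] := MVT_segment t0 (fun s _ => dg s) (cg _).
    by rewrite subr0 normrM ler_wpM2r.
  have [s _ h] := MVT_segment t0 (fun s _ => dg s) (cg _).
  by rewrite distrC h sub0r normrM normrN ler_wpM2r.
pose z (s : seq 'I_n) := \row_i (if i \in s then y 0 i else x 0 i).
suff key s : uniq s -> `|f (z s) - f x| <= M * \sum_(i <- s) `|y 0 i - x 0 i|.
  have := key (index_enum 'I_n) (index_enum_uniq _).
  by rewrite (_ : z _ = y)//; apply/rowP => i; rewrite mxE mem_index_enum.
elim: s => [_|i s IH /= /andP[is_ us]].
  by rewrite big_nil mulr0 (_ : z [::] = x) ?subrr ?normr0//; apply/rowP => i; rewrite mxE.
have -> : z (i :: s) = z s + (y 0 i - x 0 i) *: e_ i.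
  apply/rowP => j; rewrite !mxE inE; case: eqP => [->|_].
    by rewrite (negbTE is_) /= mulr1 subrKC.
  by rewrite mulr0 addr0.
rewrite big_cons mulrDr -(subrKA (f (z s))).
by apply: le_trans (ler_normD _ _) _; apply: lerD (step1 _ _ _) (IH us).
Qed.

Lemma lipschitz_continuous f (M : R) :
  (forall x y, `|f y - f x| <= M * \sum_i `|y 0 i - x 0 i|) -> continuous f.
Proof.
move=> h x; apply/(@cvgrPdist_le _ _ _ (nbhs x)) => /= e e0.
have c0 : 0 < `|M| * n%:R + 1 by rewrite ltr_wpDl// mulr_ge0.
have e'0 : 0 < e / (`|M| * n%:R + 1) by rewrite divr_gt0.
have nx : nbhs x [set y | `|x - y| <= e / (`|M| * n%:R + 1)].
  apply/nbhs_ballP; exists (e / (`|M| * n%:R + 1)) => //= y.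
  by rewrite -ball_normE => /ltW.
near=> y; rewrite distrC; apply: le_trans (h _ _) _.
have yx : `|x - y| <= e / (`|M| * n%:R + 1) by near: y.
apply: (@le_trans _ _ (`|M| * \sum_(i < n) `|x - y|)).
  apply: (@le_trans _ _ (`|M| * \sum_i `|y 0 i - x 0 i|)).
    by rewrite ler_wpM2r ?ler_norm// sumr_ge0.
  rewrite ler_wpM2l//; apply: ler_sum => i _.
  rewrite distrC [leRHS]/Num.Def.normr/= mx_normrE.
  apply: le_trans (le_bigmax _ _ (0, i)).
  by rewrite !mxE.
rewrite sumr_const card_ord -mulr_natl mulrA.
apply: (@le_trans _ _ ((`|M| * n%:R + 1) * `|x - y|)).
  by rewrite ler_wpM2r// lerDl.
by rewrite mulrC -ler_pdivlMr.
Unshelve. all: by end_near. Qed.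

Section field.
Variables (phi : 'rV[R]_n -> 'rV[R]_n) (tphi : test_field phi).

Definition dcoord (i j : 'I_n) x : R := ('D_(e_ i) phi x) 0 j.

Lemma is_derive_coord i j x : is_derive x (e_ i) (fun x => phi x 0 j) (dcoord i j x).
Proof.
have [Cphi _ _] := tphi; have [dphi _] := Cphi i.
have /derivable_mxP h := dphi x.
by split; [exact: h|rewrite /dcoord derive_mx// mxE].
Qed.

Lemma dcoord_continuous i j : continuous (dcoord i j).
Proof.
have [Cphi _ _] := tphi; have [_ cphi] := Cphi i => x.
exact: (@continuous_comp _ _ _ _ _ x (cphi x) (@coord_continuous R 1 n 0 j _)).
Qed.

Lemma test_field_bounded_supp :
  exists K : R, forall x, ~ eball 0 K x -> phi x = 0.
Proof.
have [_ /compact_bounded [M [_ hM]] _] := tphi.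
exists (n%:R * (M + 1)) => x; rewrite /eball/= subr0 => xK.
apply: contrapT => /eqP phix; apply: xK; apply: enorm_le_sup => i.
have := hM (M + 1) _ x; rewrite ltrDl ltr01 => /(_ isT).
have xc : closure [set x | phi x != 0] x by exact: subset_closure.
move=> /(_ xc); apply: le_trans.
rewrite [leRHS]/Num.Def.normr/= mx_normrE.
exact: le_trans (le_bigmax _ _ (0, i)).
Qed.

(** A test field is only known to have continuous partial derivatives. They are
    bounded, the support being compact, which makes the field Lipschitz. *)
Lemma test_field_coord_continuous j : continuous (fun x => phi x 0 j).
Proof.
have [K Kphi] := test_field_bounded_supp.
have h0 x : ~ eball 0 K x -> phi x 0 j = 0 by move=> /Kphi ->; rewrite mxE.
have hb i : exists M : R, forall x, `|dcoord i j x| <= M.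
  apply: (continuous_supp_bounded (@dcoord_continuous i j) (c := 0) (r := K)).
  exact: (is_derive_outside_supp (@is_derive_coord i j) h0).
pose M i := sval (cid (hb i)).
apply: (@lipschitz_continuous _ (\sum_i `|M i|)).
apply: (@lipschitz_of_partials _ (fun i => dcoord i j)).
  by move=> i x; exact: is_derive_coord.
move=> i x; rewrite (bigD1 i)//=.
apply: le_trans (_ : `|M i| <= _); last by rewrite lerDl sumr_ge0.
apply: le_trans (ler_norm (M i)); rewrite /M; case: cid => //=.
Qed.

Lemma divergence_continuous : continuous (divergence phi).
Proof.
move=> x; apply: (@cvg_big R 'I_n +%R 0 xpredT add_continuous _ (nbhs x)) => i _.
exact: dcoord_continuous.
Qed.

End field.

End test_fields.

(** * The perimeter of a ball *)

Section bounded_convergence.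
Context {R : realType} {n : nat}.
Local Notation mu := (@lebesgue_n R n).

Lemma Rintegral_bounded_cvg (D : set (Rn R n)) (F : nat -> Rn R n -> R)
  (f : Rn R n -> R) (M : R) : measurable D -> (mu D < +oo)%E ->
  (forall k, measurable_fun D (F k)) ->
  (forall k x, D x -> `|F k x| <= M) ->
  (forall x, D x -> F k x @[k --> \oo] --> f x) ->
  (\int[mu]_(x in D) F k x)%R @[k --> \oo] --> (\int[mu]_(x in D) f x)%R.
Proof.
move=> mD Doo mF FM Ff.
have iM : mu.-integrable D (EFin \o cst `|M|).
  by apply: (@bounded_integrable_rV _ _ D (cst `|M|) `|M|) => // x _; rewrite /= normr_id.
have mF' k : measurable_fun D (fun x => (F k x)%:E) by exact/measurable_EFinP.
have Ff' x : D x -> (F k x)%:E @[k --> \oo] --> (f x)%:E.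
  by move=> Dx; apply: cvg_EFin; [exact: nearW|exact: Ff].
have mf : measurable_fun D (fun x => (f x)%:E).
  exact: (emeasurable_fun_cvg _ _ mF' Ff').
have FM' : \forall x \ae mu, forall k, D x -> (`|(F k x)%:E| <= (`|M|%R)%:E)%E.
  apply: aeW => x k Dx.
  by rewrite /= lee_fin (le_trans (FM k x Dx))// ler_norm.
have [if_ _ h] := @dominated_convergence _ _ _ mu D mD (fun k x => (F k x)%:E)
  (fun x => (f x)%:E) (EFin \o cst `|M|) mF' mf (aeW _ Ff') iM FM'.
apply: fine_cvg; rewrite /Rintegral fineK//.
exact: integrable_fin_num.
Qed.

End bounded_convergence.

Section continuous_ops.
Context {R : realType} {n : nat}.
Implicit Types (f g : 'rV[R]_n -> R).

Lemma continuousD_rV f g : continuous f -> continuous g ->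
  continuous (fun x => f x + g x).
Proof. by move=> cf cg x; exact: (@cvgD _ _ _ (nbhs x) _ _ _ _ _ (cf x) (cg x)). Qed.

Lemma continuousM_rV f g : continuous f -> continuous g ->
  continuous (fun x => f x * g x).
Proof. by move=> cf cg x; exact: (@cvgM _ _ (nbhs x) _ _ _ _ _ (cf x) (cg x)). Qed.

Lemma continuousB_rV f g : continuous f -> continuous g ->
  continuous (fun x => f x - g x).
Proof. by move=> cf cg x; exact: (@cvgB _ _ _ (nbhs x) _ _ _ _ _ (cf x) (cg x)). Qed.

Lemma continuous_cst_rV (k : R) : continuous (fun _ : 'rV[R]_n => k).
Proof. exact: cst_continuous. Qed.

Lemma continuous_sum_rV (I : Type) (s : seq I) (F : I -> 'rV[R]_n -> R) :
  (forall i, continuous (F i)) -> continuous (fun x => \sum_(i <- s) F i x).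
Proof.
by move=> cF x; apply: (@cvg_big R I +%R 0 xpredT add_continuous _ (nbhs x)) => i _; exact: cF.
Qed.

End continuous_ops.

Section ball_perimeter.
Context {R : realType} {n : nat} (n0 : (0 < n)%N).
Local Notation mu := (@lebesgue_n R n).
Implicit Types (x y c v : 'rV[R]_n) (phi : 'rV[R]_n -> 'rV[R]_n).

(** As k grows this decreases to the indicator of the ball; the square of the
    norm is used because, unlike the norm, it is smooth at the centre. *)
Definition radial_cutoff c (r k : R) x : R :=
  step (k * (dotp (x - c) (x - c) - r ^+ 2)).

Definition radial_cutoff' c (r k : R) x : 'rV[R]_n :=
  step' (k * (dotp (x - c) (x - c) - r ^+ 2)) *: (k *: (2 *: (x - c) + 0)).

Lemma radial_cutoff_grad c r k :
  has_grad (radial_cutoff c r k) (radial_cutoff' c r k).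
Proof.
apply: (has_grad_comp (@is_derive_step R) (@continuous_step' R)).
by apply: has_gradZ; apply: has_gradD; [exact: has_grad_sqr|exact: has_grad_cst].
Qed.

Lemma eball_sqr c r x : 0 <= r ->
  eball c r x <-> dotp (x - c) (x - c) <= r ^+ 2.
Proof.
by move=> r0; rewrite /eball/= -sqr_enorm ler_pXn2r// nnegrE ?enorm_ge0.
Qed.

Lemma radial_cutoff_in c r k x : 0 <= r -> 0 <= k -> eball c r x ->
  radial_cutoff c r k x = 1.
Proof.
by move=> r0 k0 /(eball_sqr c x r0) xB; rewrite /radial_cutoff step_le0// mulr_ge0_le0// subr_le0.
Qed.

Lemma radial_cutoff_out c r k x (q : R) : 0 < k -> 0 <= q ->
  1 <= k * (q ^+ 2 - r ^+ 2) -> ~ eball c q x -> radial_cutoff c r k x = 0.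
Proof.
move=> k0 q0 kq xq; apply: step_ge1; apply: le_trans kq _.
rewrite ler_pM2l// lerB// leNgt; apply/negP => /ltW h.
exact/xq/eball_sqr.
Qed.

Lemma measurable_continuous_on (D : set (Rn R n)) (F : 'rV[R]_n -> R) :
  continuous F -> measurable_fun D (F : Rn R n -> R).
Proof. by move=> cF; apply: measurable_funTS; exact: continuous_measurable_rV. Qed.

(** The divergence theorem against a smooth radial cutoff eta that approximates
    the indicator of the ball, applied to the field eta * (phi - (x - c) / r):
    where the gradient of eta is not zero, it points towards the centre and
    |x - c| > r, while phi has norm at most 1, so the gradient term has a
    sign. *)
Lemma cutoff_divergence_le c r phi k : 0 < r -> 1 <= k -> test_field phi ->
  (\int[mu]_(x in (eball c (r + 1) : set (Rn R n)))
     (radial_cutoff c r k x * (divergence phi x - n%:R * r^-1)))%R <= 0.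
Proof.
move=> r0 k1 tphi; have k0 : 0 < k by apply: lt_le_trans k1.
set s := radial_cutoff c r k; set gs := radial_cutoff' c r k.
have [cs cgs hs] : has_grad s gs by exact: radial_cutoff_grad.
set D : set (Rn R n) := eball c (r + 1).
have mD : measurable D by exact: measurable_eball.
have r10 : 0 <= r + 1 by rewrite addr_ge0// ltW.
pose q (i : 'I_n) x := phi x 0 i - r^-1 * (dotp (x - c) (delta_mx 0 i)).
pose F i x := s x * q i x.
pose dF i x := s x * (dcoord phi i i x - r^-1) + q i x * gs x 0 i.
have cxc i : continuous (fun x : 'rV[R]_n => dotp (x - c) (delta_mx 0 i)).
  exact: (continuous_shift (v := - c) (@dotp_continuous _ _ _)).
have cq i : continuous (q i).
  apply: continuousB_rV; first exact: test_field_coord_continuous.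
  by apply: continuousM_rV; [exact: continuous_cst_rV|exact: cxc].
have cF i : continuous (F i) by exact: continuousM_rV.
have cdF i : continuous (dF i).
  apply: continuousD_rV; apply: continuousM_rV => //.
  by apply: continuousB_rV; [exact: dcoord_continuous|exact: continuous_cst_rV].
have dq i x : is_derive x (delta_mx 0 i) (q i) (dcoord phi i i x - r^-1).
  have [_ _ h] := has_gradZ r^-1 (has_grad_shift (- c) (@has_grad_dotp R n (delta_mx 0 i))).
  apply: (is_derive_eq (is_deriveB (is_derive_coord tphi i i x) (h x (delta_mx 0 i)))).
  by rewrite dotpZl dotp_delta mxE !eqxx mulr1.
have dFP i x : is_derive x (delta_mx 0 i) (F i) (dF i x).
  apply: (is_derive_eq (is_deriveM (hs x (delta_mx 0 i)) (dq i x))).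
  by rewrite dotp_delta.
have F0 i x : ~ eball c (r + 1) x -> F i x = 0.
  move=> xD; rewrite /F /s (radial_cutoff_out k0 r10 _ xD) ?mul0r//.
  have r1 : 1 <= (r + 1) ^+ 2 - r ^+ 2 by nra.
  by rewrite -[leLHS]mul1r ler_pM.
have int0 i : (\int[mu]_(x in D) dF i x)%R = 0.
  exact: (integral_derive_eq0 n0 (cF i) (cdF i) (dFP i) (F0 i)).
have intS (t : seq 'I_n) : (\int[mu]_(x in D) (\sum_(i <- t) dF i x))%R = 0.
  elim: t => [|i t IH].
    rewrite (eq_Rintegral _ (g := cst 0)); last by move=> x _; rewrite big_nil.
    by rewrite Rintegral_cst// mul0r.
  rewrite (eq_Rintegral _ (g := fun x : Rn R n => dF i x + \sum_(j <- t) dF j x)); last first.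
    by move=> x _; rewrite big_cons.
  rewrite RintegralD//; first by rewrite int0 IH addr0.
    exact: (continuous_integrable_eball (cdF i) mD (fun x h => h)).
  apply: (continuous_integrable_eball _ mD (fun x h => h)).
  exact: continuous_sum_rV.
rewrite -(intS (index_enum 'I_n)); apply: le_Rintegral => //.
- apply: (continuous_integrable_eball _ mD (fun x h => h)).
  apply: continuousM_rV => //; apply: continuousB_rV; last exact: continuous_cst_rV.
  exact: divergence_continuous.
- apply: (continuous_integrable_eball _ mD (fun x h => h)).
  exact: continuous_sum_rV.
move=> x _; rewrite /dF big_split /= -mulr_sumr.
have -> : \sum_(i < n) (dcoord phi i i x - r^-1) = divergence phi x - n%:R * r^-1.
  by rewrite sumrB sumr_const card_ord -[_ *+ n]mulr_natl.
rewrite lerDl.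
have -> : \sum_(i < n) q i x * gs x 0 i = dotp (phi x - r^-1 *: (x - c)) (gs x).
  by apply: eq_bigr => i _; rewrite /q dotp_delta !mxE.
rewrite /gs /radial_cutoff' addr0 !dotpZr; set y := dotp (x - c) (x - c).
rewrite (dotpBl (phi x)) (dotpZl _ (x - c)) -/y.
have [yr|yr] := leP y (r ^+ 2).
  by rewrite step'_eq0 ?mul0r// mulr_ge0_le0 ?(ltW k0)// subr_le0.
rewrite mulr_le0 ?step'_le0// pmulr_rle0// pmulr_rle0// subr_le0.
have yE : y = enorm (x - c) ^+ 2 by rewrite sqr_enorm.
have xr : r < enorm (x - c).
  by rewrite -(@ltr_pXn2r _ 2) ?nnegrE ?enorm_ge0 ?(ltW r0)// -yE.
have [_ _ phi1] := tphi.
apply: le_trans (dotp_le_enorm _ _) _.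
apply: (@le_trans _ _ (enorm (x - c))).
  by rewrite ler_piMl ?enorm_ge0.
by rewrite yE ler_pdivlMl// expr2 ler_wpM2r ?enorm_ge0// ltW.
Qed.

(** Let the cutoffs tend to the indicator of the ball in
    [cutoff_divergence_le]. *)
Lemma perimeter_eball_le c r : 0 < r ->
  (perimeter (eball c r) <= (n%:R / r * fine (mu (eball c r)))%:E)%E.
Proof.
move=> r0; apply: ge_ereal_sup => _ [phi tphi <-].
set B : set (Rn R n) := eball c r; set D : set (Rn R n) := eball c (r + 1).
have mD : measurable D by exact: measurable_eball.
have mB : measurable B by exact: measurable_eball.
have Boo : (mu B < +oo)%E by exact: lebesgue_outer_eball_lty.
have Doo : (mu D < +oo)%E by exact: lebesgue_outer_eball_lty.
have BD : B `<=` D by move=> x; rewrite /B /D /eball/= => h; apply: le_trans h _; rewrite lerDl.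
pose g x := divergence phi x - n%:R * r^-1.
have cg : continuous g.
  by apply: continuousB_rV; [exact: divergence_continuous|exact: continuous_cst_rV].
have [M gM] := continuous_bounded_eball c (r + 1) cg.
have iB (f : 'rV[R]_n -> R) : continuous f -> mu.-integrable B (EFin \o f).
  by move=> cf; exact: (continuous_integrable_eball cf mB (fun x h => h)).
pose f_ (k : nat) (x : Rn R n) := radial_cutoff c r k.+1%:R x * g x.
have lim : (\int[mu]_(x in D) f_ k x)%R @[k --> \oo] -->
    (\int[mu]_(x in D) ((\1_B x : R) * g x))%R.
  apply: (@Rintegral_bounded_cvg _ _ D f_ _ M) => //.
  - move=> k; apply: measurable_continuous_on; apply: continuousM_rV => //.
    by have [] := radial_cutoff_grad c r k.+1%:R.
  - move=> k x Dx; rewrite normrM -[leRHS]mul1r ler_pM ?gM//.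
    by rewrite ger0_norm ?step_ge0 ?step_le1.
  - move=> x Dx; have [xB|xB] := pselect (B x).
      rewrite indicE mem_set// mul1r; apply: cvg_near_cst; apply: nearW => k.
      by rewrite /f_ radial_cutoff_in ?mul1r// ltW.
    rewrite indicE memNset// mul0r; apply: cvg_near_cst.
    have y0 : 0 < dotp (x - c) (x - c) - r ^+ 2.
      rewrite subr_gt0 ltNge; apply/negP => h; apply: xB.
      by apply/eball_sqr => //; exact: ltW.
    have [N _ hN] := nbhs_infty_gtr ((dotp (x - c) (x - c) - r ^+ 2)^-1).
    exists N => // k /= Nk; rewrite /f_ /radial_cutoff step_ge1 ?mul0r//.
    rewrite -ler_pdivrMr// mul1r ltW//; apply: hN => /=.
    by rewrite ltnW.
have le0 : (\int[mu]_(x in D) ((\1_B x : R) * g x))%R <= 0.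
  apply: (cvgr_to_le lim); apply: nearW => k.
  by apply: cutoff_divergence_le => //; rewrite ler1n.
move: le0; rewrite (@Rintegral_supp _ _ _ B D)//; last first.
  by move=> x _ xB; rewrite indicE memNset ?mul0r.
rewrite (eq_Rintegral _ (g := fun x : Rn R n => g x)); last first.
  by move=> x xB; rewrite indicE xB mul1r.
have cdiv := divergence_continuous tphi.
rewrite RintegralB//; [|exact: iB|exact: (iB (fun=> n%:R / r) (@continuous_cst_rV R n _))].
rewrite Rintegral_cst// subr_le0 => h.
have intdiv := iB _ cdiv.
rewrite -[leLHS](@fineK _); last exact: (integrable_fin_num mB intdiv).
by rewrite lee_fin.
Qed.

End ball_perimeter.

(** * Calibration of a pair of balls *)

Section smooth_fields.
Context {R : realType} {n : nat}.
Implicit Types (x y c v : 'rV[R]_n).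

Lemma continuous_row (f : 'I_n -> 'rV[R]_n -> R) : (forall j, continuous (f j)) ->
  continuous (fun x => \row_j f j x).
Proof.
move=> cf x; apply/(@cvgrPdist_lt _ _ _ (nbhs x)) => /= e e0.
have h (j : 'I_n) : nbhs x [set y | `|f j x - f j y| < e].
  by have /cvgrPdist_lt/(_ e e0) := cf j x.
have := filter_forall (nbhs_filter x) h; apply: filterS => y hy.
rewrite [ltLHS]/Num.Def.normr/= mx_normrE; apply: bigmax_lt => // -[i j] _ /=.
by rewrite !mxE; exact: hy.
Qed.

Section row_field.
Variables (f : 'I_n -> 'rV[R]_n -> R) (df : 'I_n -> 'rV[R]_n -> 'rV[R]_n).
Hypothesis fdf : forall j, has_grad (f j) (df j).

Let derivable_row x v : derivable (fun x => \row_j f j x) x v.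
Proof.
apply/derivable_mxP => i j.
have -> : (fun x => (\row_j0 f j0 x) i j) = f j by apply/funext => y; rewrite mxE.
by have [_ _ /(_ x v) []] := fdf j.
Qed.

Let derive_row x v :
  'D_v (fun x => \row_j f j x) x = \row_j dotp (df j x) v.
Proof.
rewrite derive_mx//; apply/rowP => j; rewrite !mxE.
have -> : (fun x => (\row_j0 f j0 x) 0 j) = f j by apply/funext => y; rewrite mxE.
by have [_ _ /(_ x v) []] := fdf j.
Qed.

Lemma row_C1_field : C1_field (fun x => \row_j f j x).
Proof.
move=> i; split=> [x|]; first exact: derivable_row.
under eq_fun do rewrite derive_row; apply: continuous_row => j.
under eq_fun do rewrite dotp_delta.
by have [_ h _] := fdf j; exact: h.
Qed.

Lemma row_divergence x : divergence (fun x => \row_j f j x) x = \sum_i df i x 0 i.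
Proof. by apply: eq_bigr => i _; rewrite derive_row mxE dotp_delta. Qed.

End row_field.

Lemma step'_ge1 (y : R) : 1 <= y -> step' y = 0.
Proof.
move=> y1; rewrite /step' (max_r (_ : 1 - pos2 y <= 0)) ?mulr0 ?mul0r ?oppr0//.
rewrite subr_le0 /pos2 max_l ?(le_trans _ y1)//; exact: exprn_ege1.
Qed.

Lemma radial_cutoff'_in c r k x : 0 <= r -> 0 <= k -> eball c r x ->
  radial_cutoff' c r k x = 0.
Proof.
move=> r0 k0 /(eball_sqr c x r0) xB.
by rewrite /radial_cutoff' step'_eq0 ?scale0r// mulr_ge0_le0// subr_le0.
Qed.

Lemma radial_cutoff'_out c r k x (q : R) : 0 < k -> 0 <= q ->
  1 <= k * (q ^+ 2 - r ^+ 2) -> ~ eball c q x -> radial_cutoff' c r k x = 0.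
Proof.
move=> k0 q0 kq xq; rewrite /radial_cutoff' step'_ge1 ?scale0r//.
apply: le_trans kq _; rewrite ler_pM2l// lerB// leNgt; apply/negP => /ltW h.
exact/xq/eball_sqr.
Qed.

End smooth_fields.

Section calibration.
Context {R : realType} {n : nat}.
Local Notation mu := (@lebesgue_n R n).
Implicit Types (x y : 'rV[R]_n).

Variables (c1 c2 : 'rV[R]_n) (r : R) (E : set (Rn R n)).
Hypothesis (r0 : 0 < r) (c12 : 2 * r < enorm (c1 - c2)).
Hypothesis (mE : measurable E) (Eoo : (mu E < +oo)%E).
Hypothesis EB : sub_ae E (eball c1 r `|` eball c2 r).
Hypothesis EP : (perimeter E <= (n%:R / r * fine (mu E))%:E)%E.
Variables (zeta : 'rV[R]_n -> R) (gz : 'rV[R]_n -> 'rV[R]_n) (v : 'rV[R]_n)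
  (rho : R).
Hypothesis (hz : has_grad zeta gz).
Hypothesis (rhor : rho < r).
Hypothesis (z1 : forall x, `|zeta x| <= 1).
Hypothesis (z0 : forall x, ~ eball c1 rho x -> zeta x = 0).

Let cgzv : continuous (fun x => dotp (gz x) v).
Proof.
have [_ cgz _] := hz; apply: continuous_sum_rV => i.
by apply: continuousM_rV; [exact: cgz|exact: continuous_cst_rV].
Qed.

Let gzv0 x : ~ eball c1 rho x -> dotp (gz x) v = 0.
Proof.
have [_ _ h] := hz; move: x.
exact: (is_derive_outside_supp (fun x => h x v) z0).
Qed.

Section field.
Variables (d e : R).
Hypothesis (d0 : 0 < d) (dc : 2 * (r + d) < enorm (c1 - c2)).
Hypothesis ev : `|e| * enorm v <= 1 - rho / r.

Let k : R := ((r + d) ^+ 2 - r ^+ 2)^-1.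

Let kd0 : 0 < (r + d) ^+ 2 - r ^+ 2.
Proof. by have := r0; have := d0 => *; nra. Qed.

Let k0 : 0 < k. Proof. by rewrite invr_gt0. Qed.

Let kq : 1 <= k * ((r + d) ^+ 2 - r ^+ 2).
Proof. by rewrite mulVf// gt_eqF. Qed.

Let rd0 : 0 < r + d. Proof. by rewrite addr_gt0. Qed.

Let disj x : eball c1 (r + d) x -> ~ eball c2 (r + d) x.
Proof.
rewrite /eball/= => h1 h2; have := enormD (c1 - x) (x - c2).
rewrite subrKA (enorm_distC c1 x) => h.
have : enorm (c1 - c2) <= 2 * (r + d) by lra.
by rewrite leNgt dc.
Qed.

Let s1 := radial_cutoff c1 r k.
Let s2 := radial_cutoff c2 r k.

(** The components of the calibrating field for radius r + d, perturbed by
    e zeta v: d leaves room for cutting the field off smoothly between the radii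
    r and r + d. *)
Let f (i : 'I_n) x : R :=
  (r + d)^-1 * (s1 x * dotp (x - c1) (delta_mx 0 i) +
                s2 x * dotp (x - c2) (delta_mx 0 i)) + e * v 0 i * zeta x.

Let df (i : 'I_n) x : 'rV[R]_n :=
  (r + d)^-1 *: (s1 x *: delta_mx 0 i + dotp (x - c1) (delta_mx 0 i) *: radial_cutoff' c1 r k x +
   (s2 x *: delta_mx 0 i + dotp (x - c2) (delta_mx 0 i) *: radial_cutoff' c2 r k x)) +
  (e * v 0 i) *: gz x.

Let fdf i : has_grad (f i) (df i).
Proof.
apply: has_gradD; last exact: has_gradZ.
apply: has_gradZ; apply: has_gradD; apply: has_gradM.
- exact: radial_cutoff_grad.
- exact: (has_grad_shift (- c1) (@has_grad_dotp R n (delta_mx 0 i))).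
- exact: radial_cutoff_grad.
- exact: (has_grad_shift (- c2) (@has_grad_dotp R n (delta_mx 0 i))).
Qed.

Let phi x : 'rV[R]_n := \row_i f i x.

Let phiE x : phi x = (r + d)^-1 *: (s1 x *: (x - c1) + s2 x *: (x - c2)) +
  (e * zeta x) *: v.
Proof. by apply/rowP => i; rewrite !mxE /f !dotp_delta !mxE; ring. Qed.

Let s_out c x : ~ eball c (r + d) x -> radial_cutoff c r k x = 0.
Proof. exact: radial_cutoff_out k0 (ltW rd0) kq. Qed.

Let s_le1 c x : `|radial_cutoff c r k x| <= 1.
Proof. by rewrite ger0_norm ?step_ge0// step_le1. Qed.

Let rho_in x : eball c1 rho x -> eball c1 (r + d) x.
Proof. by rewrite /eball/= => h; apply: le_trans h _; rewrite (le_trans (ltW rhor))// lerDl ltW. Qed.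

(** Where zeta is not zero, the calibrating field has norm at most rho / r, and
    e is small enough for the perturbation to fit into the remaining gap. *)
Let phi_le1 x : enorm (phi x) <= 1.
Proof.
rewrite phiE.
have rdE (a : R) : 0 <= a -> (r + d)^-1 * a <= 1 <-> a <= r + d.
  by move=> a0; rewrite ler_pdivrMl// mulr1.
have one (c : 'rV[R]_n) : eball c (r + d) x ->
    enorm ((r + d)^-1 *: (radial_cutoff c r k x *: (x - c))) <= 1.
  move=> xc; rewrite !enormZ ger0_norm ?invr_ge0 ?(ltW rd0)//.
  rewrite ler_pdivrMl// mulr1; apply: le_trans xc.
  by rewrite ler_piMl ?enorm_ge0.
have [x1|x1] := pselect (eball c1 (r + d) x).
  rewrite /s2 s_out; last exact: disj.
  rewrite scale0r addr0; have [xr|xr] := pselect (eball c1 rho x); last first.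
    by rewrite z0// mulr0 scale0r addr0; exact: one.
  apply: le_trans (enormD _ _) _.
  have -> : 1 = rho / r + (1 - rho / r) by ring.
  apply: lerD.
    rewrite !enormZ ger0_norm ?invr_ge0 ?(ltW rd0)// mulrC.
    rewrite ler_pM ?invr_ge0 ?mulr_ge0 ?enorm_ge0 ?(ltW rd0)//.
      by apply: le_trans xr; rewrite ler_piMl ?enorm_ge0//; exact: s_le1.
    by rewrite lef_pV2 ?posrE// lerDl ltW.
  apply: le_trans ev; rewrite enormZ ler_wpM2r ?enorm_ge0// normrM.
  by rewrite ler_piMr.
rewrite /s1 s_out// scale0r add0r z0 ?mulr0 ?scale0r ?addr0; last by move=> /rho_in.
have [x2|x2] := pselect (eball c2 (r + d) x); first exact: one.
rewrite /s2 s_out// scale0r scaler0 enorm0//.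
Qed.

Let phi_test : test_field phi.
Proof.
split; [exact: (row_C1_field fdf)| |exact: phi_le1].
pose K := eball c1 (r + d) `|` eball c2 (r + d).
have cK : compact K by apply: compactU; exact: compact_eball.
have clK : closed K by apply: closedU; exact: eball_closed.
apply: (subclosed_compact _ cK); first exact: closed_closure.
rewrite [K](closure_id _).1//; apply: closure_subset => x /= phix.
apply: contrapT => /not_orP[x1 x2]; move/negP: phix; apply; apply/eqP.
rewrite phiE /s1 /s2 !s_out// !scale0r addr0 scaler0 z0 ?mulr0 ?scale0r ?addr0//.
by move=> /rho_in.
Qed.

Let phi_div x : eball c1 r x \/ eball c2 r x ->
  divergence phi x = n%:R / (r + d) + e * dotp (gz x) v.
Proof.
move=> xB; rewrite (row_divergence fdf).
have rrd c y : eball c r y -> eball c (r + d) y.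
  by rewrite /eball/= => h; apply: le_trans h _; rewrite lerDl ltW.
have dfE i : df i x = (r + d)^-1 *: delta_mx 0 i + (e * v 0 i) *: gz x.
  rewrite /df; congr (_ *: _ + _); case: xB => xB.
    rewrite /s1 /s2 radial_cutoff_in ?(ltW r0) ?(ltW k0)//.
    rewrite radial_cutoff'_in ?(ltW r0) ?(ltW k0)//.
    have x2 := disj (rrd _ _ xB).
    rewrite s_out// (radial_cutoff'_out k0 (ltW rd0) kq x2).
    by rewrite scale1r !scaler0 scale0r !addr0.
  have x1 : ~ eball c1 (r + d) x by move=> /disj; apply; exact: rrd.
  rewrite /s1 /s2 (s_out x1) (radial_cutoff'_out k0 (ltW rd0) kq x1).
  rewrite radial_cutoff_in ?(ltW r0) ?(ltW k0)//.
  rewrite radial_cutoff'_in ?(ltW r0) ?(ltW k0)//.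
  by rewrite scale1r !scaler0 scale0r !addr0 add0r.
under eq_bigr do rewrite dfE !mxE !eqxx mulr1.
rewrite big_split/= sumr_const card_ord -[_ *+ n]mulr_natl; congr (_ + _).
rewrite /dotp mulr_sumr; apply: eq_bigr => i _.
by rewrite -mulrA [v 0 i * _]mulrC.
Qed.

(** Testing the perimeter of E with the perturbed field, whose divergence on both
    balls is n / (r + d) plus the derivative of e zeta along v. *)
Lemma calibration_field_le :
  n%:R / (r + d) * fine (mu E) + e * (\int[mu]_(x in E) dotp (gz x) v)%R <=
  n%:R / r * fine (mu E).
Proof.
rewrite -lee_fin; apply: le_trans EP.
apply: (@le_trans _ _ (\int[mu]_(x in E) (divergence phi x)%:E)%E); last first.
  by apply: ereal_sup_ubound; exists phi.
have cdiv := divergence_continuous phi_test.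
pose g x := n%:R / (r + d) + e * dotp (gz x) v.
have -> : (\int[mu]_(x in E) (divergence phi x)%:E = \int[mu]_(x in E) (g x)%:E)%E.
  apply: (ae_eq_integral _ _ mE).
  - apply/measurable_EFinP; exact: measurable_continuous_on.
  - apply/measurable_EFinP; apply: measurable_continuous_on.
    apply: continuousD_rV; first exact: continuous_cst_rV.
    by apply: continuousM_rV; [exact: continuous_cst_rV|].
  - apply/aeP; apply: null_sub EB => x /=.
    rewrite not_implyE => -[Ex h]; split=> // xB; apply: h.
    by rewrite /g phi_div.
have [M gM] := continuous_supp_bounded cgzv gzv0.
have iz : mu.-integrable E (EFin \o (fun x => dotp (gz x) v)).
  apply: (bounded_integrable_rV (M := M) mE Eoo); last by move=> x _; exact: gM.
  exact: measurable_continuous_on.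
have ic (a : R) : mu.-integrable E (EFin \o (fun=> a)).
  apply: (bounded_integrable_rV (M := `|a|) mE Eoo); last by move=> x _.
  exact: measurable_cst.
have iez : mu.-integrable E (EFin \o (fun x => e * dotp (gz x) v)).
  apply: (bounded_integrable_rV (M := `|e| * M) mE Eoo).
    by apply: measurable_continuous_on; apply: continuousM_rV; [exact: continuous_cst_rV|].
  by move=> x _; rewrite normrM ler_wpM2l.
rewrite -(Rintegral_cst mu mE) -RintegralZl// -RintegralD//.
rewrite /Rintegral fineK//.
apply: (integrable_fin_num mE).
apply: (bounded_integrable_rV (M := `|n%:R / (r + d)| + `|e| * M) mE Eoo).
  apply: measurable_continuous_on; apply: continuousD_rV; first exact: continuous_cst_rV.
  by apply: continuousM_rV; [exact: continuous_cst_rV|].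
move=> x _; apply: le_trans (ler_normD _ _) _.
by rewrite lerD2l normrM ler_wpM2l.
Qed.

End field.

(** Letting d tend to 0 in [calibration_field_le] leaves e times the integral at
    most 0, for small e of either sign. *)
Lemma calibration_stationary : (\int[mu]_(x in E) dotp (gz x) v)%R = 0.
Proof.
set I := (\int[mu]_(x in E) _)%R.
have rr : 0 < 1 - rho / r by rewrite subr_gt0 ltr_pdivrMr// mul1r.
pose e0 := (1 - rho / r) / (1 + enorm v).
have v1 : 0 < 1 + enorm v by rewrite ltr_pwDl// enorm_ge0.
have e00 : 0 < e0 by rewrite divr_gt0.
have e0v : e0 * enorm v <= 1 - rho / r.
  rewrite /e0 mulrAC ler_pdivrMr// ler_wpM2l ?(ltW rr)//.
  by rewrite lerDr.
have mE0 : 0 <= fine (mu E) by rewrite fine_ge0 ?lebesgue_outer_ge0.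
have key e : `|e| * enorm v <= 1 - rho / r -> e * I <= 0.
  move=> ev; rewrite leNgt; apply/negP => eI.
  pose C := n%:R / r * fine (mu E).
  have C0 : 0 <= C by rewrite !mulr_ge0// invr_ge0 ltW.
  pose dm := (enorm (c1 - c2) - 2 * r) / 4.
  have dm0 : 0 < dm by rewrite divr_gt0// subr_gt0.
  (* With this d, replacing r by r + d changes the flux by at most e I / 2. *)
  pose d := Num.min dm (r * (e * I) / (2 * (C + 1))).
  have C1 : 0 < C + 1 by rewrite ltr_wpDl.
  have d0 : 0 < d by rewrite lt_min dm0/= divr_gt0 //; apply: mulr_gt0.
  have dc : 2 * (r + d) < enorm (c1 - c2).
    have : d <= dm by rewrite ge_min lexx.
    by rewrite /dm => ?; lra.
  have := calibration_field_le d0 dc ev; rewrite -/I.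
  have rd0 : 0 < r + d by rewrite addr_gt0.
  have -> : n%:R / (r + d) * fine (mu E) = C - C * (d / (r + d)).
    rewrite /C; field; apply/andP; split; rewrite gt_eqF//.
  rewrite -/C => h.
  have h1 : e * I <= C * (d / (r + d)) by lra.
  have h2 : C * (d / (r + d)) <= C * (d / r).
    by rewrite ler_wpM2l// ler_wpM2l ?(ltW d0)// lef_pV2 ?posrE// lerDl ltW.
  have h3 : C * (d / r) <= e * I / 2.
    have dle : d <= r * (e * I) / (2 * (C + 1)) by rewrite ge_min lexx orbT.
    apply: (@le_trans _ _ (C * (r * (e * I) / (2 * (C + 1)) / r))).
      by rewrite ler_wpM2l// ler_wpM2r// invr_ge0 ltW.
    have -> : C * (r * (e * I) / (2 * (C + 1)) / r) = (e * I / 2) * (C / (C + 1)).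
      by field; apply/andP; split; rewrite gt_eqF.
    by rewrite ler_piMr ?divr_ge0 ?(ltW eI)// ler_pdivrMr// mul1r lerDl.
  by move: eI h1 h2 h3; lra.
have ev1 : `|e0| * enorm v <= 1 - rho / r by rewrite gtr0_norm.
have ev2 : `|- e0| * enorm v <= 1 - rho / r by rewrite normrN.
have := key _ ev1; have := key _ ev2.
rewrite mulNr oppr_le0 pmulr_rge0// pmulr_rle0// => h1 h2.
by apply/eqP; rewrite eq_le h1 h2.
Qed.

End calibration.

(** * Sets that are stationary in a ball *)

Section spheres.
Context {R : realType} {n : nat} (n0 : (0 < n)%N).

(** A sphere is no larger than the concentric spheres of bigger radius, of which
    infinitely many lie in a bounded set. *)
Lemma null_sphere (c : 'rV[R]_n) (r : R) : 0 < r ->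
  null [set x | enorm (x - c) = r].
Proof.
move=> r0; apply: (@null_translate _ _ (- c) [set x | enorm x = r]) => //.
pose s (k : nat) : R := 1 + k.+1%:R^-1.
have s1 k : 1 <= s k by rewrite lerDl invr_ge0.
have s2 k : s k <= 2 by rewrite -[2]/(1 + 1) lerD2l invf_le1 ?ltr0n// ler1n.
pose S (t : R) : set (Rn R n) := [set x : 'rV[R]_n | enorm x = r * t].
have mS t : measurable (S t).
  apply: closed_measurable_rV.
  rewrite (_ : S t = (fun x => enorm (x - 0)) @^-1` [set r * t]); last first.
    by apply/seteqP; split=> x; rewrite /S /= subr0.
  by apply: closed_comp => [x _|]; [exact: enorm_continuous|exact: closed_eq].
apply: (@null_of_disjoint_copies R n _ (eball 0 (r * 2)) (fun k => S (s k))).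
- exact: measurable_eball.
- exact: lebesgue_outer_eball_lty.
- by move=> k; exact: mS.
- apply/trivIsetP => i j _ _ ij; apply/seteqP; split=> // x [] /=.
  rewrite /S/= => -> /(mulfI (lt0r_neq0 r0)) /addrI /invr_inj/eqP.
  by rewrite eqr_nat eqSS (negbTE ij).
- by move=> k x; rewrite /S /eball/= subr0 => ->; rewrite ler_pM2l.
- move=> k; apply: le_trans (@lebesgue_outer_shrink_le R n n0 (s k) (S (s k)) (s1 k)).
  apply: le_lebesgue_outer => x; rewrite /S/= => xr.
  by rewrite enormZ xr ger0_norm ?(le_trans _ (s1 k))// mulrC.
Qed.

End spheres.

Section box_cutoff.
Context {R : realType} {n : nat}.
Implicit Types (x a b v : 'rV[R]_n).

(** A smooth approximation of the indicator of the half-open box: the step from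
    0 to 1 starts at a, and the step from 1 to 0 starts at b. *)
Definition box_cutoff (k : R) a b x : R :=
  \prod_i ((1 - step (k * (x 0 i - a 0 i))) * step (k * (x 0 i - b 0 i))).

Lemma box_cutoff_grad k a b : exists g, has_grad (box_cutoff k a b) g.
Proof.
have h (c : R) (i : 'I_n) : has_grad (fun x : 'rV[R]_n => step (k * (x 0 i - c)))
    (fun x => step' (k * (dotp x (delta_mx 0 i) - c)) *: (k *: (delta_mx 0 i + 0))).
  have h1 := has_gradZ k (has_gradD (@has_grad_dotp R n (delta_mx 0 i)) (has_grad_cst (- c))).
  have := has_grad_comp (@is_derive_step R) (@continuous_step' R) h1.
  by under eq_fun do rewrite dotp_delta.
apply: has_grad_prod => i; apply: has_gradM; last exact: h.
have := has_gradD (has_grad_cst 1) (has_gradZ (-1) (h (a 0 i) i)).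
by under eq_fun do rewrite mulN1r; move=> h2; exact: h2.
Qed.

Lemma box_cutoff_bounds k a b x : 0 <= box_cutoff k a b x <= 1.
Proof.
have h (y : R) : 0 <= 1 - step y <= 1.
  by rewrite subr_ge0 step_le1 lerBlDr lerDl step_ge0.
apply: (big_ind (fun y : R => 0 <= y <= 1)) => [|y z|i _]; first by rewrite ler01 lexx.
  by move=> /andP[y0 y1] /andP[z0 z1]; rewrite mulr_ge0//= mulr_ile1.
have /andP[h1 h2] := h (k * (x 0 i - a 0 i)).
by rewrite mulr_ge0 ?step_ge0//= mulr_ile1 ?step_ge0 ?step_le1.
Qed.

Lemma box_cutoff_supp k a b x : 0 < k -> box_cutoff k a b x != 0 ->
  forall i, a 0 i <= x 0 i <= b 0 i + k^-1.
Proof.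
move=> k0 /prodf_neq0 h i; have := h i isT; rewrite mulf_eq0 negb_or => /andP[h1 h2].
apply/andP; split; rewrite leNgt; apply/negP => h3.
  by move: h1; rewrite step_le0 ?subrr ?eqxx// pmulr_rle0// subr_le0 ltW.
move: h2; rewrite step_ge1 ?eqxx// -ler_pdivrMl// mulr1.
by rewrite lerBrDr addrC ltW.
Qed.

Lemma box_cutoff_cvg a b x :
  box_cutoff k.+1%:R a b x @[k --> \oo] --> (\1_(hbox a b) x : R).
Proof.
have ev (y : R) : 0 < y -> \forall k \near \oo, step (k.+1%:R * y) = 0.
  move=> y0; have [N _ hN] := nbhs_infty_gtr (y^-1).
  exists N => // k /= Nk; rewrite step_ge1// -ler_pdivrMr// mul1r ltW//.
  by apply: hN => /=; rewrite ltnW.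
have [xab|xab] := pselect (hbox a b x); last first.
  rewrite indicE memNset//; apply: cvg_near_cst.
  have /existsNP[i /negP] := xab; rewrite negb_and -leNgt -ltNge => /orP[xi|xi].
    apply: nearW => k; rewrite /box_cutoff (bigD1 i)//= step_le0 ?subrr ?mul0r//.
    by rewrite pmulr_rle0 ?subr_le0.
  have := ev (x 0 i - b 0 i); rewrite subr_gt0 => /(_ xi).
  apply: filterS => k hk; rewrite /box_cutoff (bigD1 i)//= hk mulr0 mul0r//.
rewrite indicE mem_set//; apply: cvg_near_cst.
have h (i : 'I_n) : \forall k \near \oo, step (k.+1%:R * (x 0 i - a 0 i)) = 0.
  by apply: ev; rewrite subr_gt0; have /andP[] := xab i.
have := filter_forall (eventually_filter) h; apply: filterS => k hk.
rewrite /box_cutoff big1// => i _; rewrite hk subr0 mul1r step_le0//.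
by rewrite pmulr_rle0 ?subr_le0//; have /andP[] := xab i.
Qed.

End box_cutoff.

Section dichotomy.
Context {R : realType} {n : nat} (n0 : (0 < n)%N).
Local Notation mu := (@lebesgue_n R n).
Implicit Types (x y a b p q v : 'rV[R]_n).

Variables (c1 c2 : 'rV[R]_n) (r : R) (E : set (Rn R n)).
Hypothesis (r0 : 0 < r) (c12 : 2 * r < enorm (c1 - c2)).
Hypothesis (mE : measurable E) (Eoo : (mu E < +oo)%E).
Hypothesis EB : sub_ae E (eball c1 r `|` eball c2 r).
Hypothesis EP : (perimeter E <= (n%:R / r * fine (mu E))%:E)%E.

Let eball_convex c (t s : R) x y : 0 <= t -> t <= 1 -> eball c s x ->
  eball c s y -> eball c s (x + t *: (y - x)).
Proof.
rewrite /eball/= => t0 t1 xc yc.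
have -> : x + t *: (y - x) - c = (1 - t) *: (x - c) + t *: (y - c).
  by apply/rowP => i; rewrite !mxE; ring.
apply: le_trans (enormD _ _) _; rewrite !enormZ !ger0_norm ?subr_ge0//.
have : (1 - t) * enorm (x - c) <= (1 - t) * s by rewrite ler_wpM2l// subr_ge0.
have : t * enorm (y - c) <= t * s by rewrite ler_wpM2l.
by move=> *; lra.
Qed.

Section translation_of_boxes.
Variables (rho : R) (a b v : 'rV[R]_n).
Hypothesis (rho0 : 0 <= rho) (rhor : rho < r).
Hypothesis ab : forall i, a 0 i <= b 0 i.
Hypothesis (box1 : box (a, b) `<=` eball c1 rho)
  (box2 : forall x, box (a, b) x -> eball c1 rho (x + v)).

Let rho' : R := (rho + r) / 2.

(** The support of the cutoff exceeds the box by at most 1 / k in each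
    coordinate; by convexity the box stays in the ball while it moves to its
    final position. *)
Let cutoff_moved_supp (k t : R) x : 0 < k -> n%:R * k^-1 <= rho' - rho ->
  0 <= t -> t <= 1 -> box_cutoff k a b (x + t *: (- v)) != 0 ->
  eball c1 rho' x.
Proof.
move=> k0 kn t0 t1 /(box_cutoff_supp k0) h.
pose z : 'rV[R]_n := \row_i minr ((x + t *: (- v)) 0 i) (b 0 i).
have zab : box (a, b) z.
  move=> i /=; have /andP[h1 h2] := h i.
  by rewrite !mxE le_min ge_min lexx orbT ab andbT /=; move: h1; rewrite !mxE => ->.
have zc : eball c1 rho (z + t *: v).
  have := eball_convex t0 t1 (box1 zab) (box2 zab).
  by rewrite [z + v]addrC addrK.
have wle : enorm (x - (z + t *: v)) <= n%:R * k^-1.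
  apply: enorm_le_sup => i; have /andP[h1 h2] := h i.
  move: h1 h2; rewrite /z !mxE => h1 h2.
  have ki : 0 <= k^-1 by rewrite invr_ge0 ltW.
  by rewrite ler_norml; have [h3|h3] := leP (x 0 i + t * - v 0 i) (b 0 i);
    apply/andP; split; lra.
rewrite /eball/= -(subrKA (z + t *: v)); apply: le_trans (enormD _ _) _.
by have := lerD wle zc; lra.
Qed.

Let box_cutoff_moved (k : R) : 0 < k -> n%:R * k^-1 <= rho' - rho ->
  (\int[mu]_(x in E) box_cutoff k a b ((x : 'rV[R]_n) + - v))%R =
  (\int[mu]_(x in E) box_cutoff k a b x)%R.
Proof.
move=> k0 kn; have [g hg] := box_cutoff_grad k a b.
have [cz cg dz] := hg.
have [rr' r'r] : rho < rho' /\ rho' < r by have [] := midf_lt rhor.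
have r'0 : 0 <= rho' by rewrite (le_trans rho0)// ltW.
have z1 x : `|box_cutoff k a b x| <= 1.
  by have /andP[h0 h1] := box_cutoff_bounds k a b x; rewrite ger0_norm.
have cgv : continuous (fun x => dotp (g x) (- v)).
  by apply: continuous_sum_rV => i; apply: continuousM_rV; [exact: cg|exact: continuous_cst_rV].
have z0 t : 0 <= t -> t <= 1 ->
    forall x, ~ eball c1 rho' x -> box_cutoff k a b (x + t *: (- v)) = 0.
  move=> t0 t1 x xc; apply/eqP; apply/negPn/negP => h.
  exact/xc/(cutoff_moved_supp k0 kn t0 t1).
have gz0 : forall x, ~ eball c1 rho' x -> dotp (g x) (- v) = 0.
  apply: (is_derive_outside_supp (fun x => dz x (- v))) => x /(z0 0 (lexx _) ler01).
  by rewrite scale0r addr0.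
have [M gM] := continuous_supp_bounded cgv gz0.
pose M' := maxr M 1.
apply: (@integral_translate_invariant _ _ _ (fun x => dotp (g x) (- v)) (- v) M') => //.
- by move=> x; rewrite le_max z1 orbT.
- by move=> x; rewrite le_max gM.
move=> t t0 t1.
exact: (calibration_stationary r0 c12 mE Eoo EB EP (- v)
  (has_grad_shift (t *: - v) hg) r'r (fun x => z1 _) (z0 t t0 t1)).
Qed.

Let Rint_indic (A : set (Rn R n)) : measurable A ->
  (\int[mu]_(x in E) (\1_A x : R))%R = fine (mu (E `&` A)).
Proof. by move=> mA; rewrite /Rintegral integral_indic// setIC. Qed.

Lemma measurable_hbox p q : measurable (hbox p q : set (Rn R n)).
Proof.
rewrite (_ : hbox p q = \bigcap_(i in [set: 'I_n])
   ((fun x : 'rV[R]_n => x 0 i) @^-1` `]p 0 i, q 0 i])); last first.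
  apply/seteqP; split=> x /= h i; first by move=> _; rewrite /= in_itv/= h.
  by have := h i I; rewrite /= in_itv.
apply: fin_bigcap_measurable => // i _.
by rewrite -[X in measurable X]setTI; exact: measurable_coord.
Qed.

(** Smooth cutoffs of the box can be moved without changing their integral over
    E, by [calibration_stationary]; the cutoffs tend to the indicator. *)
Lemma hbox_density_translate :
  mu (E `&` hbox (a + v) (b + v)) = mu (E `&` hbox a b).
Proof.
have fin (A : set (Rn R n)) : mu (E `&` A) \is a fin_num.
  rewrite ge0_fin_numE ?lebesgue_outer_ge0//; apply: le_lt_trans Eoo.
  by apply: le_lebesgue_outer; exact: subIsetl.
rewrite -(fineK (fin _)) -[RHS](fineK (fin _)); congr EFin.
have mz k w : measurable_fun E (fun x : Rn R n => box_cutoff k a b ((x : 'rV[R]_n) + w)).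
  apply: measurable_continuous_on; apply: continuous_shift.
  by have [g []] := box_cutoff_grad k a b.
have lim (w : 'rV[R]_n) : (\int[mu]_(x in E) box_cutoff k.+1%:R a b ((x : 'rV[R]_n) + w))%R @[k --> \oo] -->
    fine (mu (E `&` hbox (a - w) (b - w))).
  rewrite -Rint_indic; last exact: measurable_hbox.
  apply: (@Rintegral_bounded_cvg _ _ E _ _ 1) => //.
    move=> k x _; have /andP[h0 h1] := box_cutoff_bounds k.+1%:R a b ((x : 'rV[R]_n) + w).
    by rewrite ger0_norm.
  move=> x _; rewrite (_ : \1_(hbox (a - w) (b - w)) x = \1_(hbox a b) ((x : 'rV[R]_n) + w)).
    exact: box_cutoff_cvg.
  have xE : hbox (a - w) (b - w) x <-> hbox a b ((x : 'rV[R]_n) + w).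
    by split=> h i; have := h i; rewrite !mxE ltrBlDr lerBrDr.
  have [h|h] := pselect (hbox a b ((x : 'rV[R]_n) + w)).
    by rewrite !indicE !mem_set//; exact/xE.
  by rewrite !indicE !memNset// => /xE.
have lim0 := lim 0; have limv := lim (- v).
rewrite !opprK in limv; rewrite !subr0 in lim0.
apply: (cvg_unique _ limv); first exact: Rhausdorff.
have r'r : 0 < rho' - rho by rewrite subr_gt0; have [] := midf_lt rhor.
have [N _ hN] := nbhs_infty_gtr (n%:R / (rho' - rho)).
apply: cvg_trans lim0; apply: near_eq_cvg; exists N => // k /= Nk.
have -> : (\int[mu]_(x in E) box_cutoff k.+1%:R a b ((x : 'rV[R]_n) + 0))%R =
    (\int[mu]_(x in E) box_cutoff k.+1%:R a b x)%R.
  by apply: eq_Rintegral => x _; rewrite addr0.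
apply/esym/box_cutoff_moved; first by rewrite ltr0n.
rewrite ler_pdivrMr// mulrC -ler_pdivrMr// ltW//.
by apply: hN => /=; rewrite ltnW.
Qed.

End translation_of_boxes.

(** Volume fraction of E in a box, which turns out to be the same for all boxes
    in the interior of the ball. *)
Let density p q : R := fine (mu (E `&` hbox p q)) / \prod_i (q 0 i - p 0 i).

Let inner p q := (forall i, p 0 i < q 0 i) /\
  exists rho : R, [/\ 0 <= rho, rho < r & box (p, q) `<=` eball c1 rho].

Let Efin (A : set (Rn R n)) : mu (E `&` A) \is a fin_num.
Proof.
rewrite ge0_fin_numE ?lebesgue_outer_ge0//; apply: le_lt_trans Eoo.
by apply: le_lebesgue_outer; exact: subIsetl.
Qed.

Let vol_gt0 p q : (forall i, p 0 i < q 0 i) -> 0 < \prod_i (q 0 i - p 0 i).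
Proof. by move=> pq; apply: prodr_gt0 => i _; rewrite subr_gt0. Qed.

Let subbox_sub p q a b : subbox p q a b -> box (a, b) `<=` box (p, q).
Proof.
move=> s x h i; have /andP[h1 h2] := h i; have [s1 s2 s3] := s i => /=.
by rewrite (le_trans s1 h1) (le_trans h2 s3).
Qed.

Let inner_translate p q : inner p q ->
  forall a b v, subbox p q a b -> subbox p q (a + v) (b + v) ->
  mu (E `&` id @^-1` hbox (a + v) (b + v)) = mu (E `&` id @^-1` hbox a b).
Proof.
move=> [pq [rho [rho0 rhor pqr]]] a b v s1 s2.
apply: (hbox_density_translate rho0 rhor).
- by move=> i; have [] := s1 i.
- by apply: subset_trans pqr; exact: subbox_sub.
- move=> x h; apply: pqr; apply: (subbox_sub s2) => i; have := h i.
  by rewrite !mxE !lerD2r.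
Qed.

Let inner_fin p q : (mu (E `&` id @^-1` hbox p q) < +oo)%E.
Proof. by have := Efin (hbox p q); rewrite ge0_fin_numE ?lebesgue_outer_ge0. Qed.

Let mid i : measurable_fun [set: Rn R n] (fun x : Rn R n => (id x : 'rV[R]_n) 0 i).
Proof. exact: measurable_coord. Qed.

Let density_subbox p q a b : inner p q -> subbox p q a b ->
  (forall i, a 0 i < b 0 i) -> density a b = density p q.
Proof.
move=> ipq s ab_; have [pq _] := ipq.
have := content_subbox mid (inner_fin p q) (inner_translate ipq) s.
rewrite /density => h; apply/eqP.
by rewrite eqr_div ?lt0r_neq0 ?vol_gt0//; apply/eqP.
Qed.

(** Both boxes contain translates of a common smaller box. *)
Let density_const p q p' q' : inner p q -> inner p' q' ->
  density p q = density p' q'.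
Proof.
move=> i1 i2; have [pq [rho [rho0 rhor pqr]]] := i1.
have [pq' [rho' [rho0' rhor' pqr']]] := i2.
pose d : 'rV[R]_n := \row_i minr (q 0 i - p 0 i) (q' 0 i - p' 0 i).
have d0 i : 0 < d 0 i by rewrite mxE lt_min !subr_gt0 pq pq'.
have s1 : subbox p q p (p + d).
  move=> i; split=> //; rewrite mxE; first by rewrite lerDl ltW.
  by rewrite -lerBrDl mxE ge_min lexx.
have s2 : subbox p' q' p' (p' + d).
  move=> i; split=> //; rewrite mxE; first by rewrite lerDl ltW.
  by rewrite -lerBrDl mxE ge_min lexx orbT.
rewrite -(density_subbox i1 s1); last by move=> i; rewrite mxE ltrDl.
rewrite -(density_subbox i2 s2); last by move=> i; rewrite mxE ltrDl.
have eb (s t : R) : s <= t -> eball c1 s `<=` eball c1 t.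
  by move=> st x; rewrite /eball/= => /le_trans; apply.
have h : mu (E `&` hbox (p + (p' - p)) (p + d + (p' - p))) = mu (E `&` hbox p (p + d)).
  apply: (@hbox_density_translate (maxr rho rho')).
  - by rewrite le_max rho0.
  - by rewrite gt_max rhor.
  - by move=> i; rewrite mxE lerDl ltW.
  - apply: subset_trans (subset_trans pqr _); first exact: subbox_sub.
    by apply: eb; rewrite le_max lexx.
  - move=> x hx; apply: (eb rho'); first by rewrite le_max lexx orbT.
    apply: pqr'; apply: (subbox_sub s2) => i; have := hx i.
    by rewrite !mxE/= => /andP[h1 h2]; apply/andP; split; lra.
rewrite /density -h; have -> : p + (p' - p) = p' by rewrite subrKC.
have -> : p + d + (p' - p) = p' + d by rewrite addrAC subrKC.
by congr (_ / _); apply: eq_bigr => i _; rewrite !mxE; ring.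
Qed.

(** The part of E in the box has content equal to its own measure, and content
    at most density times that measure. *)
Let null_of_density_lt1 p q : inner p q -> density p q < 1 ->
  null (E `&` hbox p q).
Proof.
move=> ipq d1; have [pq _] := ipq.
have := content_le n0 mid pq (inner_fin p q) (inner_translate ipq)
  (@subIsetr _ E (hbox p q)).
rewrite preimage_id setIA setIid -/(density p q) => h.
rewrite /null -[LHS](fineK (Efin (hbox p q))); congr EFin.
have h0 : 0 <= fine (mu (E `&` hbox p q)) by rewrite fine_ge0 ?lebesgue_outer_ge0.
have {}h : (mu (E `&` hbox p q) <= (density p q)%:E * mu (E `&` hbox p q))%E by [].
move: h; rewrite -(fineK (Efin _)) -EFinM lee_fin => h.
by apply/eqP; rewrite eq_le h0 andbT; move: h h0 d1; nra.
Qed.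

Let full_of_density_ge1 p q : inner p q -> 1 <= density p q ->
  null (hbox p q `\` E).
Proof.
move=> [pq _] d1; set V := hbox p q.
have Vle : (mu V <= (\prod_i (q 0 i - p 0 i))%:E)%E.
  by apply: le_outer_hbox => i; exact: ltW.
have EVge : ((\prod_i (q 0 i - p 0 i))%:E <= mu (E `&` V))%E.
  rewrite -(fineK (Efin _)) lee_fin; move: d1.
  by rewrite /density ler_pdivlMr ?vol_gt0// mul1r.
have Voo : (lebesgue_outer V < +oo)%E by apply: le_lt_trans Vle (ltry _).
apply: null_sub (_ : sub_ae V (E `&` V)); first by move=> x [Vx nE]; split=> // -[].
apply: sub_ae_rev => //; last by apply: sub_ae_sub; exact: subIsetr.
  by apply: measurableI => //; exact: measurable_hbox.
exact: le_trans EVge.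
Qed.

Let U : set 'rV[R]_n := [set x | enorm (x - c1) < r].

(** Half the side of a cube around x whose points stay away from the sphere:
    the factor n + 1 pays for comparing the maximum with the Euclidean norm. *)
Let delta x : R := (r - enorm (x - c1)) / (2 * n.+1%:R).

Let cell x : set 'rV[R]_n := hbox (x - const_mx (delta x)) (x + const_mx (delta x)).

Let delta_gt0 x : U x -> 0 < delta x.
Proof. by move=> xU; rewrite divr_gt0// subr_gt0. Qed.

Let cell_nbhs x : U x -> nbhs x (cell x).
Proof.
move=> xU; apply/nbhs_ballP; exists (delta x) => /=; first exact: delta_gt0.
move=> y; rewrite rV_ballE ?delta_gt0//= => h i; have := h i.
by rewrite !mxE ltr_norml => /andP[h1 h2]; apply/andP; split; lra.
Qed.

Let cell_inner x : U x -> inner (x - const_mx (delta x)) (x + const_mx (delta x)).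
Proof.
move=> xU; have d0 := delta_gt0 xU; split; first by move=> i; rewrite !mxE; lra.
exists ((enorm (x - c1) + r) / 2); have [h1 h2] := midf_lt xU.
split=> //; first by rewrite divr_ge0// addr_ge0 ?enorm_ge0// ltW.
move=> y h; rewrite /eball/= -(subrKA x); apply: le_trans (enormD _ _) _.
have yx : enorm (y - x) <= n%:R * delta x.
  apply: enorm_le_sup => i; have /andP[] := h i; rewrite !mxE ler_norml => h3 h4.
  by apply/andP; split; lra.
have nd : n%:R * delta x <= (r - enorm (x - c1)) / 2.
  have -> : n%:R * delta x = (r - enorm (x - c1)) / 2 * (n%:R / n.+1%:R).
    by rewrite /delta -natr1; field; rewrite ?natr1 ?nat1r pnatr_eq0.
  rewrite ler_piMr//; first by rewrite divr_ge0// subr_ge0 ltW.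
  by rewrite ler_pdivrMr// mul1r ler_nat.
by lra.
Qed.

(** In the open ball the density of E is the same constant in all small boxes;
    if it is less than 1, the boxes covering E show that E is null there. *)
Lemma ball_dichotomy : null (E `&` eball c1 r) \/ null (eball c1 r `\` E).
Proof.
have Uc1 : U c1 by rewrite /U/= subrr enorm0.
have [s [Us Ucov]] := rV_lindelof cell_nbhs (ex_intro _ _ Uc1).
have BU : eball c1 r `<=` U `|` [set x | enorm (x - c1) = r].
  by move=> x; rewrite /eball/= le_eqVlt => /orP[/eqP|]; [right|left].
have sphere := null_sphere n0 c1 r0.
have ic k := cell_inner (Us k).
have [d1|d1] := ltP (density (c1 - const_mx (delta c1)) (c1 + const_mx (delta c1))) 1.
  left; apply: null_sub (nullU (null_bigcup (F := fun k => E `&` cell (s k)) _) sphere).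
    by move=> x [Ex /BU[/Ucov[k _ cx]|]]; [left; exists k|right].
  by move=> k; apply: null_of_density_lt1 => //; rewrite (density_const _ (cell_inner Uc1)).
right; apply: null_sub (nullU (null_bigcup (F := fun k => cell (s k) `\` E) _) sphere).
  by move=> x [/BU[/Ucov[k _ cx]|] nE]; [left; exists k|right].
by move=> k; apply: full_of_density_ge1 => //; rewrite (density_const _ (cell_inner Uc1)).
Qed.

End dichotomy.

(** * Monotonic measure preserving maps of sets *)

Section hull.
Context {R : realType} {n : nat} (n0 : (0 < n)%N).
Local Notation mu := (@lebesgue_outer R n).

Definition Lset (A : set 'rV[R]_n) :=
  measurable (A : set (Rn R n)) /\ (mu A < +oo)%E.

(** Outer regularity with the tolerances 1 / (k + 1). *)
Lemma open_hull A : Lset A -> exists G : nat -> set 'rV[R]_n,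
  [/\ forall k, open (G k), forall k, A `<=` G k, forall k, (mu (G k) < +oo)%E &
    sub_ae (\bigcap_k G k) A].
Proof.
move=> [mA Aoo]; have Afin : mu A \is a fin_num.
  by rewrite ge0_fin_numE ?lebesgue_outer_ge0.
have h k : {O : set 'rV[R]_n | [/\ open O, A `<=` O &
    (mu O <= mu A + (k.+1%:R^-1)%:E)%E]}.
  by apply: cid; apply: open_outer_approx => //; rewrite invr_gt0.
exists (fun k => sval (h k)); split=> [k|k|k|].
- by case: (h k) => G [].
- by case: (h k) => G [].
- case: (h k) => G [_ _ /= Ole]; apply: le_lt_trans Ole _.
  by rewrite -(fineK Afin) -EFinD ltry.
have Ale k : (mu (\bigcap_k sval (h k)) <= mu A + (k.+1%:R^-1)%:E)%E.
  apply: le_trans (le_lebesgue_outer (bigcap_inf (_ : setT k))) _ => //.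
  by case: (h k) => G [].
apply: sub_ae_rev => //.
- apply: le_lt_trans (Ale 0%N) _.
  by rewrite -(fineK Afin) -EFinD ltry.
- apply/lee_addgt0Pr => e e0.
  have [k _ /(_ _ (leqnn k)) ke] := near_infty_natSinv_lt (PosNum e0).
  by apply: le_trans (Ale k) _; rewrite leeD2l// lee_fin ltW.
- by apply: sub_ae_sub => x Ax k _; case: (h k) => G [_ + _] /=; apply.
Qed.

End hull.

Section set_maps.
Context {R : realType} {n : nat} (n0 : (0 < n)%N).
Local Notation mu := (@lebesgue_outer R n).
Implicit Types (A B O : set 'rV[R]_n) (c x u : 'rV[R]_n).

Variable D : set 'rV[R]_n -> set 'rV[R]_n.
Hypothesis DL : forall A, Lset A -> Lset (D A).
Hypothesis Dmu : forall A, Lset A -> mu (D A) = mu A.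
Hypothesis Dmono : forall A B, Lset A -> Lset B -> sub_ae A B ->
  sub_ae (D A) (D B).

Lemma D_rev A B : Lset A -> measurable (B : set (Rn R n)) ->
  (mu A <= mu B)%E -> sub_ae B (D A) -> sub_ae (D A) B.
Proof.
by move=> LA mB AB; apply: sub_ae_rev => //; rewrite ?Dmu//; case: LA.
Qed.

Lemma D_rev' A B : Lset A -> Lset B -> (mu B <= mu A)%E ->
  sub_ae (D A) B -> sub_ae B (D A).
Proof.
move=> LA [_ Boo] BA; apply: sub_ae_rev => //; rewrite ?Dmu//.
by have [] := DL LA.
Qed.

Lemma Lset_open O : open O -> (mu O < +oo)%E -> Lset O.
Proof. by move=> oO Ooo; split => //; exact: open_measurable_rV. Qed.

Lemma Lset_eball c r : Lset (eball c r).
Proof. by split; [exact: measurable_eball|exact: lebesgue_outer_eball_lty]. Qed.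

Lemma Lset_sub A B : measurable (A : set (Rn R n)) -> Lset B -> A `<=` B -> Lset A.
Proof.
by move=> mA [_ Boo] AB; split => //; apply: le_lt_trans Boo; exact: le_lebesgue_outer.
Qed.

Lemma LsetU A B : Lset A -> Lset B -> Lset (A `|` B).
Proof.
move=> [mA Aoo] [mB Boo]; split; first exact: measurableU.
by apply: le_lt_trans (outer_measureU2 _ _ _) _; rewrite lte_add_pinfty.
Qed.

Section regular_extension.
(** The identity and the reflections are the instances of e. *)
Variables (e : 'rV[R]_n -> 'rV[R]_n).
Hypothesis eK : involutive e.
Hypothesis e_mu : forall A, mu (e @^-1` A) = mu A.
Hypothesis e_meas : forall A, measurable (A : set (Rn R n)) ->
  measurable (e @^-1` A : set (Rn R n)).
Variable W : set 'rV[R]_n.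
Hypothesis oW : open W.
Hypothesis ballW : forall c r, 0 < r -> eball c r `<=` W ->
  sub_ae (e @^-1` eball c r) (D (eball c r)).

Let sub_ae_e A B : sub_ae A B -> sub_ae (e @^-1` A) (e @^-1` B).
Proof.
move=> AB; rewrite /sub_ae /null.
have -> : e @^-1` A `\` e @^-1` B = e @^-1` (A `\` B) by [].
by rewrite e_mu.
Qed.

Let eeK A : e @^-1` (e @^-1` A) = A.
Proof. by apply/seteqP; split=> x /=; rewrite eK. Qed.

Lemma open_of_balls O : open O -> (mu O < +oo)%E -> O `<=` W ->
  sub_ae (e @^-1` O) (D O).
Proof.
move=> oO Ooo OW; have LO := Lset_open oO Ooo.
rewrite -(eeK (D O)); apply: sub_ae_e; apply: open_sub_ae => // c r r0 cO.
rewrite -(eeK (eball c r)); apply: sub_ae_e.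
apply: sub_ae_trans (ballW r0 (subset_trans cO OW)) _.
by apply: Dmono => //; [exact: Lset_eball|exact: sub_ae_sub].
Qed.

(** Outer regularity transfers the inclusion from open sets to all sets. *)
Lemma sets_of_balls A : Lset A -> A `<=` W -> sub_ae (e @^-1` A) (D A).
Proof.
move=> LA AW; have [G [oO AO Ooo OA]] := open_hull n0 LA.
apply: D_rev' => //; first by case: LA => mA Aoo; split; [exact: e_meas|rewrite e_mu].
  by rewrite e_mu.
apply: sub_ae_trans (sub_ae_e OA).
rewrite preimage_bigcap; apply: sub_ae_bigcap => k.
have oOW : open (G k `&` W) by exact: openI.
have OWoo : (mu (G k `&` W) < +oo)%E.
  by apply: le_lt_trans (Ooo k); apply: le_lebesgue_outer; exact: subIsetl.
have LOW := Lset_open oOW OWoo.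
apply: (@sub_ae_trans _ _ _ (D (G k `&` W))).
  by apply: Dmono => //; apply: sub_ae_sub => x Ax; split; [exact: AO|exact: AW].
apply: (@sub_ae_trans _ _ _ (e @^-1` (G k `&` W))); last first.
  by apply: sub_ae_sub => x [].
apply: D_rev => //; [by apply: e_meas; case: LOW|by rewrite e_mu|].
by apply: open_of_balls => // x [].
Qed.

End regular_extension.

Section with_reflection.
Variables (u : 'rV[R]_n) (hu : enorm u = 1).
Hypothesis Dsym : forall c r, 0 < r -> r < `|dotp c u| ->
  sub_ae (eball c r `|` refl u @^-1` eball c r)
         (D (eball c r `|` refl u @^-1` eball c r)).
Hypothesis Dper : forall c r, 0 < r ->
  perimeter (D (eball c r)) = perimeter (eball c r).

Let rK A : refl u @^-1` (refl u @^-1` A) = A.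
Proof. by apply/seteqP; split=> x /=; rewrite reflK. Qed.

Lemma Lset_refl A : Lset A -> Lset (refl u @^-1` A).
Proof.
by move=> [mA Aoo]; split; [exact: measurable_refl|rewrite lebesgue_outer_refl].
Qed.

Lemma eball_off_hyperplane c r : 0 <= r ->
  eball c r `<=` [set x | dotp x u != 0] -> r < `|dotp c u|.
Proof.
move=> r0 h; rewrite ltNge; apply/negP => cr.
have : eball c r (c - dotp c u *: u).
  by rewrite /eball/= addrC addrA addNr add0r enormN enormZ hu mulr1.
by move/h; rewrite /= dotpBl dotpZl dotpuu// mulr1 subrr eqxx.
Qed.

Let open_off : open [set x : 'rV[R]_n | dotp x u != 0].
Proof.
rewrite (_ : mkset _ = (dotp^~ u) @^-1` [set t | t != 0])//.
by apply: open_comp => [x _|]; [exact: dotp_continuous|exact: open_neq].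
Qed.

(** Off the hyperplane, the balls in O and their reflections form the disjoint
    symmetric unions which are known to be fixed. *)
Let open_sym O : open O -> (mu O < +oo)%E -> refl u @^-1` O = O ->
  sub_ae O (D O).
Proof.
move=> oO Ooo symO; have LO := Lset_open oO Ooo.
apply: (@sub_ae_trans _ _ _ (O `&` [set x | dotp x u != 0])).
  apply: null_sub (null_hyperplane n0 hu) => x [Ox h] /=.
  by apply: contrapT => /eqP xu; apply: h.
apply: open_sub_ae; first exact: openI.
move=> c r r0 cO; pose B := eball c r.
have cr : r < `|dotp c u|.
  by apply: eball_off_hyperplane; [exact: ltW|move=> x /cO[]].
apply: (@sub_ae_trans _ _ _ (B `|` refl u @^-1` B)); first by apply: sub_ae_sub; left.
apply: sub_ae_trans (Dsym r0 cr) _; apply: Dmono => //.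
  by apply: LsetU; [|apply: Lset_refl]; exact: Lset_eball.
by apply: sub_ae_sub => x [/cO[]|/cO[]] //; rewrite -[in X in _ -> _ -> X]symO.
Qed.

(** Every open hull of A can be made symmetric by intersecting it with its
    reflection, and symmetric open sets are fixed. *)
Lemma D_symmetric A : Lset A -> refl u @^-1` A = A ->
  sub_ae A (D A) /\ sub_ae (D A) A.
Proof.
move=> LA symA; suff h : sub_ae (D A) A by split => //; exact: D_rev'.
have [G [oO AO Ooo OA]] := open_hull n0 LA.
apply: sub_ae_trans OA; apply: sub_ae_bigcap => k.
pose Q := G k `&` refl u @^-1` G k.
have oQ : open Q.
  by apply: openI => //; apply: open_comp => // x _; exact: refl_continuous.
have Qoo : (mu Q < +oo)%E.
  by apply: le_lt_trans (Ooo k); apply: le_lebesgue_outer; exact: subIsetl.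
have symQ : refl u @^-1` Q = Q by rewrite /Q preimage_setI rK setIC.
have LQ := Lset_open oQ Qoo.
apply: (@sub_ae_trans _ _ _ (D Q)).
  apply: Dmono => //; apply: sub_ae_sub => x Ax; split; first exact: AO.
  by apply: AO; rewrite -[A]symA /= in Ax.
apply: (@sub_ae_trans _ _ _ Q); last by apply: sub_ae_sub => x [].
by apply: D_rev => //; [case: LQ|exact: open_sym].
Qed.

Let D_sub_sym A : Lset A -> sub_ae (D A) (A `|` refl u @^-1` A).
Proof.
move=> LA; have LU := LsetU LA (Lset_refl LA).
have sU : refl u @^-1` (A `|` refl u @^-1` A) = A `|` refl u @^-1` A.
  by rewrite preimage_setU rK setUC.
have [_ h] := D_symmetric LU sU.
by apply: sub_ae_trans h; apply: Dmono => //; apply: sub_ae_sub; left.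
Qed.

(** The image of a ball off the hyperplane splits between the ball and its
    reflection; the perimeter forces it to be one of the two. *)
Lemma D_ball c r : 0 < r -> r < `|dotp c u| ->
  sub_ae (eball c r) (D (eball c r)) \/
  sub_ae (refl u @^-1` eball c r) (D (eball c r)).
Proof.
move=> r0 cr; set B := eball c r; set E := D B.
have LB : Lset B by exact: Lset_eball.
have [mE Eoo] : Lset E by exact: DL.
have c12 : 2 * r < enorm (c - refl u c).
  by rewrite /refl opprB addrC subrK enormZ hu mulr1 normrM ger0_norm// ltr_pM2l.
have EB := D_sub_sym LB; rewrite -/E in EB.
have EP : (perimeter E <= (n%:R / r * fine (mu E))%:E)%E.
  by rewrite Dper// /E Dmu//; exact: perimeter_eball_le.
have B'E : refl u @^-1` B = eball (refl u c) r by rewrite refl_eball.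
rewrite B'E in EB *.
have [h1|h1] := ball_dichotomy n0 r0 c12 mE Eoo EB EP; last by left.
right; rewrite -B'E; apply: D_rev' => //; first exact: Lset_refl.
  by rewrite lebesgue_outer_refl.
rewrite B'E; apply: null_sub (nullU EB h1) => x [Ex nB'].
have [Bx|nBx] := pselect (B x); first by right.
by left; split=> // -[].
Qed.

Let W : set 'rV[R]_n := [set x | 0 < dotp x u].

Let open_W : open W.
Proof.
rewrite (_ : W = (dotp^~ u) @^-1` [set t | 0 < t])//.
by apply: open_comp => [x _|]; [exact: dotp_continuous|exact: open_gt].
Qed.

Let ball_in_W c r : 0 <= r -> eball c r `<=` W -> r < dotp c u.
Proof.
move=> r0 cW; have cu : 0 < dotp c u by apply: cW; rewrite /eball/= subrr enorm0.
rewrite -[ltRHS]ger0_norm ?(ltW cu)//; apply: eball_off_hyperplane => // x /cW.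
by rewrite /W/= => /lt0r_neq0.
Qed.

Let eball_sub_W c r : r < dotp c u -> eball c r `<=` W.
Proof.
move=> cr x xc; rewrite /W/=.
have := dotp_le_enorm (c - x) u; rewrite hu mulr1 dotpBl enorm_distC => h.
by have := le_trans h xc; lra.
Qed.

(** Large balls that nearly touch the hyperplane exhaust the half-space: m is the
    distance of the two given balls from the hyperplane, and M bounds the norms
    of their points. *)
Let big_ball c1 r1 c2 r2 : 0 < r1 -> 0 < r2 -> r1 < dotp c1 u -> r2 < dotp c2 u ->
  exists c (r : R), [/\ 0 < r, r < dotp c u, eball c1 r1 `<=` eball c r &
    eball c2 r2 `<=` eball c r].
Proof.
move=> r10 r20 cr1 cr2.
pose m := minr (dotp c1 u - r1) (dotp c2 u - r2).
pose M := maxr (enorm c1 + r1) (enorm c2 + r2).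
have m0 : 0 < m by rewrite lt_min !subr_gt0 cr1 cr2.
pose t := M ^+ 2 / m + m.
have Mm0 : 0 <= M ^+ 2 / m by rewrite divr_ge0 ?sqr_ge0// ltW.
have key c r : m <= dotp c u - r -> enorm c + r <= M -> 0 < r ->
    eball c r `<=` eball (t *: u) (t - m / 2).
  move=> mc cM r0 x xc.
  have x1 : m <= dotp x u.
    have := dotp_le_enorm (c - x) u; rewrite hu mulr1 dotpBl enorm_distC => h.
    by have := le_trans h xc; lra.
  have x2 : enorm x <= M.
    rewrite -[x](subrK c); apply: le_trans (enormD _ _) _.
    by apply: le_trans cM; rewrite addrC lerD2l.
  have M0 : 0 <= M by apply: le_trans x2; exact: enorm_ge0.
  have tm : 0 <= t - m / 2 by rewrite /t; lra.
  apply/eball_sqr => //; rewrite !dotpE (dotpuu hu) (dotpC u x) -sqr_enorm.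
  have x3 : enorm x ^+ 2 <= M ^+ 2 by rewrite lerXn2r ?nnegrE ?enorm_ge0.
  have tE : t * m = M ^+ 2 + m ^+ 2 by rewrite /t mulrDl divfK ?gt_eqF// expr2.
  have t0 : 0 <= t by rewrite /t; lra.
  have x4 : t * m <= t * dotp x u by rewrite ler_wpM2l.
  by move: x3 tE x4; nra.
exists (t *: u), (t - m / 2); split.
- by rewrite /t; lra.
- by rewrite dotpZl (dotpuu hu); lra.
- by apply: key => //; rewrite ?ge_min ?le_max lexx.
- by apply: key => //; rewrite ?ge_min ?le_max lexx ?orbT.
Qed.

(** The choice between a ball and its reflection is the same for two balls of
    the half-space, because it is inherited from any ball that contains both. *)
Lemma half_space_choice :
  (forall c r, 0 < r -> eball c r `<=` W -> sub_ae (eball c r) (D (eball c r))) \/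
  (forall c r, 0 < r -> eball c r `<=` W ->
     sub_ae (refl u @^-1` eball c r) (D (eball c r))).
Proof.
have [|/existsNP[c0 /existsNP[r0 /not_implyP[r00 /not_implyP[c0W h0]]]]] := pselect
  (forall c r, 0 < r -> eball c r `<=` W -> sub_ae (eball c r) (D (eball c r))).
  by left.
right=> c r rpos cW.
have cr0 := ball_in_W (ltW r00) c0W; have cr := ball_in_W (ltW rpos) cW.
have [c1 [r1 [r10 cr1 s0 s]]] := big_ball r00 rpos cr0 cr.
have c1W := eball_sub_W cr1.
have cr1' : r1 < `|dotp c1 u| by apply: lt_le_trans cr1 (ler_norm _).
have L1 := Lset_eball c1 r1.
have L := Lset_eball c r; have L0 := Lset_eball c0 r0.
have inW x : W (refl u x) -> ~ W x.
  by rewrite /W/= dotp_refl_u// => h1 h2; lra.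
have [h1|h1] := D_ball r10 cr1'.
  exfalso; apply: h0; apply: D_rev' => //.
  have h2 : sub_ae (D (eball c1 r1)) (eball c1 r1) by apply: D_rev => //; case: L1.
  have h3 := sub_ae_trans (Dmono L0 L1 (sub_ae_sub s0)) h2.
  apply: sub_ae_trans (sub_aeI h3 (D_sub_sym L0)) _.
  by apply: sub_ae_sub => x [/c1W xW []] // /c0W/inW /(_ xW).
have h2 : sub_ae (D (eball c1 r1)) (refl u @^-1` eball c1 r1).
  apply: D_rev => //; last by rewrite lebesgue_outer_refl.
  by have [] := Lset_refl L1.
apply: D_rev' => //; first exact: Lset_refl; first by rewrite lebesgue_outer_refl.
have h3 := sub_ae_trans (Dmono L L1 (sub_ae_sub s)) h2.
apply: sub_ae_trans (sub_aeI h3 (D_sub_sym L)) _.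
by apply: sub_ae_sub => x [/c1W/inW xW []] // /cW.
Qed.

Lemma half_space_sets :
  (forall A, Lset A -> A `<=` W -> sub_ae A (D A)) \/
  (forall A, Lset A -> A `<=` W -> sub_ae (refl u @^-1` A) (D A)).
Proof.
have [h|h] := half_space_choice; [left|right] => A LA AW.
  exact: (@sets_of_balls id _ _ _ W open_W h A LA AW).
apply: (@sets_of_balls (refl u) (reflK hu) _ _ W open_W h A LA AW).
  by move=> B; rewrite lebesgue_outer_refl.
by move=> B; exact: measurable_refl.
Qed.

End with_reflection.

End set_maps.

(** * Polarization of sets and the four cases *)

Section polarized_sets.
Context {R : realType} {n : nat} (n0 : (0 < n)%N).
Local Notation mu := (@lebesgue_outer R n).
Implicit Types (A B : set 'rV[R]_n) (u x : 'rV[R]_n).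

Definition polset u A : set 'rV[R]_n := [set x |
  if 0 <= dotp x u then A x \/ A (refl u x) else A x /\ A (refl u x)].

Let half u : set 'rV[R]_n := [set x | 0 <= dotp x u].

Let measurable_half u : measurable (half u : set (Rn R n)).
Proof.
apply: closed_measurable_rV.
rewrite (_ : half u = (dotp^~ u) @^-1` [set t | 0 <= t])//.
by apply: closed_comp => [x _|]; [exact: dotp_continuous|exact: closed_ge].
Qed.

Variables (u : 'rV[R]_n) (hu : enorm u = 1).

Let polsetE A : polset u A = (half u `&` (A `|` refl u @^-1` A)) `|`
  (~` half u `&` (A `&` refl u @^-1` A)).
Proof.
apply/seteqP; split=> x; rewrite /polset /half /=.
  by case: ifPn => [h|/negP h]; [left|right].
by move=> [[-> //]|[/negP/negbTE ->]].
Qed.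

Lemma measurable_polset A : measurable (A : set (Rn R n)) ->
  measurable (polset u A : set (Rn R n)).
Proof.
move=> mA; rewrite polsetE; have mA' := measurable_refl n0 hu mA.
apply: measurableU; apply: measurableI.
- exact: measurable_half.
- exact: measurableU.
- exact/measurableC/measurable_half.
- exact: measurableI.
Qed.

(** Reflecting the part of A in the negative half-space whose mirror image is
    not in A turns A into its polarization. *)
Lemma le_polset A : measurable (A : set (Rn R n)) -> (mu A <= mu (polset u A))%E.
Proof.
move=> mA; have mA' := measurable_refl n0 hu mA.
have mH := measurable_half u.
rewrite [leLHS](mH _) [leRHS](mH _).
have -> : polset u A `&` half u = (A `|` refl u @^-1` A) `&` half u.
  apply/seteqP; split=> x; rewrite /polset /half /=.
    by case: ifP => // _ [].
  by move=> [h ->].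
have -> : polset u A `&` ~` half u = (A `&` refl u @^-1` A) `&` ~` half u.
  apply/seteqP; split=> x; rewrite /polset /half /=.
    by case: ifPn => [h [_]|h []].
  by move=> [h /negP/negbTE ->]; split.
rewrite [X in (_ + X <= _)%E](mA' _) [X in (_ <= X + _)%E](mA _).
rewrite (_ : A `&` ~` half u `&` refl u @^-1` A =
  A `&` refl u @^-1` A `&` ~` half u); last by rewrite setIAC.
rewrite (_ : (A `|` refl u @^-1` A) `&` half u `&` A = A `&` half u); last first.
  by apply/seteqP; split=> x [] => [[_ xu] Ax|Ax xu] //; split => //; split => //; left.
rewrite -!addeA leeD2l// [leLHS]addeC; apply: leeD => //.
rewrite -[leLHS](lebesgue_outer_refl n0 hu); apply: le_lebesgue_outer.
move=> x [[/= Ax hx] nA]; rewrite /= in hx *; rewrite reflK// in nA.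
split; last exact: nA.
split; first by right.
by move: hx; rewrite /half/= dotp_refl_u// oppr_ge0 => /negP; rewrite -ltNge => /ltW.
Qed.

End polarized_sets.

Section classification.
Context {R : realType} {n : nat} (n0 : (0 < n)%N).
Local Notation mu := (@lebesgue_outer R n).
Implicit Types (A B O : set 'rV[R]_n) (c x u : 'rV[R]_n).

Variable D : set 'rV[R]_n -> set 'rV[R]_n.
Hypothesis DL : forall A, Lset A -> Lset (D A).
Hypothesis Dmu : forall A, Lset A -> mu (D A) = mu A.
Hypothesis Dmono : forall A B, Lset A -> Lset B -> sub_ae A B ->
  sub_ae (D A) (D B).
Variables (u : 'rV[R]_n) (hu : enorm u = 1).
Hypothesis Dsym : forall c r, 0 < r -> r < `|dotp c u| ->
  sub_ae (eball c r `|` refl u @^-1` eball c r)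
         (D (eball c r `|` refl u @^-1` eball c r)).
Hypothesis Dper : forall c r, 0 < r ->
  perimeter (D (eball c r)) = perimeter (eball c r).

Let hNu : enorm (- u) = 1. Proof. by rewrite enormN. Qed.

Let reflNu : refl (- u) = refl u.
Proof. by apply/funext => x; exact: refl_opp. Qed.

Let DsymN c r : 0 < r -> r < `|dotp c (- u)| ->
  sub_ae (eball c r `|` refl (- u) @^-1` eball c r)
         (D (eball c r `|` refl (- u) @^-1` eball c r)).
Proof. by rewrite reflNu dotpNr normrN; exact: Dsym. Qed.

Let pos : set 'rV[R]_n := [set x | 0 < dotp x u].
Let neg : set 'rV[R]_n := [set x | 0 < dotp x (- u)].

Let measurable_pos v : measurable ([set x | 0 < dotp x v] : set (Rn R n)).
Proof.
apply: open_measurable_rV.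
rewrite (_ : mkset _ = (dotp^~ v) @^-1` [set t | 0 < t])//.
by apply: open_comp => [x _|]; [exact: dotp_continuous|exact: open_gt].
Qed.

Let LI A v : Lset A -> Lset (A `&` [set x | 0 < dotp x v]).
Proof.
move=> LA; apply: (Lset_sub _ LA (@subIsetl _ _ _)).
by apply: measurableI; [case: LA|exact: measurable_pos].
Qed.

Let parts_sub A v B : Lset A -> (Lset (A `&` [set x | 0 < dotp x v]) ->
    sub_ae B (D (A `&` [set x | 0 < dotp x v]))) -> sub_ae B (D A).
Proof.
move=> LA h; apply: sub_ae_trans (h (LI v LA)) _.
by apply: Dmono => //; [exact: LI|apply: sub_ae_sub; exact: subIsetl].
Qed.

Let off_sub A B C : (forall x, A x -> 0 < dotp x u -> B x) ->
  (forall x, A x -> 0 < dotp x (- u) -> C x) -> forall S,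
  sub_ae B S -> sub_ae C S -> sub_ae A S.
Proof.
move=> AB AC S BS CS.
apply: null_sub (nullU (null_hyperplane n0 hu) (sub_aeU BS CS)) => x [Ax nS].
have [xu|xu|xu] := ltgtP (dotp x u) 0; last by left.
  by right; split=> //; right; apply: AC => //; rewrite dotpNr oppr_gt0.
by right; split=> //; left; apply: AB.
Qed.

(** This handles the half-space in which a polarization keeps only the points
    whose mirror image is in A as well. *)
Let sym_core A : Lset A -> sub_ae (A `&` refl u @^-1` A) (D A).
Proof.
move=> LA; pose C := A `&` refl u @^-1` A.
have LC : Lset C.
  apply: (Lset_sub _ LA (@subIsetl _ _ _)); apply: measurableI; first by case: LA.
  by apply: measurable_refl => //; case: LA.
have sC : refl u @^-1` C = C.
  by apply/seteqP; split=> x [/=]; rewrite /C /= ?reflK// => ? ?; split=> //=; rewrite ?reflK.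
have [h _] := D_symmetric n0 DL Dmu Dmono hu Dsym LC sC.
apply: sub_ae_trans h _; apply: Dmono => //; apply: sub_ae_sub; exact: subIsetl.
Qed.

(** In each of the two open half-spaces, independently, either all sets stay in
    place or all of them are reflected. *)
Lemma D_classification : [\/ forall A, Lset A -> sub_ae A (D A),
  forall A, Lset A -> sub_ae (refl u @^-1` A) (D A),
  forall A, Lset A -> sub_ae (polset u A) (D A) |
  forall A, Lset A -> sub_ae (polset (- u) A) (D A)].
Proof.
have hp := half_space_sets n0 DL Dmu Dmono hu Dsym Dper.
have hn := half_space_sets n0 DL Dmu Dmono hNu DsymN Dper.
rewrite reflNu in hn.
case: hp => hp; case: hn => hn.
- constructor 1 => A LA; apply: (@off_sub _ (A `&` pos) (A `&` neg)) => //.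
  + by apply: (@parts_sub _ u) => // h; apply: hp => // x [].
  + by apply: (@parts_sub _ (- u)) => // h; apply: hn => // x [].
- constructor 3 => A LA.
  apply: (@off_sub _ ((A `&` pos) `|` refl u @^-1` (A `&` neg))
    (A `&` refl u @^-1` A)).
  + move=> x; rewrite /polset/= => + xu; rewrite (ltW xu) => -[Ax|Ax]; [left|right] => //.
    by split => //; rewrite /neg/= dotpNr dotp_refl_u// opprK.
  + move=> x; rewrite /polset/= dotpNr oppr_gt0 => + xu.
    by rewrite leNgt xu.
  + apply: sub_aeU.
      by apply: (@parts_sub _ u) => // h; apply: hp => // x [].
    by apply: (@parts_sub _ (- u)) => // h; apply: hn => // x [].
  + exact: sym_core.
- constructor 4 => A LA.
  apply: (@off_sub _ (A `&` refl u @^-1` A)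
    ((A `&` neg) `|` refl u @^-1` (A `&` pos))).
  + by move=> x; rewrite /polset/= dotpNr oppr_ge0 leNgt reflNu => + xu; rewrite xu.
  + move=> x; rewrite /polset/= => + xu; rewrite (ltW xu) reflNu => -[Ax|Ax]; [left|right] => //.
    by split => //; rewrite /pos/= dotp_refl_u// -dotpNr.
  + exact: sym_core.
  + apply: sub_aeU.
      by apply: (@parts_sub _ (- u)) => // h; apply: hn => // x [].
    by apply: (@parts_sub _ u) => // h; apply: hp => // x [].
- constructor 2 => A LA.
  apply: (@off_sub _ (refl u @^-1` (A `&` neg)) (refl u @^-1` (A `&` pos))).
  + by move=> x Ax xu; split => //; rewrite /neg/= dotpNr dotp_refl_u// opprK.
  + by move=> x Ax xu; split => //; rewrite /pos/= dotp_refl_u// -dotpNr.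
  + by apply: (@parts_sub _ (- u)) => // h; apply: hn => // x [].
  + by apply: (@parts_sub _ u) => // h; apply: hp => // x [].
Qed.

End classification.

(** * Rearrangements of functions *)

Section balls_as_bodies.
Context {R : realType} {n : nat}.

Lemma eball_convex_body (c : 'rV[R]_n) (r : R) : 0 < r -> convex_body (eball c r).
Proof.
move=> r0; split; first exact: compact_eball.
  move=> x y l; rewrite !inE /eball/= => xc yc.
  pose t : R := l%:num.
  have -> : conv l x y = t *: (x : 'rV[R]_n) + (1 - t) *: (y : 'rV[R]_n) by [].
  have t0 : 0 <= t by rewrite /t; exact: ge0.
  have t1 : 0 <= 1 - t by rewrite /t subr_ge0; exact: le1.
  have -> : t *: (x : 'rV[R]_n) + (1 - t) *: (y : 'rV[R]_n) - c =
      t *: ((x : 'rV[R]_n) - c) + (1 - t) *: ((y : 'rV[R]_n) - c).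
    by apply/rowP => i; rewrite !mxE; ring.
  apply: le_trans (enormD _ _) _; rewrite !enormZ !ger0_norm//.
  have := ler_wpM2l t0 xc; have := ler_wpM2l t1 yc.
  by lra.
by exists c; exact: nbhs_eball.
Qed.

Lemma eball_refl_symmetric (u c : 'rV[R]_n) (r : R) : enorm u = 1 -> 0 < r ->
  r < `|dotp c u| ->
  symmetric_two_balls u (eball c r `|` refl u @^-1` eball c r).
Proof.
move=> hu r0 cr; split.
  exists (eball c r), (refl u @^-1` eball c r); split => //.
  - by exists c, r.
  - by exists (refl u c), r => //; rewrite refl_eball.
  - apply/seteqP; split=> // x [/= xc xc'].
    have h y : eball c r y -> `|dotp y u - dotp c u| <= r.
      rewrite /eball/= -dotpBl => yc; rewrite ler_norml.
      have := dotp_le_enorm (y - c) u; have := dotp_le_enorm (- (y - c)) u.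
      by rewrite enormN hu mulr1 dotpNl => h1 h2; apply/andP; split; lra.
    have := h _ xc; have := h _ xc'; rewrite dotp_refl_u// !ler_norml.
    move=> /andP[h1 h2] /andP[h3 h4]; move: cr; rewrite ltNge => /negP; apply.
    by rewrite ler_norml; apply/andP; split; lra.
apply/seteqP; split=> [_ [x [xc|xc] <-]|x].
- by right; rewrite /= reflK.
- by left.
- move=> [xc|xc]; exists (refl u x); rewrite ?reflK//; [right|left] => //=.
  by rewrite reflK.
Qed.

End balls_as_bodies.

Section function_classes.
Context {R : realType} {n : nat}.
Local Notation mu := (@lebesgue_outer R n).
Implicit Types (f g : 'rV[R]_n -> R).

Definition above f (t : R) : set 'rV[R]_n := [set x | t < f x].

Definition meas f := measurable_fun [set: Rn R n] (f : Rn R n -> R).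

Lemma measurable_above f t : meas f -> measurable (above f t : set (Rn R n)).
Proof.
move=> mf; have := mf measurableT _ (@measurable_itv R `]t, +oo[).
rewrite setTI (_ : _ @^-1` _ = above f t)//.
by apply/seteqP; split=> x; rewrite /above /= in_itv/= andbT.
Qed.

(** The form in which both classes enter: a threshold whose superlevel set has
    infinite measure does not exceed the essential infimum. *)
Lemma class_above X f : X = class_S \/ X = class_V -> X f -> meas f /\
  forall t, (mu (above f t) < +oo)%E \/ null [set x | f x < t].
Proof.
move=> [->|->].
  move=> [mf hf]; split=> // t.
  have [h|h] := ltP (ess_inf (@lebesgue_n R n) (EFin \o f)) t%:E; first by left; exact: hf.
  right; move/ess_infP: h => /aeP; apply: null_sub => x /=.
  by rewrite lee_fin => h1 h2; move: h1; rewrite ltNge h2.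
move=> [mf f0 hf]; split=> // t; have [t0|t0] := ltP 0 t; first by left; exact: hf.
right; apply: null_sub null0 => x /= ft.
by have := le_lt_trans (f0 x) (lt_le_trans ft t0); rewrite ltxx.
Qed.

Lemma class_S_intro f : meas f ->
  (forall t, (mu (above f t) < +oo)%E \/ null [set x | f x < t]) -> class_S f.
Proof.
move=> mf h; split=> // t et; have [//|f0] := h t.
exfalso; move: et; rewrite ltNge => /negP; apply; apply/ess_infP/aeP.
by apply: null_sub f0 => x /=; rewrite lee_fin => /negP; rewrite -ltNge.
Qed.

Lemma class_nonneg X f : X = class_S \/ X = class_V -> meas f ->
  (forall x, 0 <= f x) -> (forall t, 0 < t -> (mu (above f t) < +oo)%E) -> X f.
Proof.
move=> [->|->] mf f0 hf; last by split.
apply: class_S_intro => // t; have [t0|t0] := ltP 0 t; first by left; exact: hf.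
right; apply: null_sub null0 => x /= ft.
by have := le_lt_trans (f0 x) (lt_le_trans ft t0); rewrite ltxx.
Qed.

Definition eqae (A B : set 'rV[R]_n) := sub_ae A B /\ sub_ae B A.

Lemma eqae_sym A B : eqae A B -> eqae B A. Proof. by case. Qed.

Lemma eqae_trans A B C : eqae A B -> eqae B C -> eqae A C.
Proof. by move=> [h1 h2] [h3 h4]; split; [apply: sub_ae_trans h3|apply: sub_ae_trans h2]. Qed.

End function_classes.

Section rearrangements.
Context {R : realType} {n : nat}.
Local Notation mu := (@lebesgue_outer R n).
Implicit Types (f g : 'rV[R]_n -> R) (A B : set 'rV[R]_n).

Variables (X : set ('rV[R]_n -> R)) (hX : X = class_S \/ X = class_V).
Variables (T : ('rV[R]_n -> R) -> ('rV[R]_n -> R)) (hT : rearrangement X T).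

Let mT f : X f -> meas (T f).
Proof. by have [TX _ _] := hT => /TX /(class_above hX)[]. Qed.

Let T_above f t : X f -> mu (above (T f) t) = mu (above f t).
Proof. by have [_ Te _] := hT => Xf; exact: Te. Qed.

Let sub_le f g t : ess_le f g -> sub_ae (above f t) (above g t).
Proof.
move=> /aeP; apply: null_sub => x [/= fx gx] h; apply: gx.
exact: lt_le_trans h.
Qed.

(** By monotonicity one of the superlevel sets contains the other, and their
    finite measures agree. *)
Let T_common f g t : X f -> X g -> (forall x, f x <= g x) ->
  above f t = above g t -> (mu (above g t) < +oo)%E ->
  eqae (above (T f) t) (above (T g) t).
Proof.
move=> Xf Xg fg E fin; have [_ _ Tm] := hT.
have h : sub_ae (above (T f) t) (above (T g) t).
  by apply: sub_le; apply: Tm => //; apply: aeW.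
split=> //; apply: sub_ae_rev h; first exact/measurable_above/mT.
  by rewrite T_above.
by rewrite !T_above// E.
Qed.

(** If f takes no value in ]s, t], then T f takes none almost everywhere. *)
Let T_nested f s t : X f -> s <= t -> above f s = above f t ->
  (mu (above f t) < +oo)%E -> eqae (above (T f) s) (above (T f) t).
Proof.
move=> Xf st E fin.
have h : sub_ae (above (T f) t) (above (T f) s).
  by apply: sub_ae_sub => x; exact: le_lt_trans.
split=> //; apply: sub_ae_rev h; first exact/measurable_above/mT.
  by rewrite T_above// E.
by rewrite !T_above// E.
Qed.

(** The functions that lead from f to the indicator of its superlevel set A. *)
Let two (a c : R) A : 'rV[R]_n -> R := fun x => a + (c - a) * \1_A x.

Let two_in a c A x : A x -> two a c A x = c.
Proof. by move=> Ax; rewrite /two indicE mem_set// mulr1 subrKC. Qed.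

Let two_out a c A x : ~ A x -> two a c A x = a.
Proof. by move=> Ax; rewrite /two indicE memNset// mulr0 addr0. Qed.

Let meas_two a c A : Lset A -> meas (two a c A).
Proof.
move=> [mA _]; apply: measurable_funD; first exact: measurable_cst.
by apply: measurable_funM; [exact: measurable_cst|exact: measurable_indic].
Qed.

Let above_two a c A s : a <= s -> s < c -> above (two a c A) s = A.
Proof.
move=> as_ sc; apply/seteqP; split=> x; rewrite /above/=.
  have [//|nA] := pselect (A x); rewrite two_out// => sa.
  by have := lt_le_trans sa as_; rewrite ltxx.
by move=> Ax; rewrite two_in.
Qed.

Let above_two_sub a c A s : a <= s -> above (two a c A) s `<=` A.
Proof.
move=> as_ x; rewrite /above/=; have [//|nA] := pselect (A x).
by rewrite two_out// => sa; have := lt_le_trans sa as_; rewrite ltxx.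
Qed.

Let fin_sub A B : B `<=` A -> Lset A -> (mu B < +oo)%E.
Proof. by move=> BA [_]; apply: le_lt_trans; exact: le_lebesgue_outer. Qed.

Let X_two a c A : Lset A -> 0 <= a <= c \/ (X = class_S /\ a <= c) ->
  a <= 0 -> X (two a c A).
Proof.
move=> LA hac a0.
have two_ge x : a <= c -> a <= two a c A x.
  by move=> ac; have [Ax|Ax] := pselect (A x); [rewrite two_in|rewrite two_out].
case: hac => [/andP[a0' ac]|[-> ac]].
  apply: (class_nonneg hX); first exact: meas_two.
    by move=> x; apply: le_trans a0' (two_ge x ac).
  move=> t t0; apply: fin_sub LA; apply: above_two_sub.
  exact: le_trans a0 (ltW t0).
apply: class_S_intro; first exact: meas_two.
move=> t; have [at_|ta] := leP a t; first by left; apply: fin_sub LA; exact: above_two_sub.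
right; apply: null_sub null0 => x /=.
by rewrite ltNge (le_trans (ltW ta))// two_ge.
Qed.

Let indicE_two A : \1_A = two 0 1 A.
Proof. by apply/funext => x; rewrite /two add0r subr0 mul1r. Qed.

Let X_indic A : Lset A -> X \1_A.
Proof.
by move=> LA; rewrite indicE_two; apply: X_two => //; left; rewrite lexx ler01.
Qed.

(** The values of the image of an indicator lie in {0, 1} up to null sets, apart
    from negative values: the interval between 0 and 1 is excluded by the level
    sets, and so is everything above 1. *)
Lemma diamond_above A : Lset A -> eqae (diamond T A) (above (T \1_A) 0).
Proof.
move=> LA; have XA := X_indic LA; have [mA Aoo] := LA.
have E s : 0 <= s -> s < 1 -> above \1_A s = A.
  by rewrite indicE_two; exact: above_two.
split; first by apply: sub_ae_sub => x; rewrite /diamond /above /= => ->.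
have top : null (above (T \1_A) 1).
  rewrite /null T_above// (_ : above \1_A 1 = set0) ?lebesgue_outer0//.
  apply/seteqP; split=> // x; rewrite /above /=.
  by rewrite indicE; case: (x \in A); rewrite ?ltxx// ltr10.
have h k : null (above (T \1_A) 0 `\` above (T \1_A) (1 - k.+1%:R^-1)).
  have k1 : 0 <= 1 - k.+1%:R^-1 :> R by rewrite subr_ge0 invf_le1 ?ltr0n// ler1n.
  have k2 : 1 - k.+1%:R^-1 < 1 :> R by rewrite ltrBlDr ltrDl invr_gt0.
  have [] : eqae (above (T \1_A) 0) (above (T \1_A) (1 - k.+1%:R^-1)).
    by apply: T_nested; rewrite ?E.
  by [].
apply: null_sub (nullU top (null_bigcup h)) => x [/= x0 x1].
have [t1|t1|t1] := ltgtP (T \1_A x) 1; [right|by left|by exfalso; apply: x1].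
have e0 : 0 < 1 - T \1_A x by rewrite subr_gt0.
have [k _ /(_ _ (leqnn k)) ke] := near_infty_natSinv_lt (PosNum e0).
exists k => //; split => //; rewrite /above /= => hk.
  have {}ke : k.+1%:R^-1 < 1 - T \1_A x by exact: ke.
  by move: ke hk; set a := k.+1%:R^-1; lra.
Qed.

(** The superlevel sets of T f are the images of those of f: truncations of f
    and functions with two values lead from f to the indicator of the superlevel
    set, through comparable functions with that superlevel set. *)
Lemma above_diamond f t : X f -> (mu (above f t) < +oo)%E ->
  (X = class_V -> 0 <= t) ->
  eqae (above (T f) t) (diamond T (above f t)).
Proof.
move=> Xf fin Vt; set A := above f t.
have [mf hf] := class_above hX Xf.
have LA : Lset A by split => //; exact: measurable_above.
pose a : R := minr t 0; pose c : R := maxr t 0 + 1.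
have at_ : a <= t by rewrite ge_min lexx.
have a0 : a <= 0 by rewrite ge_min lexx orbT.
have tc : t < c by rewrite ltr_pwDr// le_max lexx.
have c1 : 1 <= c by rewrite lerDr le_max lexx orbT.
have ac : a <= c by apply: le_trans a0 (le_trans ler01 c1).
have hac : 0 <= a <= c \/ (X = class_S /\ a <= c).
  case: hX => hX'; first by right.
  by left; rewrite ac andbT le_min lexx andbT Vt.
(* Then h lies below f and g, g is comparable with the indicator of A, and all
   of them have the superlevel set A at a suitable level. *)
pose g := two a c A; pose h x := minr (f x) (g x).
have Xg : X g by exact: X_two.
have above_h s : above h s = above f s `&` above g s.
  by apply/seteqP; split=> x; rewrite /above /h /= lt_min => /andP.
have mh : meas h by apply: measurable_minr => //; exact: meas_two.
have above_g s : a <= s -> above g s `<=` A by exact: above_two_sub.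
have Xh : X h.
  case: hX => hX'.
    rewrite hX'; apply: class_S_intro => // s; have [as_|sa] := leP a s.
      by left; apply: fin_sub LA; rewrite above_h => x [_]; exact: above_g.
    case: (hf s) => [hs|hs]; [left|right].
      rewrite above_h; apply: le_lt_trans hs; apply: le_lebesgue_outer; exact: subIsetl.
    apply: null_sub hs => x; rewrite /h /= gt_min => /orP[//|].
    have : a <= g x by have [Ax|Ax] := pselect (A x); [rewrite /g two_in|rewrite /g two_out].
    by move=> ag gs; have := le_lt_trans ag gs; rewrite ltNge (ltW sa).
  have [_ f0 _] : class_V f by rewrite -hX'.
  have a_0 : a = 0 by rewrite /a min_r// Vt.
  apply: (class_nonneg hX) => //.
    move=> x; rewrite le_min f0 /= -a_0.
    by have [Ax|Ax] := pselect (A x); [rewrite /g two_in|rewrite /g two_out].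
  move=> s s0; apply: fin_sub LA; rewrite above_h => x [_]; apply: above_g.
  by rewrite a_0 ltW.
have gA s : a <= s -> s < c -> above g s = A by exact: above_two.
have hA : above h t = A by rewrite above_h gA// -/A setIid.
have e1 : eqae (above (T h) t) (above (T f) t).
  by apply: T_common => // x; rewrite /h ge_min lexx.
have e2 : eqae (above (T h) t) (above (T g) t).
  apply: T_common => //; first by move=> x; rewrite /h ge_min lexx orbT.
    by rewrite hA gA.
  by rewrite gA.
have e3 : eqae (above (T g) t) (above (T g) 0).
  have c0 : 0 < c by apply: lt_le_trans c1.
  have [t0|/ltW t0] := leP 0 t.
    by apply: eqae_sym; apply: T_nested => //; rewrite !gA.
  by apply: T_nested => //; rewrite !gA.
have e4 : eqae (above (T g) 0) (above (T \1_A) 0).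
  have c0 : 0 < c by apply: lt_le_trans c1.
  have iA : above \1_A 0 = A by rewrite indicE_two above_two.
  have [t0|/ltW t0] := leP 0 t.
    apply: eqae_sym; apply: T_common; rewrite ?iA ?gA//; first exact: X_indic.
    move=> x; rewrite indicE_two /g; have [Ax|Ax] := pselect (A x).
      by rewrite !two_in.
    by rewrite !two_out// /a min_r.
  apply: T_common; rewrite ?iA ?gA//; first exact: X_indic.
  move=> x; rewrite indicE_two /g; have [Ax|Ax] := pselect (A x).
    by rewrite !two_in// /c max_r// add0r.
  by rewrite !two_out.
apply: eqae_trans (eqae_sym e1) _; apply: eqae_trans e2 _.
apply: eqae_trans e3 _; apply: eqae_trans e4 _.
exact/eqae_sym/diamond_above.
Qed.

Lemma diamond_Lset A : Lset A -> Lset (diamond T A).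
Proof.
move=> LA; have XA := X_indic LA; have [h1 h2] := diamond_above LA.
split.
  have := mT XA measurableT (@measurable_set1 R 1).
  by rewrite setTI.
apply: le_lt_trans (sub_ae_le h1) _; rewrite T_above//.
by apply: fin_sub LA; rewrite indicE_two; exact: above_two_sub.
Qed.

Lemma diamond_mu A : Lset A -> mu (diamond T A) = mu A.
Proof.
move=> LA; have XA := X_indic LA; have [h1 h2] := diamond_above LA.
have E : mu (above (T \1_A) 0) = mu A by rewrite T_above// indicE_two above_two.
by apply/eqP; rewrite -E eq_le !sub_ae_le.
Qed.

Lemma diamond_mono A B : Lset A -> Lset B -> sub_ae A B ->
  sub_ae (diamond T A) (diamond T B).
Proof.
move=> LA LB AB; have [h1 _] := diamond_above LA; have [_ h2] := diamond_above LB.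
have [_ _ Tm] := hT.
apply: (sub_ae_trans h1); apply: sub_ae_trans h2; apply: sub_le.
apply: Tm; [exact: X_indic|exact: X_indic|].
apply/aeP; apply: null_sub AB => x /=; rewrite !indicE.
have [Ax|Ax] := pselect (A x); have [Bx|Bx] := pselect (B x);
  rewrite ?(mem_set Ax) ?(mem_set Bx) ?(memNset Ax) ?(memNset Bx) ?lexx ?ler01//.
Qed.

Hypothesis Too : mu [set: 'rV[R]_n] = +oo%E.

(** If T f and T0 f differ at a point, a rational number separates them there.
    At a rational level of finite measure the superlevel sets of T f and T0 f
    agree, since op A is contained in the diamond of A and is at least as large;
    a level of infinite measure is an essential lower bound of both. *)
Lemma ess_eq_map_of_sets (T0 : ('rV[R]_n -> R) -> ('rV[R]_n -> R))
  (op : set 'rV[R]_n -> set 'rV[R]_n) :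
  (forall f t, above (T0 f) t = op (above f t)) ->
  (forall f t, null [set x | f x < t] -> null [set x | T0 f x < t]) ->
  (forall A, measurable (A : set (Rn R n)) -> measurable (op A : set (Rn R n))) ->
  (forall A, measurable (A : set (Rn R n)) -> (mu A <= mu (op A))%E) ->
  (forall A, Lset A -> sub_ae (op A) (diamond T A)) ->
  ess_eq_map X T T0.
Proof.
move=> opE op0 mop muop opD f Xf.
have [mf hf] := class_above hX Xf.
have [TX _ _] := hT.
have [_ hTf] := class_above hX (TX _ Xf).
pose Z (q : rat) : set 'rV[R]_n := [set x | T f x < ratr q < T0 f x \/ T0 f x < ratr q < T f x].
have Znull q : null (Z q).
  have [fin|fin] := ltP (mu (above f (ratr q))) +oo%E; last first.
    case: (hf (ratr q)) => h1; first by move: h1; rewrite ltNge fin.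
    case: (hTf (ratr q)) => h2; first by move: h2; rewrite T_above// ltNge fin.
    apply: null_sub (nullU h2 (op0 _ _ h1)) => x [/andP[h _]|/andP[h _]];
      by [left|right].
  have Vq : X = class_V -> 0 <= ratr q :> R.
    move=> XV; rewrite leNgt; apply/negP => q0.
    have [_ f0 _] : class_V f by rewrite -XV.
    move: fin; rewrite (_ : above f (ratr q) = setT) ?Too ?ltxx//.
    by apply/seteqP; split=> // x _; exact: lt_le_trans q0 (f0 x).
  have LA : Lset (above f (ratr q)) by split=> //; exact: measurable_above.
  have [e1 e2] := above_diamond Xf fin Vq.
  have h1 := opD _ LA.
  have h2 : sub_ae (diamond T (above f (ratr q))) (op (above f (ratr q))).
    apply: sub_ae_rev h1; first by apply: mop; case: LA.
      by rewrite diamond_mu.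
    by rewrite diamond_mu//; apply: muop; case: LA.
  rewrite -opE in h1 h2.
  have h3 := sub_ae_trans e1 h2; have h4 := sub_ae_trans h1 e2.
  apply: null_sub (nullU h3 h4) => x [/andP[s1 s2]|/andP[s1 s2]]; [right|left];
    by split=> //; rewrite /above /= ltNge (ltW s1).
pose F k := if unpickle k is Some q then Z q else set0.
apply/aeP; apply: null_sub (null_bigcup (F := F) _).
  move=> x /= /eqP; rewrite neq_lt => xne.
  have [q Zq] : exists q, Z q x.
    case/orP: xne => h; have [q] := rat_in_itvoo h; rewrite in_itv/= => qx; exists q.
      by left.
    by right.
  by exists (pickle q); [|rewrite /F pickleK].
by move=> k; rewrite /F; case: unpickle => [q|]; [exact: Znull|exact: null0].
Qed.

End rearrangements.

Theorem theorem6p21 (R : realType) (n : nat) (hn : (2 <= n)%N)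
  (u : 'rV[R]_n) (hu : enorm u = 1)
  (X : set ('rV[R]_n -> R)) (hX : X = class_S \/ X = class_V)
  (T : ('rV[R]_n -> R) -> ('rV[R]_n -> R)) (hT : rearrangement X T)
  (hper : perimeter_preserving_on_convex_bodies (diamond T))
  (hinv : invariant_on_symmetric_two_balls u (diamond T)) :
  [\/ ess_eq_map X T id,
      ess_eq_map X T (reflf u),
      ess_eq_map X T (polarization u)
    | ess_eq_map X T (fun f => reflf u (polarization u f))].
Proof.
have n0 : (0 < n)%N by exact: ltn_trans hn.
have [Tnull|Too] := @lebesgue_outer_setT_dich R n n0.
  (* All functions are then equal almost everywhere. *)
  by constructor 1 => f _; apply/aeP; apply: null_sub Tnull.
have Dsym c (r : R) : 0 < r -> r < `|dotp c u| ->
  sub_ae (eball c r `|` refl u @^-1` eball c r)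
         (diamond T (eball c r `|` refl u @^-1` eball c r)).
  move=> r0 cr; have /aeP := hinv _ (eball_refl_symmetric hu r0 cr).
  by apply: null_sub => x [xK nD] /= h; apply: nD; exact/h.
have Dper c (r : R) : 0 < r -> perimeter (diamond T (eball c r)) = perimeter (eball c r).
  by move=> r0; have [_ ->] := hper _ (eball_convex_body c r0).
have pol_lt (v : 'rV[R]_n) f (t : R) : enorm v = 1 -> null [set x | f x < t] ->
    null [set x | polarization v f x < t].
  move=> hv f0; apply: null_sub (nullU f0 (null_refl n0 hv f0)) => x /=.
  rewrite /polarization; case: ifP => _; first by rewrite gt_max => /andP[]; left.
  by rewrite gt_min => /orP[]; [left|right].
have above_pol (v : 'rV[R]_n) f (t : R) : above (polarization v f) t = polset v (above f t).
  apply/seteqP; split=> x; rewrite /above /polset /polarization /=.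
    by case: ifP => _; [rewrite lt_max => /orP|rewrite lt_min => /andP].
  by case: ifP => _ h; [rewrite lt_max; exact/orP|rewrite lt_min; exact/andP].
have hNu : enorm (- u) = 1 by rewrite enormN.
have := D_classification n0 (diamond_Lset hX hT) (diamond_mu hX hT)
  (diamond_mono hX hT) hu Dsym Dper.
case=> h; [constructor 1|constructor 2|constructor 3|constructor 4].
- exact: (@ess_eq_map_of_sets _ _ _ hX _ hT Too id id (fun _ _ => erefl)
    (fun _ _ => id) (fun _ => id) (fun _ _ => lexx _) h).
- apply: (ess_eq_map_of_sets hX hT Too (op := fun A => refl u @^-1` A)) => //.
  + by move=> f t; exact: null_refl.
  + by move=> A; exact: measurable_refl.
  + by move=> A _; rewrite lebesgue_outer_refl.
- apply: (ess_eq_map_of_sets hX hT Too (op := polset u)) => //.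
  + by move=> f t; exact: pol_lt.
  + by move=> A; exact: measurable_polset.
  + by move=> A; exact: le_polset.
- (* Reflecting the polarization is polarizing towards the other side. *)
  have -> : (fun f => reflf u (polarization u f)) = polarization (- u).
    apply/funext => f; apply/funext => x.
    rewrite /reflf /polarization dotp_refl_u// reflK// refl_opp dotpNr.
    by case: ifP => _; [rewrite maxC|rewrite minC].
  apply: (ess_eq_map_of_sets hX hT Too (op := polset (- u))) => //.
  + by move=> f t; exact: pol_lt.
  + by move=> A; exact: measurable_polset.
  + by move=> A; exact: le_polset.
Qed.
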